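(* Let $\Phi$ be a normal random conformal graph directed Markov system (with finitely primitive shift space $E_A^\infty$). Then for $\mathbb P$-a.e. $\omega\in\Omega$ we have $$\dim_H(J_\omega)=\inf\{s\ge0:P(s\zeta)\le0\}.$$
   Context: Symbolic setting. $V$ is a finite set of vertices, $E$ a countable set of directed edges, $i,t:E\to V$ give the initial and terminal vertex, and $A:E\times E\to\{0,1\}$ satisfies $A_{e,e'}=1$ iff $t(e)=i(e')$. $E_A^\infty=\{\tau\in E^{\mathbb{N}\cup\{0\}}:A_{\tau_{n-1},\tau_n}=1\ \forall n\ge1\}$ with left shift $\sigma$; a finite word is admissible if all its consecutive letters satisfy $A=1$; $E_A^n$ is the set of admissible words of length $n$. Standing assumption: $E_A^\infty$ is finitely primitive, i.e. there are $N_A\ge1$ and a finite $\Lambda\subset E_A^{N_A}$ such that for all $e,e'\in E$ some $w\in\Lambda$ makes $e w e'$ admissible. Random base. $(\Omega,\mathcal F,\mathbb P)$ is a complete probability space, $\theta:\Omega\to\Omega$ is invertible, bimeasurable, $\mathbb P$-preserving and ergodic. RGDMS. $\{X_v\}_{v\in V}$ are non-empty compact subsets of $\mathbb R^d$, $d\ge1$. A random graph directed Markov system $\Phi=(\theta,\{\omega\mapsto\phi_{e,\omega}\}_{e\in E})$ consists of one-to-one maps $\phi_{e,\omega}:X_{t(e)}\to X_{i(e)}$, Lipschitz with constant at most a common $s_\Phi\in(0,1)$, with $\omega\mapsto\phi_{e,\omega}(x)$ measurable for each $x$. For a word $\tau\in E_A^n$, $\phi_{\tau,\omega}=\phi_{\tau_0,\omega}\circ\phi_{\tau_1,\theta(\omega)}\circ\cdots\circ\phi_{\tau_{n-1},\theta^{n-1}(\omega)}$.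 The coding map $\pi_\omega:E_A^\infty\to\bigcup_vX_v$ is given by $\{\pi_\omega(\tau)\}=\bigcap_{n\ge1}\phi_{\tau_0\cdots\tau_{n-1},\omega}(X_{t(\tau_{n-1})})$, and $J_\omega=\pi_\omega(E_A^\infty)$ is the random limit set. $\Phi$ is conformal if: (C1) each $X_v$ is compact, connected, and the closure of its interior; (C2) for $\mathbb P$-a.e. $\omega$ and all $e\ne e'$, $\phi_{e,\omega}(\mathrm{Int}X_{t(e)})\cap\phi_{e',\omega}(\mathrm{Int}X_{t(e')})=\emptyset$; (C3) for each $v$ there is a bounded open connected $W_v\supset X_v$ such that for all $\omega$ and all $e$ with $t(e)=v$, $\phi_{e,\omega}$ extends to a $C^1$ conformal diffeomorphism of $W_v$ onto its image, with $\omega\mapsto\phi_{e,\omega}(x)$ measurable for $x\in W_{t(e)}$; (C4) there are $\mathfrak a\in(0,\pi/2)$ and $\ell>0$ such that for each $v$ and $x\in X_v$ there is $u\in\mathbb R^d$ with $|u|=\ell$ and $\{y:\langle y-x,u\rangle>|y-x||u|\cos\mathfrak a,\ |y-x|<|u|\}\subset\mathrm{Int}(X_v)$; (C5) there are a set of full $\mathbb P$-measure and constants $L\ge1$, $0<\alpha_\Phi<1$ such that for all $\omega$ in this set, $e\in E$, $x,y\in W_{t(e)}$: $\big||\phi'_{e,\omega}(y)|-|\phi'_{e,\omega}(x)|\big|\le L|\phi'_{e,\omega}(x)||y-x|^{\alpha_\Phi}$. Here $|\phi'|$ is the norm of the derivative. $\Phi$ is normal if for each $e\in E$ there is $M_e\in(0,s_\Phi]$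 such that for $\mathbb P$-a.e. $\omega$, $\inf\{|\phi'_{e,\omega}(x)|:x\in X_{t(e)}\}>M_e$. Pressure. $\zeta(\tau,\omega)=\log|\phi'_{\tau_0,\omega}(\pi_{\theta(\omega)}(\sigma\tau))|$ and $S_n\zeta(\tau,\omega)=\sum_{l=0}^{n-1}\zeta(\sigma^l\tau,\theta^l\omega)$. For $s\in\mathbb R$ let $M_{s\zeta}(\omega)=\sup_{\tau\in E_A^\infty}\sum_{e:A_{e,\tau_0}=1}e^{s\zeta(e\tau,\omega)}$. For each $e\in E$ fix $\xi_e\in E_A^\infty$ with first letter $e$. If $\int\log M_{s\zeta}\,d\mathbb P<\infty$, the relative topological pressure $P(s\zeta)$ is the constant such that for $\mathbb P$-a.e. $\omega$ and all $e\in E$, $P(s\zeta)=\lim_n\frac1n\log\sum_{a\in E_A^n,\,a_0=e,\,A_{a_{n-1},e}=1}\exp(sS_n\zeta(a\xi_e,\omega))$ (it is known that this constant exists); otherwise $P(s\zeta)=\infty$. $\dim_H$ is Hausdorff dimension in $\mathbb R^d$. *)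

(* Defs.v *)
From HB Require Import structures.
From mathcomp Require Import all_boot all_order all_algebra.
From mathcomp Require Import all_classical all_reals all_analysis.
Set Implicit Arguments.
Unset Strict Implicit.
Unset Printing Implicit Defensive.
Import Order.TTheory GRing.Theory Num.Theory.
Import numFieldNormedType.Exports.
Local Open Scope classical_set_scope.
Local Open Scope ring_scope.

Section Euclidean.
Context {R : realType} {d : nat}.
Implicit Types (x y u v : 'rV[R]_d) (A U : set 'rV[R]_d).
Implicit Types f g : 'rV[R]_d -> 'rV[R]_d.

Definition inner u v : R := \sum_(j < d) u ord0 j * v ord0 j.

(* The norm `|x| that MathComp-Analysis puts on 'rV[R]_d is the sup norm; it
   has the same topology and the same differentials, but metric notions below
   use the Euclidean norm. *)
Definition enorm x : R := Num.sqrt (inner x x).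

Definition borel_rV : Type := g_sigma_algebraType (@open 'rV[R]_d).

Definition dnorm f x : R :=
  sup [set enorm ('d f x v) | v in [set v | enorm v <= 1]].

Definition C1_on U f : Prop :=
  (forall x, U x -> differentiable f x) /\
  (forall x, U x -> {for x, continuous (jacobian f)}).

Definition C1_diffeo_onto_image U f : Prop :=
  [/\ C1_on U f, open (f @` U) &
      exists2 g, C1_on (f @` U) g & forall x, U x -> g (f x) = x].

(* Angle preservation only: orientation-reversing maps are allowed, and for
   d = 1 the condition says that the derivative does not vanish. *)
Definition conformal_on U f : Prop :=
  forall x, U x ->
    exists2 c : R, 0 < c & forall v, enorm ('d f x v) = c * enorm v.

(* The open cone with apex x, axis u, half-angle a and height |u|. *)
Definition open_cone x u (a : R) : set 'rV[R]_d :=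
  [set y | inner (y - x) u > enorm (y - x) * enorm u * cos a /\
           enorm (y - x) < enorm u].

Definition ediam U : \bar R :=
  ereal_sup [set (enorm (p.1 - p.2))%:E | p in U `*` U].

(* The empty set must contribute 0 also when s = 0, whereas 0 `^ 0 = 1. *)
Definition hausdorff_gauge (s : R) U : \bar R :=
  if U == set0 then 0%E else (ediam U `^ s)%E.

Definition hausdorff_premeasure (s delta : R) A : \bar R :=
  ereal_inf [set (\sum_(0 <= k <oo) hausdorff_gauge s (U k))%E | U in
    [set U : nat -> set 'rV[R]_d |
      A `<=` \bigcup_k U k /\ forall k, (ediam (U k) <= delta%:E)%E]].

Definition hausdorff_measure (s : R) A : \bar R :=
  ereal_sup [set hausdorff_premeasure s delta A | delta in
    [set delta : R | 0 < delta]].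

Definition hausdorff_dim A : \bar R :=
  ereal_inf [set s%:E | s in
    [set s : R | 0 <= s /\ hausdorff_measure s A = 0%E]].

End Euclidean.

Arguments borel_rV R d : clear implicits.

Section RandomBase.
Context {disp : measure_display} {Omega : measurableType disp} {R : realType}.

Definition bimeasurable (theta : Omega -> Omega) : Prop :=
  exists theta' : Omega -> Omega,
    [/\ cancel theta theta', cancel theta' theta,
        measurable_fun [set: Omega] theta &
        measurable_fun [set: Omega] theta'].

Definition measure_preserving (P : probability Omega R)
    (theta : Omega -> Omega) : Prop :=
  forall A, measurable A -> P (theta @^-1` A) = P A.

Definition ergodic (P : probability Omega R) (theta : Omega -> Omega) : Prop :=
  forall A, measurable A -> theta @^-1` A = A -> P A = 0%E \/ P A = 1%E.

End RandomBase.

Section SymbolSpace.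
Context {V : finType} {E : countType} (ini ter : E -> V).
Implicit Types (tau : nat -> E) (a w : seq E) (e : E).

(* The incidence matrix A, as a boolean relation. *)
Definition adm : rel E := fun e e' => ter e == ini e'.

Definition shift_space : set (nat -> E) :=
  [set tau | forall n, adm (tau n) (tau n.+1)].

Definition words (n : nat) : set (seq E) :=
  [set a | size a = n /\ sorted adm a].

Definition finitely_primitive : Prop :=
  exists (N : nat) (Lambda : set (seq E)),
    [/\ (1 <= N)%N, finite_set Lambda, Lambda `<=` words N &
        forall e e', exists2 w, Lambda w & sorted adm (e :: rcons w e')].

Definition shift tau : nat -> E := fun n => tau n.+1.

Definition scons e tau : nat -> E := fun n => if n is m.+1 then tau m else e.

Definition word_cat a tau : nat -> E := foldr scons tau a.

End SymbolSpace.

(* [gmap e omega] is a total function: only its values on X_{t(e)} matter for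
   the system itself, and outside of X_{t(e)} it is free, so that for a
   conformal system it also denotes the extension to W_{t(e)}. *)
Record rgdms {disp : measure_display} (Omega : measurableType disp)
    (R : realType) (d : nat) (V : finType) (E : countType) (ini ter : E -> V)
  := RGDMS {
  vset : V -> set 'rV[R]_d;
  gmap : E -> Omega -> 'rV[R]_d -> 'rV[R]_d;
  contr : R;
  vset_nonempty : forall v, vset v !=set0;
  vset_compact : forall v, compact (vset v);
  contr_bounds : 0 < contr < 1;
  gmap_into : forall e omega x,
    vset (ter e) x -> vset (ini e) (gmap e omega x);
  gmap_inj : forall e omega x y, vset (ter e) x -> vset (ter e) y ->
    gmap e omega x = gmap e omega y -> x = y;
  gmap_lipschitz : forall e omega x y, vset (ter e) x -> vset (ter e) y ->
    enorm (gmap e omega x - gmap e omega y) <= contr * enorm (x - y);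
  gmap_measurable : forall e x, vset (ter e) x ->
    measurable_fun [set: Omega] (fun omega => gmap e omega x : borel_rV R d)
}.

Section System.
Context {disp : measure_display} {Omega : measurableType disp} {R : realType}
  {d : nat} {V : finType} {E : countType} {ini ter : E -> V}.
Variables (P : probability Omega R) (theta : Omega -> Omega).
Variable Phi : rgdms Omega R d ini ter.

Local Notation X := (vset Phi).
Local Notation phi := (gmap Phi).

Definition cond_C1 : Prop :=
  forall v, [/\ compact (X v), connected (X v) & closure ((X v)°) = X v].

Definition cond_C2 : Prop :=
  \forall omega \ae P, forall e e', e != e' ->
    (phi e omega @` (X (ter e))°) `&` (phi e' omega @` (X (ter e'))°) = set0.

Definition cond_C3 (W : V -> set 'rV[R]_d) : Prop :=
  [/\ forall v, [/\ bounded_set (W v), open (W v), connected (W v) &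
                    X v `<=` W v],
      forall e omega, C1_diffeo_onto_image (W (ter e)) (phi e omega) /\
                      conformal_on (W (ter e)) (phi e omega) &
      forall e x, W (ter e) x ->
        measurable_fun [set: Omega] (fun omega => phi e omega x : borel_rV R d)].

Definition cond_C4 : Prop :=
  exists a l : R, [/\ 0 < a < pi / 2, 0 < l &
    forall v x, X v x ->
      exists2 u : 'rV[R]_d, enorm u = l & open_cone x u a `<=` (X v)°].

Definition cond_C5 (W : V -> set 'rV[R]_d) : Prop :=
  exists L alpha : R, [/\ 1 <= L, 0 < alpha < 1 &
    \forall omega \ae P, forall e x y, W (ter e) x -> W (ter e) y ->
      `|dnorm (phi e omega) y - dnorm (phi e omega) x|
        <= L * dnorm (phi e omega) x * enorm (y - x) `^ alpha].

Definition conformal : Prop :=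
  [/\ cond_C1, cond_C2, cond_C4 &
      exists W : V -> set 'rV[R]_d, cond_C3 W /\ cond_C5 W].

Definition normal : Prop :=
  forall e, exists2 M : R, 0 < M <= contr Phi &
    \forall omega \ae P,
      M < inf [set dnorm (phi e omega) x | x in X (ter e)].

Fixpoint word_map (a : seq E) (omega : Omega) (x : 'rV[R]_d) : 'rV[R]_d :=
  if a is e :: b then phi e omega (word_map b (theta omega) x) else x.

(* For an admissible tau the intersection is a singleton, so get returns its
   only element. *)
Definition coding (omega : Omega) (tau : nat -> E) : 'rV[R]_d :=
  get (\bigcap_n (word_map (mkseq tau n.+1) omega @` X (ter (tau n)))).

Definition limit_set (omega : Omega) : set 'rV[R]_d :=
  coding omega @` shift_space ini ter.

Definition zeta (tau : nat -> E) (omega : Omega) : R :=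
  ln (dnorm (phi (tau 0%N) omega) (coding (theta omega) (shift tau))).

Definition birkhoff (n : nat) (tau : nat -> E) (omega : Omega) : R :=
  \sum_(l < n) zeta (iter l (@shift E) tau) (iter l theta omega).

Definition transfer_sup (s : R) (omega : Omega) : \bar R :=
  ereal_sup [set
    (\esum_(e in [set e | adm ini ter e (tau 0%N)])
      (expR (s * zeta (scons e tau) omega))%:E)%E
    | tau in shift_space ini ter].

Definition return_words (n : nat) (e : E) : set (seq E) :=
  [set a | [/\ words ini ter n a, ohead a = Some e & adm ini ter (last e a) e]].

Variable xi : E -> nat -> E.

Definition partition_sum (s : R) (n : nat) (e : E) (omega : Omega) : \bar R :=
  (\esum_(a in return_words n e)
    (expR (s * birkhoff n (word_cat a (xi e)) omega))%:E)%E.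

Definition is_pressure (s : R) (p : \bar R) : Prop :=
  \forall omega \ae P, forall e,
    (fun n : nat => (n%:R^-1)%:E * lne (partition_sum s n e omega))%E @ \oo
      --> p.

(* A definite description: the constant is unique as soon as E is nonempty
   (with no edge, every p satisfies is_pressure). *)
Definition pressure (s : R) : \bar R :=
  if (\int[P]_omega lne (transfer_sup s omega) < +oo)%E
  then get (is_pressure s) else +oo%E.

End System.

(* Main.v *)
(** Bounded distortion makes the derivative of a composed map [phi_a] comparable
    to its value at one base point, so [g a omega], the logarithm of that value,
    is almost additive under concatenation, and the partition functions
    [Z_n = sum_(|a| = n) exp (s g a omega)] are almost multiplicative along the
    orbit of [omega].  Birkhoff's theorem applied to [log Z_k], averaged over the
    phases modulo [k], then shows that [log Z_n] grows like [n P(s zeta)].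

    Upper bound: if [P(s zeta) <= 0] and [s < s'], then [Z_n] at [s'] tends to
    [0], and the images of finitely many small balls under the [phi_a], [|a| = n],
    cover the limit set.

    Lower bound: if [P(s zeta) > 0], monotone convergence gives a finite alphabet
    for which [Z_n] stays bounded below.  Given a cover of the limit set by sets
    [U_k] of diameter at most [r_k], consider the words over this alphabet stopped
    when their contraction first drops below [r_k] and whose cylinder meets [U_k]:
    by the open set condition their number is bounded, by Koenig's lemma finitely
    many of them cut all long words, and almost multiplicativity bounds
    [sum_k r_k^s] from below.  No conformal measure is needed. *)

From HB Require Import structures.
Require Import Defs.
From mathcomp Require Import all_boot all_order all_algebra.
From mathcomp Require Import all_classical all_reals all_analysis.
From mathcomp Require Import measurable_realfun ring lra zify.
Set Implicit Arguments.
Unset Strict Implicit.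
Unset Printing Implicit Defensive.
Import Order.TTheory GRing.Theory Num.Theory.
Import numFieldNormedType.Exports.
Local Open Scope classical_set_scope.
Local Open Scope ring_scope.

(** The sets [X v] are not assumed convex, so a bound on the derivative cannot be integrated along
    segments inside them. The estimates are made on balls of one radius [eps] around points of
    [X v], inside the open sets of the conformal extension; [eps] is so small that the extended maps
    still contract there, so every word maps such balls into such balls. This is why a cylinder is
    covered by a fixed number of pieces instead of one. The alphabet may be infinite, and normality
    bounds derivatives from below only letter by letter. Uniform lower bounds are therefore taken
    along connecting words, whose letters form a finite list, and the stopped words of the lower
    bound use a finite alphabet, where one more letter costs a bounded factor. The supremum in
    [transfer_sup] ranges over uncountably many sequences, so its integral is compared with that of
    the logarithm of Z_1 through lower integrals; completeness of the probability space makes the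
    exceptional sets measurable. Geometry and symbolic dynamics meet only in the record
    [sys_est]. *)

Section EuclideanNorm.
Context {R : realType} {d : nat}.
Implicit Types (x y z u v w : 'rV[R]_d).

Lemma innerC u v : inner u v = inner v u.
Proof. by apply: eq_bigr => j _; rewrite mulrC. Qed.

Lemma innerDl u v w : inner (u + v) w = inner u w + inner v w.
Proof. by rewrite /inner -big_split; apply: eq_bigr => j _; rewrite mxE mulrDl. Qed.

Lemma innerZl (k : R) u v : inner (k *: u) v = k * inner u v.
Proof. by rewrite /inner mulr_sumr; apply: eq_bigr => j _; rewrite mxE mulrA. Qed.

Lemma innerDr u v w : inner u (v + w) = inner u v + inner u w.
Proof. by rewrite innerC innerDl !(innerC u). Qed.

Lemma innerZr (k : R) u v : inner u (k *: v) = k * inner u v.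
Proof. by rewrite innerC innerZl innerC. Qed.

Lemma innerNl u v : inner (- u) v = - inner u v.
Proof. by rewrite -scaleN1r innerZl mulN1r. Qed.

Lemma innerBl u v w : inner (u - v) w = inner u w - inner v w.
Proof. by rewrite innerDl innerNl. Qed.

Lemma innerBr u v w : inner u (v - w) = inner u v - inner u w.
Proof. by rewrite innerC innerBl !(innerC u). Qed.

Lemma inner_ge0 u : 0 <= inner u u.
Proof. by apply: sumr_ge0 => j _; rewrite -expr2 sqr_ge0. Qed.

Lemma enorm_ge0 u : 0 <= enorm u.
Proof. exact: sqrtr_ge0. Qed.

Lemma enorm_sqr u : enorm u ^+ 2 = inner u u.
Proof. by rewrite sqr_sqrtr// inner_ge0. Qed.

Lemma enormZ (k : R) u : enorm (k *: u) = `|k| * enorm u.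
Proof. by rewrite /enorm innerZl innerZr mulrA -expr2 sqrtrM ?sqr_ge0// sqrtr_sqr. Qed.

Lemma enormN u : enorm (- u) = enorm u.
Proof. by rewrite -scaleN1r enormZ normrN1 mul1r. Qed.

Lemma enormC u v : enorm (u - v) = enorm (v - u).
Proof. by rewrite -enormN opprB. Qed.

Lemma enorm_coord u j : `|u ord0 j| <= enorm u.
Proof.
rewrite -sqrtr_sqr; apply: ler_wsqrtr.
rewrite /inner (bigD1 j)//= -expr2 lerDl.
by apply: sumr_ge0 => i _; rewrite -expr2 sqr_ge0.
Qed.

Lemma enorm_eq0 u : enorm u = 0 -> u = 0.
Proof.
move=> u0; apply/rowP => j; rewrite mxE; apply/eqP.
by rewrite -normr_le0 -u0 enorm_coord.
Qed.

Lemma enorm0 : enorm (0 : 'rV[R]_d) = 0.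
Proof. by rewrite -[0](scale0r 0) enormZ normr0 mul0r. Qed.

Lemma enorm_gt0 u : u != 0 -> 0 < enorm u.
Proof. by move=> u0; rewrite lt_neqAle enorm_ge0 andbT eq_sym; apply: contra u0 => /eqP/enorm_eq0/eqP. Qed.

Lemma inner_le u v : inner u v <= enorm u * enorm v.
Proof.
have [->|u0] := eqVneq u 0; first by rewrite -[X in inner X](scale0r 0) innerZl mul0r enorm0 mul0r.
have [->|v0] := eqVneq v 0.
  by rewrite innerC -[X in inner X](scale0r 0) innerZl mul0r enorm0 mulr0.
have nu := enorm_gt0 u0; have nv := enorm_gt0 v0.
have := inner_ge0 (enorm v *: u - enorm u *: v).
rewrite innerBl !innerBr !innerZl !innerZr -!enorm_sqr (innerC v u) => h.
rewrite -(ler_pM2l (mulr_gt0 nu nv)); nra.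
Qed.

Lemma enormD u v : enorm (u + v) <= enorm u + enorm v.
Proof.
rewrite -(@ler_pXn2r _ 2)// ?nnegrE ?enorm_ge0 ?addr_ge0 ?enorm_ge0//.
rewrite enorm_sqr innerDl !innerDr -!enorm_sqr.
by have := inner_le u v; rewrite (innerC v u) => h; nra.
Qed.

Lemma enorm_tri y x z : enorm (x - z) <= enorm (x - y) + enorm (y - z).
Proof. by rewrite (le_trans _ (enormD _ _))// subrKA. Qed.

Lemma enorm_dist u v : `|enorm u - enorm v| <= enorm (u - v).
Proof.
rewrite ler_norml; apply/andP; split.
  by rewrite lerNl opprB lerBlDr -{1}(subrK u v) (le_trans (enormD _ _))// enormC.
by rewrite lerBlDr -{1}(subrK v u) enormD.
Qed.

Lemma enorm_le_sum u : enorm u <= \sum_(j < d) `|u ord0 j|.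
Proof.
have s0 : 0 <= \sum_(j < d) `|u ord0 j| by apply: sumr_ge0.
rewrite -(@ler_pXn2r _ 2)// ?nnegrE ?enorm_ge0//.
rewrite enorm_sqr /inner.
rewrite expr2 mulr_suml; apply: ler_sum => j _.
apply: (le_trans (ler_norm _)); rewrite normrM ler_wpM2l//.
by rewrite (bigD1 j)//= lerDl sumr_ge0.
Qed.

Lemma norm_le_enorm u : `|u| <= enorm u.
Proof.
change (mx_norm u <= enorm u).
have [->|u0] := eqVneq (mx_norm u) 0; first exact: enorm_ge0.
by have [[i j] /= ->] := mx_norm_neq0 u0; rewrite (ord1 i) enorm_coord.
Qed.

Lemma enorm_le_norm u : enorm u <= d%:R * `|u|.
Proof.
have le_norm j : `|u ord0 j| <= `|u|.
  change (`|u ord0 j| <= mx_norm u); rewrite mx_normrE.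
  exact: (@le_bigmax _ _ _ 0 (fun i => `|u i.1 i.2|) (ord0, j)).
rewrite (le_trans (enorm_le_sum u))// (le_trans (ler_sum _ (fun j _ => le_norm j)))//.
by rewrite sumr_const card_ord mulr_natl.
Qed.

End EuclideanNorm.

(** * Differential calculus in the Euclidean norm *)

Section EuclideanTopology.
Context {R : realType} {d : nat}.
Implicit Types (x y z u v w : 'rV[R]_d) (A : set 'rV[R]_d).

Lemma nbhs_enormP x A :
  nbhs x A <-> exists2 e : R, 0 < e & forall y, enorm (y - x) < e -> A y.
Proof.
split=> [|[e e0 h]].
  move=> /nbhs_ballP[e /= e0 h]; exists e => // y ye; apply: h.
  by rewrite -ball_normE/= distrC (le_lt_trans (norm_le_enorm _)).
(* Dividing by [d.+1] rather than [d] avoids a separate case [d = 0]. *)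
apply/nbhs_ballP; exists (e / d.+1%:R) => /=; first by rewrite divr_gt0.
rewrite -ball_normE => y /= ye; apply: h; rewrite (le_lt_trans (enorm_le_norm _))//.
have d0 : 0 < d.+1%:R :> R by [].
rewrite distrC ltr_pdivlMr// in ye.
apply: le_lt_trans ye; rewrite mulrC; apply: ler_wpM2l => //.
by rewrite ler_nat.
Qed.

Lemma open_enorm_ball x (r : R) : open [set y | enorm (y - x) < r].
Proof.
rewrite openE => y /= yr; apply/nbhs_enormP; exists (r - enorm (y - x)).
  by rewrite subr_gt0.
by move=> z zy /=; rewrite (le_lt_trans (enorm_tri y _ _))// -ltrBrDr.
Qed.

Lemma compact_enorm_ball x (r : R) : compact [set y | enorm (y - x) <= r].
Proof.
apply: bounded_closed_compact.
  exists (`|x| + r); split; first by rewrite num_real.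
  move=> M Mr y /= yr; apply: le_trans (ltW Mr).
  rewrite -(subrK x y) addrC (le_trans (ler_normD _ _))// lerD2l.
  by rewrite (le_trans _ yr)// norm_le_enorm.
rewrite -[X in closed X]setCK; apply: open_closedC; rewrite openE => y /=.
move/negP; rewrite -ltNge => yr; apply/nbhs_enormP.
exists (enorm (y - x) - r); first by rewrite subr_gt0.
move=> z zy /=; apply/negP; rewrite -ltNge.
by have := enorm_tri z y x; rewrite [enorm (y - z)]enormC; lra.
Qed.

(** The library differential is a little-o for the sup norm; equivalence of the norms transfers the
    remainder to [enorm]. *)
Lemma differentiable_enorm (f : 'rV[R]_d -> 'rV[R]_d) x :
  differentiable f x -> forall eta : R, 0 < eta -> exists2 del : R, 0 < del &
    forall h, enorm h < del ->
      enorm (f (x + h) - f x - 'd f x h) <= eta * enorm h.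
Proof.
move=> df eta eta0.
have /eqaddoP := diff_locally df.
have d0 : 0 < d.+1%:R :> R by [].
move=> /(_ _ (divr_gt0 eta0 d0)) /nbhs_enormP[del del0 H]; exists del => // h hd.
have {H} := H h; rewrite subr0 => /(_ hd) /= H.
have -> : f (x + h) - f x - 'd f x h = f (h + x) - (f x + 'd f x h) by rewrite opprD addrA (addrC x).
rewrite (le_trans (enorm_le_norm _))//.
rewrite (@le_trans _ _ (d.+1%:R * `|f (h + x) - (f x + 'd f x h)|))//.
  by rewrite ler_wpM2r// ler_nat.
rewrite (@le_trans _ _ (d.+1%:R * (eta / d.+1%:R * `|h|)))//.
  by rewrite ler_wpM2l.
rewrite mulrA mulrCA mulfV ?pnatr_eq0// mulr1 ler_wpM2l ?(ltW eta0)//.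
exact: norm_le_enorm.
Qed.

(** The inner product as a function of its first argument, named so that it can carry a linear
    structure and enter the chain rule. *)
Definition innerr u w : R := inner w u.

Lemma innerr_is_linear u : linear (innerr u).
Proof. by move=> k v w; rewrite /innerr innerDl innerZl. Qed.

HB.instance Definition _ u :=
  GRing.isLinear.Build R 'rV[R]_d R _ (innerr u) (innerr_is_linear u).

Lemma innerr_continuous u : continuous (innerr u).
Proof.
move=> x; apply/(@cvgrPdist_lt _ _ _ (nbhs x)) => e e0; apply/nbhs_enormP.
have u1 : 0 < enorm u + 1 by rewrite ltr_wpDl ?enorm_ge0.
exists (e / (enorm u + 1)); first by rewrite divr_gt0.
move=> y; rewrite ltr_pdivlMr// => ye; rewrite /innerr -innerBl.
apply: le_lt_trans ye; rewrite -normrN -innerNl opprB.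
apply: (@le_trans _ _ (enorm (y - x) * enorm u)); last first.
  by rewrite ler_wpM2l ?enorm_ge0// lerDl.
rewrite ler_norml inner_le andbT lerNl -innerNl.
by rewrite (le_trans (inner_le _ _))// enormN.
Qed.

Lemma is_derive_inner (f : 'rV[R]_d -> 'rV[R]_d) x v u (t : R) :
  differentiable f (x + t *: v) ->
  is_derive t (1 : R) (fun t : R => inner (f (x + t *: v)) u) (inner ('d f (x + t *: v) v) u).
Proof.
move=> df.
pose l : R -> 'rV[R]_d := cst x + ( *:%R ^~ v).
have dl : is_diff t l (fun s => s *: v).
  apply: (is_diff_eq (is_diffD (is_diff_cst x t) (is_diff_scalel t v))).
  by apply/funext => s; rewrite /= add0r.
have di : is_diff (f (l t)) (innerr u) (innerr u).
  apply: DiffDef; last exact/diff_lin/innerr_continuous.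
  exact/linear_differentiable/innerr_continuous.
have df' : is_diff (l t) f ('d f (l t)) by exact: differentiableP.
have [dF eF] := is_diff_comp (is_diff_comp dl df') di.
apply: DeriveDef; first exact/diff_derivable/dF.
by have := deriveE (1 : R) dF; rewrite eF /= scale1r.
Qed.

(** A vector-valued map has no exact mean value, so the scalar theorem is applied to the component
    of [f] along [f y - f x]; the segment stays in the ball by convexity. *)
Lemma mean_value (f : 'rV[R]_d -> 'rV[R]_d) (x0 : 'rV[R]_d) (r c : R) :
  (forall y, enorm (y - x0) < r -> differentiable f y /\
     forall v, enorm ('d f y v) <= c * enorm v) ->
  forall x y, enorm (x - x0) < r -> enorm (y - x0) < r ->
    enorm (f y - f x) <= c * enorm (y - x).
Proof.
move=> df x y xr yr.
have seg (t : R) : 0 <= t <= 1 -> enorm (x + t *: (y - x) - x0) < r.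
  move=> /andP[t0 t1].
  have -> : x + t *: (y - x) - x0 = (1 - t) *: (x - x0) + t *: (y - x0).
    by apply/rowP => j; rewrite !mxE; ring.
  rewrite (le_lt_trans (enormD _ _))// !enormZ !ger0_norm ?subr_ge0//.
  set a := enorm (x - x0) in xr *; set b := enorm (y - x0) in yr *.
  by have [ab|ba] := leP a b; [apply: le_lt_trans yr|apply: le_lt_trans xr]; nra.
pose u : 'rV[R]_d := f y - f x.
have der (t : R) : 0 <= t <= 1 -> is_derive t (1 : R) (fun t : R => inner (f (x + t *: (y - x))) u)
    (inner ('d f (x + t *: (y - x)) (y - x)) u).
  by move=> t01; apply: is_derive_inner; have [] := df _ (seg t t01).
have [||t t01] := @MVT_segment R (fun t : R => inner (f (x + t *: (y - x))) u)
   (fun t : R => inner ('d f (x + t *: (y - x)) (y - x)) u) 0 1 ler01.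
- by move=> t; rewrite in_itv/= => /andP[t0 t1]; apply: der; rewrite !ltW.
- apply: derivable_within_continuous => t; rewrite in_itv/= => t01.
  by have [] := der t t01.
rewrite in_itv/= in t01.
rewrite scale1r subrKC scale0r addr0 -innerBl -/u -enorm_sqr subr0 mulr1 => e.
have [->|u0] := eqVneq u 0.
  have [_ /(_ (y - x)) h] := df _ xr.
  by rewrite enorm0; exact: le_trans (enorm_ge0 _) h.
rewrite -(ler_pM2r (enorm_gt0 u0)) -expr2 e (le_trans (inner_le _ _))//.
by rewrite ler_wpM2r ?enorm_ge0//; have [_] := df _ (seg t t01).
Qed.

(* A minimiser [p] of [enorm (f p - y) + m1 * enorm (p - x0)] over a closed ball
   satisfies [f p = y]: otherwise moving [p] in the direction [v] with
   ['d f p v = y - f p] would decrease the value. *)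
Lemma expanding_ball (f : 'rV[R]_d -> 'rV[R]_d) x0 (r m : R) : 0 < m ->
  (forall y, enorm (y - x0) < r -> differentiable f y /\
     forall v, m * enorm v <= enorm ('d f y v)) ->
  forall y, enorm (y - f x0) < m * r ->
    exists2 x, enorm (x - x0) < r & f x = y.
Proof.
move=> m0 df y yr.
have r0 : 0 < r by rewrite -(pmulr_rgt0 _ m0); apply: le_lt_trans yr; exact: enorm_ge0.
(* Slack in both factors: [m1 < m] makes the descent below strict, and [r1 < r] gives a compact ball
   on which [f] is differentiable. Both are shrunk by k = (1 + q) / 2 with q = n / (m r); this works
   because k ^ 2 - q is the square of (1 - q) / 2. *)
have [m1 /andP[m10 m1m] [r1 /andP[r10 r1r] ym]] :
    exists2 m1, 0 < m1 < m & exists2 r1, 0 < r1 < r & enorm (y - f x0) < m1 * r1.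
  have n0 := enorm_ge0 (y - f x0); move: yr; set n := enorm _ in n0 *; move=> yr.
  have q0 : 0 <= n / (m * r) by rewrite divr_ge0// ltW// mulr_gt0.
  have q1 : n / (m * r) < 1 by rewrite ltr_pdivrMr ?mul1r// mulr_gt0.
  have nE : n = n / (m * r) * m * r by rewrite -mulrA divfK// gt_eqF// mulr_gt0.
  move: q0 q1 nE; set q := n / _ => q0 q1 nE.
  pose k : R := (1 + q) / 2.
  have k0 : 0 < k by rewrite /k; lra.
  have k1 : k < 1 by rewrite /k; lra.
  have kq : q < k ^+ 2.
    by rewrite -subr_gt0 (_ : _ - _ = ((1 - q) / 2) ^+ 2) ?exprn_gt0; [|lra|rewrite /k; field].
  exists (m * k); first by rewrite mulr_gt0//= gtr_pMr.
  exists (k * r); first by rewrite mulr_gt0//= gtr_pMl.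
  rewrite nE (_ : m * k * (k * r) = k ^+ 2 * (m * r)); last ring.
  by rewrite -mulrA ltr_pM2r// mulr_gt0.
pose B := [set p | enorm (p - x0) <= r1].
pose F p := enorm (f p - y) + m1 * enorm (p - x0).
have cB : {within B, continuous F}.
  apply: continuous_in_subspaceT => p; rewrite inE => /= pr1.
  have [dfp _] := df p (le_lt_trans pr1 r1r).
  have cn (g : 'rV[R]_d -> 'rV[R]_d) z : {for p, continuous g} ->
      {for p, continuous (fun q : 'rV[R]_d => enorm (g q - z))}.
    move=> cg; apply/(@cvgrPdist_lt _ _ _ (nbhs p)) => e e0; apply/nbhs_enormP.
    have /cg/nbhs_enormP[del del0 H] : nbhs (g p) [set w | enorm (w - g p) < e].
      by apply/nbhs_enormP; exists e.
    exists del => // q /H /= qe; rewrite distrC (le_lt_trans (enorm_dist _ _))//.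
    by rewrite (_ : g q - z - _ = g q - g p)// opprB addrA subrK.
  have c1 := cn f y (differentiable_continuous dfp).
  have c2 := cn id x0 (fun B h => h).
  have c3 : {for p, continuous (fun q : 'rV[R]_d => m1 * enorm (q - x0))}.
    exact: (@cvgMl_tmp _ _ (nbhs p) _ _ _ _ c2).
  exact: (@cvgD _ _ _ (nbhs p) _ _ _ _ _ c1 c3).
have B0 : B !=set0 by exists x0; rewrite /B/= subrr enorm0 ltW.
have [p] := EVT_min_rV B0 (@compact_enorm_ball x0 r1) cB.
rewrite inE /= => pr1 pmin.
(* The minimiser is not on the boundary: [m1 * enorm (p - x0)] is at most [F p], hence at most
   [F x0], which is below [m1 * r1]. *)
have px : enorm (p - x0) < r1.
  have : F p <= F x0 by apply: pmin; rewrite inE /B/= subrr enorm0 ltW.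
  rewrite /F subrr enorm0 mulr0 addr0 => h.
  rewrite -(ltr_pM2l m10); apply: le_lt_trans ym; rewrite (enormC y).
  by apply: le_trans h; rewrite lerDr enorm_ge0.
exists p; first exact: lt_trans px r1r.
apply: contrapT => /eqP fpy.
have w0 : 0 < enorm (y - f p) by apply: enorm_gt0; rewrite subr_eq0 eq_sym.
have [dfp dm] := df p (lt_trans px r1r).
(* The lower bound [m] makes the differential injective, hence bijective in finite dimension. *)
have [v dv] : exists v, 'd f p v = y - f p.
  pose M := lin1_mx ('d f p).
  have ME v : v *m M = 'd f p v by rewrite mul_rV_lin1.
  have Minj : row_free M.
    rewrite -kermx_eq0; apply/eqP/row_matrixP => i; rewrite row0.
    have := sub_kermxP (row_sub i (kermx M)); rewrite ME => h.
    have := dm (row i (kermx M)); rewrite h enorm0 pmulr_rle0// => h0.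
    by apply: enorm_eq0; apply/eqP; rewrite eq_le h0 enorm_ge0.
  exists ((y - f p) *m invmx M); rewrite -ME mulmxKV//.
  by rewrite -row_free_unit.
have v0 : 0 < enorm v.
  apply: enorm_gt0; apply/eqP => v0.
  by move: w0; rewrite -dv v0 linear0 enorm0 ltxx.
have hv := dm v; rewrite dv in hv.
have eta0 : 0 < (m - m1) / 2 by lra.
have [del del0 H] := differentiable_enorm dfp eta0.
(* The three caps keep [1 - t] positive, put [t *: v] in the range of the linear approximation, and
   keep [p + t *: v] in the compact ball. The first term of [F] then drops by at least
   [t * m * enorm v] minus an error [(m - m1) / 2 * (t * enorm v)], while the second grows by at
   most [m1 * (t * enorm v)]. *)
pose t := Num.min (1 / 2) (Num.min (del / (2 * enorm v)) ((r1 - enorm (p - x0)) / enorm v)).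
have t0 : 0 < t.
  by rewrite !lt_min !divr_gt0//= ?mulr_gt0//= subr_gt0.
have t1 : t <= 1 / 2 by rewrite ge_min lexx.
have tdel : t * enorm v < del.
  rewrite (@le_lt_trans _ _ (del / 2))//; last lra.
  rewrite -ler_pdivlMr// !ge_min; apply/orP; right; apply/orP; left.
  by rewrite invfM mulrA.
have tr : t * enorm v <= r1 - enorm (p - x0).
  by rewrite -ler_pdivlMr// !ge_min lexx !orbT.
have etv : enorm (t *: v) = t * enorm v by rewrite enormZ gtr0_norm.
have {H} := H (t *: v); rewrite etv => /(_ tdel) H.
have : F p <= F (p + t *: v).
  apply: pmin; rewrite inE /B/=.
  have -> : p + t *: v - x0 = (p - x0) + t *: v by rewrite addrAC.
  by rewrite (le_trans (enormD _ _))// etv; lra.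
rewrite /F.
have : enorm (f (p + t *: v) - y) <= (1 - t) * enorm (y - f p) + (m - m1) / 2 * (t * enorm v).
  have -> : f (p + t *: v) - y = - ((1 - t) *: (y - f p)) +  (f (p + t *: v) - f p - 'd f p (t *: v)).
    have -> : 'd f p (t *: v) = t *: (y - f p) by rewrite -dv linearZ.
    apply/rowP => j; rewrite !mxE; ring.
  rewrite (le_trans (enormD _ _))// enormN enormZ ger0_norm; last lra.
  by rewrite lerD2l.
have : enorm (p + t *: v - x0) <= enorm (p - x0) + t * enorm v.
  by rewrite addrAC (le_trans (enormD _ _))// etv.
rewrite [enorm (f p - y)]enormC.
have : 0 < t * enorm v by rewrite mulr_gt0.
nra.
Qed.

End EuclideanTopology.

(** * Conformal differentials and their ratio *)

Section ConformalAt.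
Context {R : realType} {d : nat}.
Implicit Types (x y z u v w : 'rV[R]_d) (f g : 'rV[R]_d -> 'rV[R]_d).

Definition conf_at f x : Prop := differentiable f x /\
  0 < dnorm f x /\ forall v, enorm ('d f x v) = dnorm f x * enorm v.

Lemma exists_unit : (0 < d)%N -> exists u : 'rV[R]_d, enorm u = 1.
Proof.
move=> d0; exists (delta_mx ord0 (Ordinal d0)).
rewrite /enorm /inner (bigD1 (Ordinal d0))//= big1 ?mxE ?eqxx/= ?mulr1 ?addr0 ?sqrtr1//.
by move=> j /negPf jn; rewrite mxE jn andbF mulr0.
Qed.

(** A unit vector attains the supremum that defines [dnorm]. Positive dimension enters here: in
    dimension zero [dnorm] vanishes. *)
Lemma conf_atP f x (c : R) : (0 < d)%N -> 0 < c -> differentiable f x ->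
  (forall v, enorm ('d f x v) = c * enorm v) -> conf_at f x /\ dnorm f x = c.
Proof.
move=> d0 c0 df dfc.
suff e : dnorm f x = c by split=> //; split=> //; split=> [|v]; rewrite e.
have [e0 ne0] := exists_unit d0.
apply/eqP; rewrite eq_le; apply/andP; split.
- apply: ge_sup; first by exists (enorm ('d f x e0)), e0; rewrite /= ?ne0.
  by move=> _ [v /= v1 <-]; rewrite dfc -[leRHS]mulr1 ler_wpM2l// ltW.
- apply: ub_le_sup; last by exists e0; rewrite /= ?ne0// dfc ne0 mulr1.
  by exists c => _ [v /= v1 <-]; rewrite dfc -[leRHS]mulr1 ler_wpM2l// ltW.
Qed.

Lemma conf_at_comp f g x : (0 < d)%N -> conf_at f x -> conf_at g (f x) ->
  conf_at (g \o f) x /\ dnorm (g \o f) x = dnorm g (f x) * dnorm f x.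
Proof.
move=> d0 [df [f0 fc]] [dg [g0 gc]].
have dgf := differentiable_comp df dg.
have e := diff_comp df dg.
apply: (conf_atP d0 (mulr_gt0 g0 f0) dgf) => v.
by rewrite e /= gc fc mulrA.
Qed.

Lemma conf_at_id x : (0 < d)%N -> conf_at id x /\ dnorm id x = 1.
Proof.
move=> d0; apply: conf_atP => //.
by move=> v; rewrite diff_val mul1r.
Qed.

(** One direction suffices, because a conformal differential stretches all vectors equally. *)
Lemma dnorm_le_lipschitz f x (k r : R) : 0 < r -> 0 <= k -> conf_at f x -> (0 < d)%N ->
  (forall y, enorm (y - x) < r -> enorm (f y - f x) <= k * enorm (y - x)) ->
  dnorm f x <= k.
Proof.
move=> r0 k0 [df [f0 fc]] d0 lip.
apply/ler_addgt0Pr => e e0.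
have [del del0 H] := differentiable_enorm df e0.
have [e1 ne1] := exists_unit d0.
pose t := Num.min (del / 2) (r / 2).
have t0 : 0 < t by rewrite lt_min !divr_gt0.
have nt : enorm (t *: e1) = t by rewrite enormZ ne1 mulr1 gtr0_norm.
have td : t < del by rewrite gt_min ltr_pdivrMr// ltr_pMr// ltr1n.
have tr : t < r by rewrite gt_min orbC ltr_pdivrMr// ltr_pMr// ltr1n.
have := H (t *: e1); rewrite nt => /(_ td) h1.
have := lip (x + t *: e1); rewrite addrAC subrr add0r nt => /(_ tr) h2.
have h3 : enorm ('d f x (t *: e1)) = dnorm f x * t by rewrite fc nt.
have := enorm_tri (f (x + t *: e1) - f x) ('d f x (t *: e1)) 0.
rewrite !subr0 h3 enormC => h4.
by rewrite -(ler_pM2r t0) mulrDl; lra.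
Qed.

End ConformalAt.

(** * Thickenings and nets of compact sets *)

Section EuclideanCovers.
Context {R : realType} {d : nat}.
Implicit Types (A B U : set 'rV[R]_d).

Lemma compact_thickening A U : compact A -> open U -> A `<=` U ->
  exists2 e : R, 0 < e & forall x y, A x -> enorm (y - x) < e -> U y.
Proof.
move=> /compact_near_coveringP cA oU AU.
pose P (n : nat) (x : 'rV[R]_d) := forall y, enorm (y - x) < n.+1%:R^-1 -> U y.
have [|N _ HN] := cA nat \oo P _.
  move=> x /AU Ux; have /nbhs_enormP[e e0 eU] : nbhs x U by exact: open_nbhs_nbhs.
  have e20 : 0 < e / 2 by rewrite divr_gt0.
  exists ([set y | enorm (y - x) < e / 2], [set n | n.+1%:R^-1 < e / 2]).
    split; first by apply/nbhs_enormP; exists (e / 2).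
    exact: near_infty_natSinv_lt (PosNum e20).
  move=> [y n] /= [yx nx] w wy; apply: eU.
  rewrite (le_lt_trans (enorm_tri y _ _))//.
  by rewrite (splitr e) ltrD// (lt_trans wy).
exists N.+1%:R^-1; first by [].
by move=> x y Ax xy; exact: (HN N (leqnn N) x Ax y xy).
Qed.

Lemma compact_enorm_bounded A : compact A ->
  exists2 D : R, 0 <= D & forall x y, A x -> A y -> enorm (x - y) <= D.
Proof.
move=> /compact_bounded[M [Mr MA]].
exists (d%:R * (2 * (`|M| + 1))); first by rewrite !mulr_ge0// addr_ge0.
move=> x y Ax Ay.
have M1 : M < `|M| + 1 by rewrite (le_lt_trans (ler_norm M))// ltrDl.
have h u : A u -> `|u| <= `|M| + 1 := MA _ M1 u.
rewrite (le_trans (enorm_le_norm _))// ler_wpM2l//.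
by rewrite (le_trans (ler_normB _ _))// mulrDl mul1r lerD// h.
Qed.

(** The centres can be taken in the interior, since [A] is its closure; being finitely many, they
    share one inner radius [rho]. Near every point of [A] there is thus a ball of fixed size inside
    [A], which the packing argument needs. *)
Lemma interior_net A (e : R) : 0 < e -> compact A -> closure A° = A ->
  exists (S : seq 'rV[R]_d) (rho : R), [/\ 0 < rho,
    forall z, z \in S -> forall y, enorm (y - z) < rho -> A y &
    forall x, A x -> exists2 z, z \in S & enorm (x - z) < e].
Proof.
move=> e0; rewrite compact_cover => cA clA.
have [|x Ax|D DA AD] := cA _ A° (fun z => [set x | enorm (x - z) < e]).
- by move=> z _; exact: open_enorm_ball.
- have : closure A° x by rewrite clA.
  move=> /(_ [set y | enorm (y - x) < e])[|z [Az zx]].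
    by apply/nbhs_enormP; exists e.
  by exists z => //=; rewrite enormC.
have : forall T : seq 'rV[R]_d, (forall z, z \in T -> A° z) ->
    exists2 rho : R, 0 < rho &
    forall z, z \in T -> forall y, enorm (y - z) < rho -> A y.
  elim=> [|z T IH] TA; first by exists 1.
  have [|r r0 rT] := IH; first by move=> y yT; apply: TA; rewrite inE yT orbT.
  have /nbhs_enormP[r' r'0 r'A] : nbhs z A by apply: TA; rewrite inE eqxx.
  exists (Num.min r r'); first by rewrite lt_min r0.
  move=> y; rewrite inE => /orP[/eqP->|yT] w; rewrite lt_min => /andP[wr wr'].
    exact: r'A.
  exact: (rT y).
move=> /(_ (finmap.enum_fset D))[|rho rho0 H].
  by move=> z zD; have /set_mem := DA _ zD.
exists (finmap.enum_fset D), rho; by split.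
Qed.

(** [q m k] is the [k]-th point of a finite net at scale [m.+1%:R^-1], and [None] means that the net
    is exhausted. The double index lets a later measurability proof use countable unions. *)
Lemma countable_dense A : compact A -> closure A° = A ->
  exists q : nat -> nat -> option 'rV[R]_d,
    (forall m k z, q m k = Some z -> A z) /\
    forall x, A x -> forall e : R, 0 < e ->
      exists m k z, q m k = Some z /\ enorm (x - z) < e.
Proof.
move=> cA clA.
have /choice[S HS] : forall m : nat, exists S : seq 'rV[R]_d,
    (forall z, z \in S -> A z) /\
    forall x, A x -> exists2 z, z \in S & enorm (x - z) < m.+1%:R^-1.
  move=> m; have m0 : 0 < m.+1%:R^-1 :> R by rewrite invr_gt0.
  have [S [rho [rho0 h1 h2]]] := interior_net m0 cA clA.
  exists S; split=> // z zS; apply: h1 (zS) _ _.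
  by rewrite subrr enorm0.
exists (fun m k => onth (S m) k); split.
  by move=> m k z e; have [h _] := HS m; apply: h; apply/onthP; exists k.
move=> x Ax e e0.
have [m me] : exists m : nat, m.+1%:R^-1 < e.
  have [N _ HN] := near_infty_natSinv_lt (PosNum e0).
  by exists N; exact: (HN N (leqnn N)).
have [_ /(_ x Ax)[z zS xz]] := HS m.
have /onthP[k kz] := zS.
by exists m, k, z; split; last exact: lt_trans me.
Qed.

End EuclideanCovers.

(** * Admissible words as paths of the graph *)

Section Words.
Context {V : finType} {E : countType} (ini ter : E -> V).
Implicit Types (a b w : seq E) (u v : V) (e : E) (tau : nat -> E).

(* The word [a] labels a path of the graph from the vertex [u] to the vertex [v];
   unlike admissibility, this composes without a case for the empty word. *)
Fixpoint wt a u v : bool :=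
  if a is e :: b then (ini e == u) && wt b (ter e) v else u == v.

Lemma wt_cat a b u v : wt (a ++ b) u v <-> exists2 w, wt a u w & wt b w v.
Proof.
elim: a u => [|e a IH] u /=.
  by split=> [h|[w /eqP->]//]; exists u.
split=> [/andP[-> /IH[w h1 h2]]|[w /andP[-> h1] h2]]; first by exists w.
by apply/IH; exists w.
Qed.

Lemma sorted_wt e b : sorted (adm ini ter) (e :: b) =
  wt (e :: b) (ini e) (ter (last e b)).
Proof.
rewrite /= eqxx /=; elim: b e => [|e' b IH] e /=; first by rewrite eqxx.
by rewrite IH /adm eq_sym.
Qed.

Lemma wt_sorted a u v : wt a u v -> sorted (adm ini ter) a.
Proof.
case: a => [//|e b] /= /andP[_]; elim: b e => [//|e' b IH] e /= /andP[h1 h2].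
by rewrite IH// andbT /adm eq_sym.
Qed.

Lemma wt_last e b u v : wt (e :: b) u v -> v = ter (last e b).
Proof. by elim: b e u => [|e' b IH] e u /= /andP[_ ]; [move/eqP|exact: IH]. Qed.

Lemma mkseq_shift (tau : nat -> E) n : mkseq tau n.+1 = tau 0%N :: mkseq (Defs.shift tau) n.
Proof. by rewrite /mkseq /= -[1%N]addn0 iotaDl -map_comp. Qed.

Lemma mkseq_word_cat a tau : mkseq (word_cat a tau) (size a) = a.
Proof.
elim: a => [//|e a IH]; rewrite [size _]/= mkseq_shift; congr (_ :: _); exact: IH.
Qed.

Lemma word_cat_size a tau : word_cat a tau (size a) = tau 0%N.
Proof. by elim: a. Qed.

Lemma shift_space_shift tau : shift_space ini ter tau -> shift_space ini ter (Defs.shift tau).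
Proof. by move=> h n; exact: h. Qed.

Lemma wt_mkseq tau n : shift_space ini ter tau ->
  wt (mkseq tau n) (ini (tau 0%N)) (ini (tau n)).
Proof.
elim: n tau => [|n IH] tau st; first by rewrite /= eqxx.
rewrite mkseq_shift /= eqxx /=; have /eqP -> := st 0%N.
exact: (IH (Defs.shift tau) (shift_space_shift st)).
Qed.

Lemma wt_word_cat a u v tau : wt a u v -> shift_space ini ter tau ->
  ini (tau 0%N) = v -> shift_space ini ter (word_cat a tau) /\
  ini (word_cat a tau 0%N) = u.
Proof.
elim: a u => [|e a IH] u /= => [/eqP-> //|/andP[/eqP <- wa] st iv].
have [h1 h2] := IH _ wa st iv; split=> // -[|n]; last exact: h1.
by rewrite /adm /= h2.
Qed.

End Words.

Lemma ln_le_sub1 (R : realType) (x : R) : 0 < x -> ln x <= x - 1.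
Proof.
move=> x0; have := @le_ln1Dx R (x - 1); rewrite addrCA subrr addr0.
by apply; rewrite ltrBrDl subrr.
Qed.

Lemma ln_sub_le (R : realType) (x y t : R) : 0 < x -> 0 < y ->
  x <= (1 + t) * y -> ln x - ln y <= t.
Proof.
move=> x0 y0 h; rewrite -ln_div ?posrE//.
apply: le_trans (ln_le_sub1 _) _; first exact: divr_gt0.
by rewrite lerBlDl ler_pdivrMr.
Qed.

Lemma ler_wln (R : realType) (x y : R) : 0 < x -> x <= y -> ln x <= ln y.
Proof. by move=> x0 xy; rewrite ler_ln ?posrE// (lt_le_trans x0). Qed.

#[local] Opaque dnorm enorm.

(** * Bounded distortion and packing along a fixed orbit of the base *)

Section Geometry.
Context {disp : measure_display} {Omega : measurableType disp} {R : realType}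
  {d : nat} {V : finType} {E : countType} {ini ter : E -> V}.
Variables (theta : Omega -> Omega) (Phi : rgdms Omega R d ini ter).
Variable W : V -> set 'rV[R]_d.
Variables (L alpha : R) (M : E -> R).

Local Notation X := (vset Phi).
Local Notation phi := (gmap Phi).
Local Notation wm := (word_map theta Phi).
Local Notation kap := (contr Phi).
Local Notation wt := (wt ini ter).
Local Notation E_A := (shift_space ini ter).

Definition good_base (omega : Omega) : Prop := [/\
  forall e e', e != e' ->
    (phi e omega @` (X (ter e))°) `&` (phi e' omega @` (X (ter e'))°) = set0,
  forall e x y, W (ter e) x -> W (ter e) y ->
      `|dnorm (phi e omega) y - dnorm (phi e omega) x|
        <= L * dnorm (phi e omega) x * enorm (y - x) `^ alpha &
  forall e, M e < inf [set dnorm (phi e omega) x | x in X (ter e)]].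

(** Taken along the whole forward orbit, because [word_map] reads the letter at position [n] over
    [iter n theta omega]. *)
Definition good (omega : Omega) : Prop := forall n, good_base (iter n theta omega).

Lemma good_theta omega : good omega -> good (theta omega).
Proof. by move=> h n; rewrite -iterSr; exact: h. Qed.

Lemma good_iter n omega : good omega -> good (iter n theta omega).
Proof. by elim: n => [//|n IH] /IH; rewrite iterS; exact: good_theta. Qed.

Hypothesis d0 : (0 < d)%N.
Hypothesis HC1 : cond_C1 Phi.
Hypothesis HC3 : cond_C3 Phi W.
Hypothesis L1 : 1 <= L.
Hypothesis alpha01 : 0 < alpha < 1.
Hypothesis M0 : forall e, 0 < M e.

Variables (eps diamX : R).
Hypothesis eps0 : 0 < eps.
Hypothesis epsW : forall v x y, X v x -> enorm (y - x) < eps -> W v y.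
Hypothesis epsL : kap * (1 + L * (2 * eps) `^ alpha) <= (1 + kap) / 2.
Hypothesis diamX_ge0 : 0 <= diamX.
Hypothesis diamXP : forall v x y, X v x -> X v y -> enorm (x - y) <= diamX.

Let alpha0 : 0 < alpha. Proof. by case/andP: alpha01. Qed.
Let kap0 : 0 < kap. Proof. by case/andP: (contr_bounds Phi). Qed.
Let kap1 : kap < 1. Proof. by case/andP: (contr_bounds Phi). Qed.

(* Contraction ratio of all the maps on the [eps]-thickenings of the X_v. *)
Definition rate : R := (1 + kap) / 2.

Let rate0 : 0 < rate. Proof. by rewrite /rate; have := kap0; lra. Qed.
Let rate1 : rate < 1. Proof. by rewrite /rate; have := kap1; lra. Qed.
Let kap_rate : kap <= rate. Proof. by rewrite /rate; have := kap1; lra. Qed.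

Definition thick v : set 'rV[R]_d :=
  [set y | exists2 x, X v x & enorm (y - x) < eps].

Lemma sub_thick v : X v `<=` thick v.
Proof. by move=> x Xx; exists x; rewrite ?subrr ?enorm0. Qed.

Lemma thick_W v : thick v `<=` W v.
Proof. by move=> y [x Xx yx]; exact: epsW yx. Qed.

Lemma letter_conf e omega x : W (ter e) x -> conf_at (phi e omega) x.
Proof.
move=> Wx; have [_ H _] := HC3; have [[[df _] _ _] Hc] := H e omega.
by have [c c0 cP] := Hc x Wx; have [] := conf_atP d0 c0 (df x Wx) cP.
Qed.

Lemma letter_dnorm_int e omega x : (X (ter e))° x -> dnorm (phi e omega) x <= kap.
Proof.
move=> /nbhs_enormP[r r0 rX].
have Xx : X (ter e) x by apply: rX; rewrite subrr enorm0.
apply: (dnorm_le_lipschitz r0 (ltW kap0)) => //.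
- exact/letter_conf/thick_W/sub_thick.
- by move=> y yx; apply: gmap_lipschitz => //; exact: rX.
Qed.

(** The Lipschitz constant controls the derivative only at interior points. A point of the
    thickening is within [eps] of some point of [X], itself within [eps] of an interior one, whence
    the [2 * eps] in [epsL]. *)
Lemma letter_dnorm_thick e omega y : good_base omega -> thick (ter e) y ->
  dnorm (phi e omega) y <= rate.
Proof.
move=> [_ hol _] [x Xx yx].
have [_ _ clX] := HC1 (ter e).
have : closure (X (ter e))° x by rewrite clX.
move=> /(_ [set y | enorm (y - x) < eps])[|z [Xz zx]].
  by apply/nbhs_enormP; exists eps.
have Xz' : X (ter e) z by exact: interior_subset.
have Wz : W (ter e) z by exact/thick_W/sub_thick.
have Wy : W (ter e) y by apply: thick_W; exists x.
have := hol e z y Wz Wy; rewrite ler_distl => /andP[_ h].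
apply: (le_trans h); apply: (le_trans _ epsL).
have [_ [dz0 _]] := letter_conf omega Wz.
have dz := letter_dnorm_int omega Xz.
set D := dnorm _ _ in dz dz0 *.
have p0 : 0 <= enorm (y - z) `^ alpha by exact: powR_ge0.
have p1 : enorm (y - z) `^ alpha <= (2 * eps) `^ alpha.
  apply: ge0_ler_powR; rewrite ?nnegrE ?enorm_ge0 ?mulr_ge0 ?(ltW alpha0) ?(ltW eps0)//.
  rewrite (le_trans (enorm_tri x _ _))// mulr_natl mulr2n.
  by apply: lerD; apply: ltW => //; rewrite enormC.
set p := enorm _ `^ _ in p0 p1 *; set p' := (2 * eps) `^ _ in p1 *.
rewrite (_ : D + _ = D * (1 + L * p)); last ring.
have L0 : 0 <= L by apply: le_trans L1.
by apply: ler_pM => //; [exact: ltW|rewrite addr_ge0 ?mulr_ge0|rewrite lerD2l ler_wpM2l].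
Qed.

Lemma letter_ball e omega x y y' : good_base omega -> X (ter e) x ->
  enorm (y - x) < eps -> enorm (y' - x) < eps ->
  enorm (phi e omega y' - phi e omega y) <= rate * enorm (y' - y).
Proof.
move=> gw Xx; apply: mean_value => {y y'} y yx.
have ty : thick (ter e) y by exists x.
have [dy [_ cy]] := letter_conf omega (thick_W ty).
split=> // v; rewrite cy ler_wpM2r ?enorm_ge0//.
exact: letter_dnorm_thick.
Qed.

Lemma wm_cat a b omega x :
  wm (a ++ b) omega x = wm a omega (wm b (iter (size a) theta omega) x).
Proof. by elim: a omega => [//|e a IH] omega /=; rewrite IH -iterSr. Qed.

Lemma wm_X a u v omega x : wt a u v -> X v x -> X u (wm a omega x).
Proof.
elim: a u omega => [|e a IH] u omega /= => [/eqP->//|/andP[/eqP <- wa] Xx].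
exact/gmap_into/IH.
Qed.

Lemma wm_lip a u v omega x y : wt a u v -> X v x -> X v y ->
  enorm (wm a omega x - wm a omega y) <= kap ^+ size a * enorm (x - y).
Proof.
elim: a u omega => [|e a IH] u omega /=; first by rewrite mul1r.
move=> /andP[_ wa] Xx Xy.
rewrite (le_trans (gmap_lipschitz _ (wm_X _ wa Xx) (wm_X _ wa Xy)))//.
by rewrite exprS -mulrA ler_wpM2l ?(ltW kap0)//; exact: IH wa Xx Xy.
Qed.

Lemma wm_conf_X a u v omega x : wt a u v -> X v x -> conf_at (wm a omega) x.
Proof.
elim: a u omega => [|e a IH] u omega /=; first by move=> _ _; have [] := conf_at_id x d0.
move=> /andP[_ wa] Xx.
have h1 := IH _ (theta omega) wa Xx.
have h2 := letter_conf omega (thick_W (sub_thick (wm_X (theta omega) wa Xx))).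
by have [] := conf_at_comp d0 h1 h2.
Qed.

Lemma wm_ball a u v omega x : good omega -> wt a u v -> X v x ->
  forall y y', enorm (y - x) < eps -> enorm (y' - x) < eps ->
  enorm (wm a omega y' - wm a omega y) <= rate ^+ size a * enorm (y' - y).
Proof.
move=> + + Xx; elim: a u omega => [|e a IH] u omega gw /=.
  by move=> _ y y' _ _; rewrite mul1r.
move=> /andP[_ wa] y y' yx yx'.
have xx : enorm (x - x) < eps by rewrite subrr enorm0.
have IH' := IH _ _ (good_theta gw) wa.
have stay w : enorm (w - x) < eps -> enorm (wm a (theta omega) w - wm a (theta omega) x) < eps.
  move=> wx; apply: le_lt_trans (IH' _ _ xx wx) _; apply: le_lt_trans _ wx.
  by rewrite ler_piMl ?enorm_ge0// exprn_ile1// ltW.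
apply: le_trans (letter_ball (gw 0%N) (wm_X _ wa Xx) (stay _ yx) (stay _ yx')) _.
by rewrite exprS -mulrA ler_wpM2l ?(ltW rate0)// IH'.
Qed.

Lemma wm_thick a u v omega y : good omega -> wt a u v -> thick v y ->
  thick u (wm a omega y).
Proof.
move=> gw wa [x Xx yx]; exists (wm a omega x); first exact: wm_X wa Xx.
have xx : enorm (x - x) < eps by rewrite subrr enorm0.
apply: le_lt_trans (wm_ball gw wa Xx xx yx) _; apply: le_lt_trans _ yx.
by rewrite ler_piMl ?enorm_ge0// exprn_ile1// ltW.
Qed.

Lemma wm_conf a u v omega y : good omega -> wt a u v -> thick v y ->
  conf_at (wm a omega) y.
Proof.
elim: a u omega => [|e a IH] u omega gw /=; first by move=> _ _; have [] := conf_at_id y d0.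
move=> /andP[_ wa] ty.
have h1 := IH _ _ (good_theta gw) wa ty.
have h2 := letter_conf omega (thick_W (wm_thick (good_theta gw) wa ty)).
by have [] := conf_at_comp d0 h1 h2.
Qed.

Definition ld a omega y : R := ln (dnorm (wm a omega) y).

Lemma ld_cons e a u v omega y : good omega -> wt a u v -> ter e = u -> thick v y ->
  ld (e :: a) omega y =
  ln (dnorm (phi e omega) (wm a (theta omega) y)) + ld a (theta omega) y.
Proof.
move=> gw wa eu ty.
have h1 := wm_conf (good_theta gw) wa ty.
have tu := wm_thick (good_theta gw) wa ty; rewrite -eu in tu.
have h2 := letter_conf omega (thick_W tu).
have [_ e1] := conf_at_comp d0 h1 h2.
rewrite /ld; have -> : wm (e :: a) omega = phi e omega \o wm a (theta omega) by [].
have [_ [p1 _]] := h1; have [_ [p2 _]] := h2.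
rewrite e1; exact: (@lnM R _ _ p2 p1).
Qed.

Definition osc : R := 2 * eps + diamX.

(* Sum of the geometric series [L * (osc * rate ^+ n) `^ alpha]. *)
Definition distK : R := L * osc `^ alpha / (1 - rate `^ alpha).

Let ra0 : 0 <= rate `^ alpha. Proof. exact: powR_ge0. Qed.
Let ra1 : rate `^ alpha < 1.
Proof.
have e1 : (1 : R) `^ alpha = 1 by rewrite powR1.
by rewrite -[ltRHS]e1; apply: gt0_ltr_powR; rewrite ?nnegrE ?(ltW rate0).
Qed.

Lemma distK_ge0 : 0 <= distK.
Proof.
by rewrite /distK divr_ge0 ?subr_ge0 ?(ltW ra1)// mulr_ge0 ?powR_ge0// (le_trans _ L1).
Qed.

(** Two points of [thick v] need not share a ball. The path goes through their base points in [X v]: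
    the outer legs contract on balls, the middle one by the Lipschitz bound on [X v]. This explains
    the two [eps] and the [diamX] in [osc]. *)
Lemma wm_osc a u v omega y y' : good omega -> wt a u v -> thick v y -> thick v y' ->
  enorm (wm a omega y - wm a omega y') <= osc * rate ^+ size a.
Proof.
move=> gw wa [x Xx yx] [x' Xx' yx'].
have xx (z : 'rV[R]_d) : enorm (z - z) < eps by rewrite subrr enorm0.
have h1 := wm_ball gw wa Xx (xx x) yx.
have h2 := wm_ball gw wa Xx' (xx x') yx'.
have h3 := wm_lip omega wa Xx Xx'.
have h4 := diamXP Xx Xx'.
rewrite (le_trans (enorm_tri (wm a omega x) _ _))//.
apply: (le_trans (lerD (le_refl _) (enorm_tri (wm a omega x') _ _))).
have kr : kap ^+ size a <= rate ^+ size a.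
  by apply: lerXn2r; rewrite ?nnegrE ?(ltW kap0) ?(ltW rate0).
have r0 : 0 <= rate ^+ size a by rewrite exprn_ge0// ltW.
rewrite [enorm (wm a omega x' - _)]enormC.
have h5 : kap ^+ size a * enorm (x - x') <= rate ^+ size a * diamX.
  by apply: ler_pM => //; rewrite ?exprn_ge0 ?enorm_ge0// ltW.
rewrite /osc; nra.
Qed.

Lemma letter_distortion e omega y y' : good_base omega -> W (ter e) y -> W (ter e) y' ->
  `|ln (dnorm (phi e omega) y) - ln (dnorm (phi e omega) y')| <= L * enorm (y - y') `^ alpha.
Proof.
move=> [_ hol _].
have half w w' : W (ter e) w -> W (ter e) w' ->
    ln (dnorm (phi e omega) w) - ln (dnorm (phi e omega) w') <= L * enorm (w - w') `^ alpha.
  move=> Ww Ww'.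
  have [_ [p0 _]] := letter_conf omega Ww; have [_ [p0' _]] := letter_conf omega Ww'.
  have := hol e w' w Ww' Ww; rewrite ler_distl => /andP[_].
  move=> h; apply: (ln_sub_le p0 p0'); apply: (le_trans h).
  by rewrite mulrDl mul1r lerD2l mulrAC.
move=> Wy Wy'; rewrite ler_norml half// andbT lerNl opprB.
by rewrite enormC; exact: half.
Qed.

(** With q = rate ^ alpha, the quantity [distK] times 1 - q ^ n is the [n]-th partial sum of the
    distortion series; carrying it instead of [distK] makes the induction on words close. *)
Lemma distortion_step n (t : R) : 0 <= t -> t <= osc * rate ^+ n ->
  L * t `^ alpha + distK * (1 - (rate `^ alpha) ^+ n) <= distK * (1 - (rate `^ alpha) ^+ n.+1).
Proof.
move=> t0 tn.
have osc0 : 0 <= osc by rewrite /osc addr_ge0 ?mulr_ge0// ltW.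
have e1 : distK * (1 - rate `^ alpha) = L * osc `^ alpha.
  by rewrite /distK divfK// gt_eqF// subr_gt0.
have h : t `^ alpha <= osc `^ alpha * (rate `^ alpha) ^+ n.
  apply: (@le_trans _ _ ((osc * rate ^+ n) `^ alpha)).
    by apply: ge0_ler_powR; rewrite ?nnegrE ?mulr_ge0 ?exprn_ge0 ?(ltW alpha0) ?(ltW rate0).
  rewrite powRM ?exprn_ge0 ?(ltW rate0)//.
  by rewrite -(powR_mulrn n (ltW rate0)) powRAC powR_mulrn.
have L0 : 0 <= L by apply: le_trans L1.
have : L * t `^ alpha <= L * osc `^ alpha * (rate `^ alpha) ^+ n.
  by rewrite -mulrA ler_wpM2l.
rewrite -e1 exprS; nra.
Qed.

Lemma distK_bound n : distK * (1 - (rate `^ alpha) ^+ n) <= distK.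
Proof. by rewrite ler_piMr ?distK_ge0// gerBl exprn_ge0. Qed.

(** By the chain rule, the first letter of [e :: a] acts on two points that the rest of the word has
    already brought to distance [osc * rate ^+ size a]; the Hoelder condition turns these distances
    into a convergent series. *)
Lemma ld_distortion a u v omega y y' : good omega -> wt a u v ->
  thick v y -> thick v y' -> `|ld a omega y - ld a omega y'| <= distK.
Proof.
move=> gw wa ty ty'; apply: le_trans _ (distK_bound (size a)).
elim: a u omega gw wa => [|e a IH] u omega gw /=.
  have e1 w : ld [::] omega w = 0.
    by rewrite /ld (_ : wm [::] omega = id)//; have [_ ->] := conf_at_id w d0; rewrite ln1.
  by move=> _; rewrite !e1 subrr normr0 subrr mulr0.
move=> /andP[_ wa].
rewrite !(ld_cons gw wa (erefl _)) // opprD addrACA.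
apply: le_trans (ler_normD _ _) _.
have g' := good_theta gw.
apply: le_trans (distortion_step (enorm_ge0 _) (wm_osc g' wa ty ty')).
apply: lerD; last exact: (IH _ _ g' wa).
exact: letter_distortion (gw 0%N) (thick_W (wm_thick g' wa ty)) (thick_W (wm_thick g' wa ty')).
Qed.

(** The images under the prefixes are nested and compact, so they have a common point and [get]
    returns one. The point [y] serves as the coding of the shifted sequence. *)
Lemma coding_mem tau omega n : E_A tau ->
  exists2 y, X (ini (tau n)) y & coding theta Phi omega tau = wm (mkseq tau n) omega y.
Proof.
move=> st.
have it n' : ter (tau n') = ini (tau n'.+1) by exact/eqP/(st n').
pose K n := wm (mkseq tau n.+1) omega @` X (ter (tau n)).
have wK n' : wt (mkseq tau n'.+1) (ini (tau 0%N)) (ter (tau n')).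
  by rewrite it; exact: wt_mkseq.
have Kdecr n' : K n'.+1 `<=` K n'.
  move=> _ [y Xy <-]; rewrite /K; exists (phi (tau n'.+1) (iter n'.+1 theta omega) y).
    by rewrite it; exact: gmap_into.
  rewrite -[n'.+2]addn1 /mkseq iotaD add0n map_cat wm_cat /=.
  by rewrite size_map size_iota.
have [p Kp] : (\bigcap_n K n) !=set0.
  have subK m n' : (n' <= m)%N -> K m `<=` K n'.
    elim: m => [|m IH]; first by rewrite leqn0 => /eqP->.
    rewrite leq_eqVlt => /orP[/eqP->//|/IH h]; exact: subset_trans h.
  have cK n' : compact (K n').
    apply: continuous_compact; last exact: vset_compact.
    apply: continuous_in_subspaceT => x /set_mem Xx.
    exact/differentiable_continuous/(wm_conf_X omega (wK n') Xx).1.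
  have K0 n' : K n' !=set0.
    by have [y Xy] := vset_nonempty Phi (ter (tau n')); exists (wm (mkseq tau n'.+1) omega y), y.
  have [p Kp] := choice K0.
  have [x [_ clx]] : K 0%N `&` cluster (p @ \oo) !=set0.
    by apply: (cK 0%N); exists 0%N => // m _; exact: (subK m).
  exists x => n' _.
  have /closure_id -> : closed (K n') by exact: compact_closed (@norm_hausdorff _ _) (cK n').
  by move=> B nB; apply: clx nB; exists n' => // m nm; exact: (subK m _ nm).
have : (\bigcap_n K n) (coding theta Phi omega tau).
  by apply: getPex; exists p.
(* Membership number [n] concerns the prefix of length [n.+1], so the empty prefix is served by the
   first letter. *)
case: n => [|n] /(_ _ I).
  move=> /(_ 0%N)[y Xy <-]; exists (wm (mkseq tau 1) omega y) => //.
  exact: wm_X (wK 0%N) Xy.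
by move=> /(_ n)[y Xy <-]; exists y => //; rewrite -it.
Qed.

(** Each term of the Birkhoff sum is a one-letter derivative at a coding point. [coding_mem] writes
    that point as an image under the rest of the word, so only the base point differs from the chain
    rule for [ld a omega y], and the same series bounds the difference. *)
Lemma birkhoff_ld a u v tau omega y : good omega -> wt a u v -> E_A tau ->
  ini (tau 0%N) = v -> thick v y ->
  `|birkhoff theta Phi (size a) (word_cat a tau) omega - ld a omega y| <= distK.
Proof.
move=> gw wa st iv ty; apply: le_trans _ (distK_bound (size a)).
elim: a u omega gw wa => [|e a IH] u omega gw /=.
  move=> _; rewrite /birkhoff big_ord0 /ld (_ : wm [::] omega = id)//.
  by have [_ ->] := conf_at_id y d0; rewrite ln1 subrr normr0 subrr mulr0.
move=> /andP[_ wa].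
rewrite /birkhoff big_ord_recl /=.
have -> : \sum_(i < size a) zeta theta Phi (iter (bump 0 i) (@Defs.shift E) (scons e (word_cat a tau)))
    (iter (bump 0 i) theta omega) = birkhoff theta Phi (size a) (word_cat a tau) (theta omega).
  by apply: eq_bigr => i _; rewrite /bump add1n !iterSr.
rewrite (ld_cons gw wa (erefl _)) // opprD addrACA.
apply: le_trans (ler_normD _ _) _.
have g' := good_theta gw.
have [sw iw] := wt_word_cat wa st iv.
have [y' Xy' e'] := coding_mem (theta omega) (size a) sw.
have iv' : ini (word_cat a tau (size a)) = v by rewrite word_cat_size.
rewrite mkseq_word_cat iv' in Xy' e'.
apply: le_trans (distortion_step (enorm_ge0 _) (wm_osc g' wa (sub_thick Xy') ty)).
apply: lerD; last exact: (IH _ _ g' wa).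
rewrite /zeta /=.
have -> : Defs.shift (scons e (word_cat a tau)) = word_cat a tau by [].
rewrite e'.
exact: letter_distortion (gw 0%N)
  (thick_W (wm_thick g' wa (sub_thick Xy'))) (thick_W (wm_thick g' wa ty)).
Qed.

Variables (z : V -> 'rV[R]_d) (S : V -> seq 'rV[R]_d) (rho : R).
Hypothesis z_int : forall v, (X v)° (z v).
Hypothesis rho0 : 0 < rho.
Hypothesis rho_eps : rho <= eps.
Hypothesis SX : forall v p, p \in S v -> forall y, enorm (y - p) < rho -> X v y.
Hypothesis Scover : forall v x, X v x -> exists2 p, p \in S v & enorm (x - p) < eps.

(** Evaluated at one interior point of the terminal set: there the Lipschitz bound on [X] controls
    the derivative without a distortion constant, and the derivative is a limit of quotients of
    values on [X], hence measurable. The value 0 agrees with the identity map of the empty word. *)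
Definition gpot (a : seq E) omega : R :=
  if a is e :: b then ld a omega (z (ter (last e b))) else 0.

Let zX v : X v (z v). Proof. exact: interior_subset. Qed.

Lemma gpot_wt a u v omega : wt a u v -> gpot a omega = ld a omega (z v).
Proof.
case: a => [_|e b /wt_last ->//]; rewrite /= /ld (_ : wm [::] omega = id)//.
by have [_ ->] := conf_at_id (z v) d0; rewrite ln1.
Qed.

Lemma ld_gpot a u v omega y : good omega -> wt a u v -> thick v y ->
  `|ld a omega y - gpot a omega| <= distK.
Proof.
move=> gw wa ty; rewrite (gpot_wt omega wa).
exact: ld_distortion gw wa ty (sub_thick (zX v)).
Qed.

(** The chain rule is exact if the derivative of [a] is taken at the image of [z w] under [b];
    distortion moves that point to [z v] at the cost of one [distK]. *)
Lemma gpot_cat a b u v w omega : good omega -> wt a u v -> wt b v w ->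
  `|gpot (a ++ b) omega - gpot a omega - gpot b (iter (size a) theta omega)| <= distK.
Proof.
move=> gw wa wb.
have wab : wt (a ++ b) u w by apply/wt_cat; exists v.
rewrite (gpot_wt _ wab) (gpot_wt _ wb).
have h1 := wm_conf_X (iter (size a) theta omega) wb (zX w).
have tb := sub_thick (wm_X (iter (size a) theta omega) wb (zX w)).
have h2 := wm_conf gw wa tb.
have [_ e1] := conf_at_comp d0 h1 h2.
have -> : ld (a ++ b) omega (z w) =
    ld a omega (wm b (iter (size a) theta omega) (z w)) + ld b (iter (size a) theta omega) (z w).
  have e2 : wm (a ++ b) omega = wm a omega \o wm b (iter (size a) theta omega).
    by apply/funext => x; rewrite wm_cat.
  by rewrite /ld e2 e1; exact: (@lnM R _ _ h2.2.1 h1.2.1).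
rewrite addrAC addrK.
exact: ld_gpot gw wa tb.
Qed.

Lemma gpot_ub a u v omega : wt a u v -> gpot a omega <= (size a)%:R * ln kap.
Proof.
move=> wa; rewrite (gpot_wt _ wa).
have /nbhs_enormP[r r0 rX] := z_int v.
have cz := wm_conf_X omega wa (zX v).
have h : dnorm (wm a omega) (z v) <= kap ^+ size a.
  apply: (dnorm_le_lipschitz r0 _ cz d0); first by rewrite exprn_ge0// ltW.
  by move=> y yz; apply: wm_lip wa (rX _ yz) (zX v).
rewrite /ld mulr_natl -lnXn//.
exact: ler_wln cz.2.1 h.
Qed.

Lemma gpot_letter e omega : good omega -> ln (M e) <= gpot [:: e] omega.
Proof.
move=> gw; have [_ _ /(_ e) h] := gw 0%N.
rewrite /gpot /ld /=; apply: ler_wln => //.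
apply: ltW; apply: (lt_le_trans h); apply: ge_inf; last by exists (z (ter e)).
by exists 0 => _ [x Xx <-]; apply: ltW; have [_ []] := letter_conf omega (thick_W (sub_thick Xx)).
Qed.

Lemma birkhoff_gpot a u v tau omega : good omega -> wt a u v -> E_A tau ->
  ini (tau 0%N) = v ->
  `|birkhoff theta Phi (size a) (word_cat a tau) omega - gpot a omega| <= distK.
Proof.
move=> gw wa st iv; rewrite (gpot_wt _ wa).
exact: birkhoff_ld gw wa st iv (sub_thick (zX v)).
Qed.

Lemma dnorm_gpot a u v omega y : good omega -> wt a u v -> thick v y ->
  expR (gpot a omega - distK) <= dnorm (wm a omega) y <= expR (gpot a omega + distK).
Proof.
move=> gw wa ty; have := ld_gpot gw wa ty; rewrite ler_distl.
have [_ [p0 _]] := wm_conf gw wa ty.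
by rewrite /ld -{3 4}(lnK p0) !ler_expR.
Qed.

Lemma wm_gpot a u v omega x : good omega -> wt a u v -> X v x ->
  forall y y', enorm (y - x) < eps -> enorm (y' - x) < eps ->
  enorm (wm a omega y' - wm a omega y) <= expR (gpot a omega + distK) * enorm (y' - y).
Proof.
move=> gw wa Xx; apply: mean_value => y yx.
have ty : thick v y by exists x.
have [dy [_ cy]] := wm_conf gw wa ty.
split=> // w; rewrite cy ler_wpM2r ?enorm_ge0//.
by have /andP[] := dnorm_gpot gw wa ty.
Qed.

(** The lower derivative bound makes the word map expanding at scale [expR (gpot a omega - distK)],
    so images of balls contain balls of comparable size. Both openness of images and the packing
    rest on this. *)
Lemma wm_image_ball a u v omega x r : good omega -> wt a u v -> r <= eps ->
  X v x ->
  forall y, enorm (y - wm a omega x) < expR (gpot a omega - distK) * r ->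
  exists2 x', enorm (x' - x) < r & wm a omega x' = y.
Proof.
move=> gw wa re Xx; apply: expanding_ball; first exact: expR_gt0.
move=> y yx; have ty : thick v y by exists x => //; exact: lt_le_trans re.
have [dy [_ cy]] := wm_conf gw wa ty.
split=> // w; rewrite cy ler_wpM2r ?enorm_ge0//.
by have /andP[] := dnorm_gpot gw wa ty.
Qed.

Lemma wm_interior a u v omega x : good omega -> wt a u v -> (X v)° x ->
  (X u)° (wm a omega x).
Proof.
move=> gw wa /nbhs_enormP[r r0 rX].
pose r' := Num.min r eps.
have r'0 : 0 < r' by rewrite lt_min r0.
apply/nbhs_enormP; exists (expR (gpot a omega - distK) * r').
  by rewrite mulr_gt0// expR_gt0.
have Xx : X v x by apply: rX; rewrite subrr enorm0.
have re : r' <= eps by rewrite ge_min lexx orbT.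
move=> y /(wm_image_ball gw wa re Xx)[x' xx' <-].
apply: wm_X wa (rX _ _); apply: lt_le_trans xx' _.
by rewrite ge_min lexx.
Qed.

(** The common prefix is removed by injectivity; at the first differing letter the open set
    condition over the corresponding base point applies. *)
Lemma wm_disjoint a a' u v u' v' omega x x' : good omega ->
  wt a u v -> wt a' u' v' -> ~~ prefix a a' -> ~~ prefix a' a ->
  (X v)° x -> (X v')° x' -> wm a omega x <> wm a' omega x'.
Proof.
elim: a a' u u' omega => [|e a IH] [|e' a'] u u' omega gw //=.
move=> /andP[_ wa] /andP[_ wa'].
have g' := good_theta gw.
case: (eqVneq e e') => [ee|ee'] /=.
  rewrite -ee in wa' *.
  move=> p p' ix ix' /gmap_inj h.
  apply: (IH _ _ _ _ g' wa wa' p p' ix ix'); apply: h.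
    exact: wm_X wa (interior_subset ix).
  exact: wm_X wa' (interior_subset ix').
move=> _ _ ix ix' h.
have [/(_ e e' ee') h0 _ _] := gw 0%N.
suff : set0 (wm (e :: a) omega x) by [].
rewrite -h0; split.
  by exists (wm a (theta omega) x) => //; exact: wm_interior g' wa ix.
by rewrite /= h; exists (wm a' (theta omega) x') => //; exact: wm_interior g' wa' ix'.
Qed.

(* The images of the interiors under pairwise incomparable words are disjoint and
   contain balls of radius comparable to [r] near [p0]; flooring the coordinates
   of their centres at a mesh proportional to [r] separates them. *)
Lemma packing (c : R) : 0 < c -> exists I : finType, forall omega r (T : set (seq E)) p0,
  good omega -> 0 < r ->
  (forall t, T t -> c * r <= expR (gpot t omega) <= r) ->
  (forall t t', T t -> T t' -> prefix t t' -> t = t') ->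
  (forall t, T t -> exists tau, [/\ E_A tau, t = mkseq tau (size t) &
     enorm (coding theta Phi omega tau - p0) <= r]) ->
  exists f : seq E -> I, forall t t', T t -> T t' -> f t = f t' -> t = t'.
Proof.
move=> c0.
(* [C * r] bounds the distance from a chosen centre to [p0]: the coded point is within [r], the
   centre within [expR distK * eps * r] of it. The mesh [h * r] is such that [d] coordinate errors
   add up to half the inner radius [expR (- distK) * c * r * rho]. *)
pose C := expR distK * eps + 1.
pose h := expR (- distK) * c * rho / (2 * d%:R).
have dR0 : 0 < d%:R :> R by rewrite ltr0n.
have h0 : 0 < h by rewrite /h divr_gt0 ?mulr_gt0// expR_gt0.
have C0 : 0 < C by rewrite /C addr_gt0// mulr_gt0// expR_gt0.
pose N := Num.truncn (2 * C / h).
exists {ffun 'I_d -> 'I_N.+1} => omega r T p0 gw r0 Tr Tinc Tp.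
have /choice[P HP] : forall t, exists p, T t -> exists u v q,
    [/\ wt t u v, (X v)° q, q \in S v, p = wm t omega q & enorm (p - p0) <= C * r].
  move=> t; have [Tt|nTt] := pselect (T t); last by exists 0 => /nTt.
  have [tau [st et tp]] := Tp t Tt.
  have wtt : wt t (ini (tau 0%N)) (ini (tau (size t))) by rewrite {1}et; exact: wt_mkseq.
  have [y Xy cy] := coding_mem omega (size t) st; rewrite -et in cy.
  have [q qS yq] := Scover Xy.
  have Xq : X (ini (tau (size t))) q by apply: (SX qS); rewrite subrr enorm0.
  exists (wm t omega q) => _; exists (ini (tau 0%N)), (ini (tau (size t))), q; split=> //.
    by apply/nbhs_enormP; exists rho => // w; exact: SX qS w.
  apply: le_trans (enorm_tri (coding theta Phi omega tau) _ _) _.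
  rewrite /C mulrDl mul1r lerD// cy.
  have qq : enorm (q - q) < eps by rewrite subrr enorm0.
  apply: le_trans (wm_gpot gw wtt Xq yq qq) _.
  rewrite expRD [expR _ * expR _]mulrC -!mulrA ler_wpM2l ?expR_ge0// mulrC.
  apply: ler_pM; rewrite ?enorm_ge0 ?expR_ge0//; last by have /andP[] := Tr t Tt.
  by rewrite enormC ltW.
(* Shifting by [C / h] puts the scaled coordinates between 0 and [2 * C / h], so their integer parts
   fit in ['I_N.+1]. *)
pose F t : {ffun 'I_d -> 'I_N.+1} := [ffun j =>
  inord (Num.truncn ((P t ord0 j - p0 ord0 j) / (h * r) + C / h))].
exists F => t t' Tt Tt' Ftt'.
have [u [v [q [wtt iq qS eP bP]]]] := HP t Tt.
have [u' [v' [q' [wtt' iq' qS' eP' bP']]]] := HP t' Tt'.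
have hr0 : 0 < h * r by rewrite mulr_gt0.
have bnd s : enorm (P s - p0) <= C * r -> forall j,
    0 <= (P s ord0 j - p0 ord0 j) / (h * r) + C / h <= 2 * C / h.
  move=> bs j; have := le_trans (enorm_coord (P s - p0) j) bs.
  rewrite !mxE ler_norml => /andP[l1 l2].
  have e1 : C / h = C * r / (h * r) by rewrite -mulf_div divff ?mulr1// gt_eqF.
  have i0 : 0 <= (h * r)^-1 by rewrite invr_ge0 ltW.
  have m1 := ler_wpM2r i0 l1; have m2 := ler_wpM2r i0 l2.
  by rewrite -mulrA e1; apply/andP; split; lra.
have close j : `|P t ord0 j - P t' ord0 j| < h * r.
  have : F t j = F t' j by rewrite Ftt'.
  rewrite !ffunE => /(congr1 val) /=.
  have b1 := bnd t bP j; have b2 := bnd t' bP' j.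
  have /andP[b10 b11] := b1; have /andP[b20 b21] := b2.
  rewrite !inordK ?ltnS; first last.
  - exact: le_truncn.
  - exact: le_truncn.
  move=> e.
  have tr (x : R) : 0 <= x -> (Num.truncn x)%:R <= x /\ x < (Num.truncn x).+1%:R.
    by move=> x0; rewrite -truncn_ge_nat// -truncn_le_nat.
  have [k1 k2] := tr _ b10; have [k3 k4] := tr _ b20.
  rewrite e in k1 k2.
  set A := (P t ord0 j - _) / _ in k1 k2; set B := (P t' ord0 j - _) / _ in k3 k4.
  rewrite -[X in X < _](_ : `|(A - B) * (h * r)| = _); last first.
    by rewrite /A /B -mulrBl divfK ?gt_eqF// opprB addrA subrK.
  rewrite normrM (gtr0_norm hr0) gtr_pMl// ltr_norml.
  by rewrite -(natr1 _) in k2 k4; apply/andP; split; lra.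
(* In the same cell, the centre of [t'] falls into the ball contained in the image of the [rho]-ball
   around [q]. It is then the image of interior points under both words, which forces the words to
   be comparable. *)
have PP : enorm (P t' - wm t omega q) < expR (gpot t omega - distK) * rho.
  rewrite -eP; apply: le_lt_trans (enorm_le_sum _) _.
  apply: (@le_lt_trans _ _ (\sum_(j < d) h * r)).
    by apply: ler_sum => j _; rewrite !mxE distrC ltW.
  rewrite sumr_const card_ord -mulr_natr /h.
  have /andP[+ _] := Tr t Tt; move: (expR_gt0 (- distK)).
  rewrite expRD; move: (expR (- distK)) (expR (gpot t omega)) => k G k0 G1.
  have -> : k * c * rho / (2 * d%:R) * r * d%:R = (c * r) * (k * rho) / 2.
    by field; rewrite gt_eqF.
  have kr0 : 0 < k * rho by rewrite mulr_gt0.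
  have cr0 : 0 < c * r by rewrite mulr_gt0.
  by rewrite -mulrA; nra.
have Xq : X v q := interior_subset iq.
have [x xq ex] := wm_image_ball gw wtt rho_eps Xq PP.
have ix : (X v)° x.
  apply/nbhs_enormP; exists (rho - enorm (x - q)); first by rewrite subr_gt0.
  move=> w wx; apply: (SX qS); apply: le_lt_trans (enorm_tri x _ _) _.
  by rewrite -ltrBrDr.
have := wm_disjoint gw wtt wtt' _ _ ix iq'.
rewrite ex eP'.
case: (boolP (prefix t t')) => [p _|_]; first exact: Tinc.
case: (boolP (prefix t' t)) => [p _|_]; first exact/esym/Tinc.
by move=> /(_ isT isT).
Qed.

End Geometry.

#[local] Transparent enorm.

(** * Measurability of word maps and of their derivatives *)

Section MeasurableVectors.
Context {disp : measure_display} {Omega : measurableType disp} {R : realType}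
  {d : nat}.
Implicit Types (f g : Omega -> 'rV[R]_d) (A : set 'rV[R]_d).

(** Coordinatewise, so that differences and norms reduce to real-valued functions. *)
Definition measurable_rV f : Prop :=
  forall j, measurable_fun [set: Omega] (fun w => f w ord0 j).

Lemma measurable_rV_borel f :
  measurable_fun [set: Omega] (fun w => f w : borel_rV R d) -> measurable_rV f.
Proof.
move=> mf j; apply: (measurability _ (RGenOInfty.measurableE R)) => //.
move=> _ [_ [a ->] <-]; rewrite setTI.
pose B : set (borel_rV R d) := (fun x : 'rV[R]_d => x ord0 j) @^-1` `]a, +oo[.
have mB : measurable B.
  apply: sub_sigma_algebra; apply: open_comp; last exact: interval_open.
  by move=> x _; exact: coord_continuous.
by have := mf measurableT B mB; rewrite setTI.
Qed.

Lemma measurable_rVB f g : measurable_rV f -> measurable_rV g ->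
  measurable_rV (fun w => f w - g w).
Proof.
move=> mf mg j; under eq_fun do rewrite !mxE.
exact: (measurable_funB (mf j) (mg j)).
Qed.

Lemma measurable_rV_cst (x : 'rV[R]_d) : measurable_rV (fun=> x).
Proof. by move=> j; exact: measurable_cst. Qed.

Lemma measurable_enorm f : measurable_rV f ->
  measurable_fun [set: Omega] (fun w => enorm (f w)).
Proof.
move=> mf; apply: (@measurableT_comp _ _ _ _ _ _ (@Num.sqrt R)).
  by apply: continuous_measurable_fun; exact: sqrt_continuous.
by apply: measurable_sum => j; apply: measurable_funM.
Qed.

(* A Lipschitz function is the infimum of countably many cones, which gives the
   joint measurability. *)
Lemma measurable_rV_lipschitz (F : Omega -> 'rV[R]_d -> 'rV[R]_d) A f :
  compact A -> closure A° = A ->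
  (forall x, A x -> measurable_rV (F ^~ x)) ->
  (forall w x y, A x -> A y -> enorm (F w x - F w y) <= enorm (x - y)) ->
  measurable_rV f -> (forall w, A (f w)) ->
  measurable_rV (fun w => F w (f w)).
Proof.
move=> cA clA mF lF mf Af j.
have [q [qA qd]] := countable_dense cA clA.
apply: (measurability _ (RGenInftyO.measurableE R)) => //.
move=> _ [_ [a ->] <-]; rewrite setTI.
pose G m k := if q m k is Some z then
   [set w | F w z ord0 j + enorm (z - f w) < a] else set0.
have -> : (fun w => F w (f w) ord0 j) @^-1` `]-oo, a[ = \bigcup_m \bigcup_k G m k.
  apply/seteqP; split=> [w /=|w [m _ [k _]]].
    rewrite in_itv/= => wa; pose e := (a - F w (f w) ord0 j) / 2.
    have e0 : 0 < e by rewrite /e divr_gt0// subr_gt0.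
    have [m [k [z [qz fz]]]] := qd _ (Af w) e e0.
    exists m => //; exists k => //; rewrite /G qz /=.
    have /(le_trans (enorm_coord _ _)) := lF w z (f w) (qA _ _ _ qz) (Af w).
    move=> /(_ j); rewrite !mxE ler_norml => /andP[_ h].
    by rewrite (enormC (f w)) /e in fz; lra.
  rewrite /G; case qz: (q m k) => [z|//] /= h; rewrite in_itv/=.
  have /(le_trans (enorm_coord _ _)) := lF w z (f w) (qA _ _ _ qz) (Af w).
  by move=> /(_ j); rewrite !mxE ler_norml => /andP[h1 _]; lra.
apply: bigcupT_measurable => m; apply: bigcupT_measurable => k.
rewrite /G; case qz: (q m k) => [z|//].
have mg : measurable_fun [set: Omega] (fun w => F w z ord0 j + enorm (z - f w)).
  apply: measurable_funD; first exact: mF (qA _ _ _ qz) j.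
  by apply/measurable_enorm/measurable_rVB => //; exact: measurable_rV_cst.
have := mg measurableT _ (measurable_itv `]-oo, a[); rewrite setTI.
by congr measurable; apply/seteqP; split=> w /=; rewrite in_itv.
Qed.

(** For a conformal map the norm of the derivative is the limit of difference quotients along a
    single unit vector; the step [r / n.+2] keeps the points inside [A]. *)
Lemma measurable_dnorm (F : Omega -> 'rV[R]_d -> 'rV[R]_d) A x : (0 < d)%N ->
  (forall y, A y -> measurable_rV (F ^~ y)) -> A° x ->
  (forall w, conf_at (F w) x) ->
  measurable_fun [set: Omega] (fun w => dnorm (F w) x).
Proof.
move=> d0 mF /nbhs_enormP[r r0 rA] cF.
have [e0 ne0] := @exists_unit R d d0.
pose t (n : nat) : R := r / n.+2%:R.
have t0 n : 0 < t n by rewrite /t divr_gt0.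
have tr n : t n < r by rewrite /t ltr_pdivrMr// ltr_pMr// ltr1n.
have nt n : enorm (t n *: e0) = t n by rewrite enormZ ne0 mulr1 gtr0_norm.
have tA n : A (x + t n *: e0) by apply: rA; rewrite addrAC subrr add0r nt.
have Ax : A x by apply: rA; rewrite subrr enorm0.
apply: (@measurable_fun_cvg _ _ _ _ (fun n w => (t n)^-1 * enorm (F w (x + t n *: e0) - F w x))).
  move=> n; apply: measurable_funM; first exact: measurable_cst.
  by apply/measurable_enorm/measurable_rVB; exact: mF.
move=> w _; have [df [p0 fc]] := cF w.
apply/cvgrPdist_le => e e_gt0; have [del del0 H] := differentiable_enorm df e_gt0.
have [N _ HN] := near_infty_natSinv_lt (PosNum (divr_gt0 del0 r0)).
exists N => // n /= Nn.
have td : t n < del.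
  rewrite /t -ltr_pdivlMl// mulrC; apply: le_lt_trans (HN _ Nn).
  by rewrite lef_pV2 ?posrE// ler_nat.
have {H} := H (t n *: e0); rewrite nt => /(_ td) H.
have h3 : enorm ('d (F w) x (t n *: e0)) = dnorm (F w) x * t n by rewrite fc nt.
have := le_trans (enorm_dist _ _) H; rewrite h3 => H2.
rewrite -(ler_pM2r (t0 n)); apply: le_trans H2.
rewrite distrC -[X in _ * X <= _](gtr0_norm (t0 n)) -normrM mulrBl mulrAC.
by rewrite mulVf ?mul1r// gt_eqF.
Qed.

End MeasurableVectors.

Section AlmostEverywhere.
Context {disp : measure_display} {Omega : measurableType disp} {R : realType}.
Variables (P : probability Omega R) (theta : Omega -> Omega).
Hypothesis theta_meas : measurable_fun [set: Omega] theta.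
Hypothesis theta_pres : measure_preserving P theta.

Lemma ae_theta (Q : Omega -> Prop) :
  (\forall w \ae P, Q w) -> \forall w \ae P, Q (theta w).
Proof.
move=> [N [mN N0 QN]]; exists (theta @^-1` N); split.
- by rewrite -[X in measurable X]setTI; exact: theta_meas.
- by rewrite theta_pres.
- by move=> w /= h; exact: QN.
Qed.

Lemma ae_iter (Q : Omega -> Prop) n :
  (\forall w \ae P, Q w) -> \forall w \ae P, Q (iter n theta w).
Proof.
elim: n Q => [//|n IH] Q aQ.
by apply: (IH (fun w => Q (theta w))); exact: ae_theta.
Qed.

Lemma aeI (Q1 Q2 : Omega -> Prop) : (\forall w \ae P, Q1 w) ->
  (\forall w \ae P, Q2 w) -> \forall w \ae P, Q1 w /\ Q2 w.
Proof. exact: filterI. Qed.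

Lemma ae_forall_count (I : countType) (Q : I -> Omega -> Prop) :
  (forall i, \forall w \ae P, Q i w) -> \forall w \ae P, forall i, Q i w.
Proof.
move=> h.
have : \forall w \ae P, forall n, if unpickle n is Some i then Q i w else True.
  apply: ae_foralln => n; case: (unpickle n) => [i|]; [exact: h|exact: aeW].
by apply: filterS => w hw i; have := hw (pickle i); rewrite pickleK.
Qed.

End AlmostEverywhere.

Section SystemMeasurability.
Context {disp : measure_display} {Omega : measurableType disp} {R : realType}
  {d : nat} {V : finType} {E : countType} {ini ter : E -> V}.
Variables (theta : Omega -> Omega) (Phi : rgdms Omega R d ini ter).
Variable W : V -> set 'rV[R]_d.
Hypothesis theta_meas : measurable_fun [set: Omega] theta.
Hypothesis d0 : (0 < d)%N.
Hypothesis HC1 : cond_C1 Phi.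
Hypothesis HC3 : cond_C3 Phi W.

Local Notation X := (vset Phi).
Local Notation wm := (word_map theta Phi).

Let kap01 : 0 < contr Phi < 1. Proof. exact: contr_bounds. Qed.

(** The first letter is evaluated at a point that itself depends on [w], so measurability at fixed
    points is not enough; the Lipschitz bound supplies the joint statement. *)
Lemma wm_measurable a u v x : wt ini ter a u v -> X v x ->
  measurable_rV (fun w => wm a w x).
Proof.
elim: a u => [|e a IH] u /=; first by move=> _ _; exact: measurable_rV_cst.
move=> /andP[_ wa] Xx.
have [cX _ clX] := HC1 (ter e).
have /andP[k0 k1] := kap01.
apply: (@measurable_rV_lipschitz _ _ _ _ (gmap Phi e) (X (ter e))
  (fun w => wm a (theta w) x) cX clX).
- by move=> y Xy; apply/measurable_rV_borel/gmap_measurable.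
- move=> w y z Xy Xz; apply: le_trans (gmap_lipschitz _ Xy Xz) _.
  by rewrite ler_piMl ?enorm_ge0// ltW.
- by move=> j; exact: (measurableT_comp (IH _ wa Xx j) theta_meas).
- by move=> w; have h := wm_X theta (theta w) wa Xx.
Qed.

Lemma gpot_measurable (z : V -> 'rV[R]_d) a u v :
  (forall v, (X v)° (z v)) -> wt ini ter a u v ->
  measurable_fun [set: Omega] (gpot theta Phi z a).
Proof.
move=> zi wa.
have XW : forall v, X v `<=` W v by case: HC3 => h _ _ v'; have [] := h v'.
(* Measurability concerns every [w], not only the good ones, so conformality is drawn from
   [cond_C3], which holds for all of them. *)
have conf w : conf_at (wm a w) (z v).
  elim: a u w wa => [|e a IH] u w /=.
    by move=> _; have [] := conf_at_id (z v) d0.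
  move=> /andP[_ wa].
  have h1 := IH _ (theta w) wa.
  have h2 : conf_at (gmap Phi e w) (wm a (theta w) (z v)).
    have [_ H _] := HC3; have [[[df _] _ _] Hc] := H e w.
    have Wx := XW _ _ (wm_X theta (theta w) wa (interior_subset (zi v))).
    by have [c c0 cP] := Hc _ Wx; have [] := conf_atP d0 c0 (df _ Wx) cP.
  by have [] := conf_at_comp d0 h1 h2.
have -> : gpot theta Phi z a = fun w => ln (dnorm (wm a w) (z v)).
  apply/funext => w; exact: (gpot_wt theta Phi d0 z w wa).
apply: (@measurableT_comp _ _ _ _ _ _ (@ln R)); first exact: measurable_ln.
apply: (@measurable_dnorm _ _ _ _ _ (X v)) => //.
by move=> y Xy; exact: wm_measurable wa Xy.
Qed.

End SystemMeasurability.

(** * Interface between the geometry and the symbolic arguments *)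

Section Estimates.
Context {disp : measure_display} {Omega : measurableType disp} {R : realType}
  {d : nat} {V : finType} {E : countType} {ini ter : E -> V}.
Variables (P : probability Omega R) (theta : Omega -> Omega).
Variable Phi : rgdms Omega R d ini ter.

(* What the symbolic and covering arguments use about a conformal system:
   [g a omega] is the logarithm of the contraction of the word [a]. *)
Record sys_est (good : set Omega) (g : seq E -> Omega -> R) (K kp : R)
    (mm : E -> R) : Prop := {
  est_K : 0 <= K;
  est_kp : 0 < kp;
  est_ae : \forall w \ae P, good w;
  est_theta : forall w, good w -> good (theta w);
  est_meas : forall a u v, wt ini ter a u v -> measurable_fun [set: Omega] (g a);
  est_cat : forall a b u v v' w, good w -> wt ini ter a u v -> wt ini ter b v v' ->
    `|g (a ++ b) w - g a w - g b (iter (size a) theta w)| <= K;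
  est_ub : forall a u v w, good w -> wt ini ter a u v -> g a w <= - kp * (size a)%:R;
  est_letter : forall e w, good w -> - mm e <= g [:: e] w;
  est_birkhoff : forall a u v tau w, good w -> wt ini ter a u v ->
    shift_space ini ter tau -> ini (tau 0%N) = v ->
    `|birkhoff theta Phi (size a) (word_cat a tau) w - g a w| <= K;
  (* Several pieces per word, one for each small ball covering the terminal set, since the
     contraction estimate holds on balls. The diameter bound excludes the empty word, which does not
     determine a terminal vertex. *)
  est_cover : exists (C : R) (N : nat), 0 < C /\ forall w, good w ->
    exists U : seq E -> 'I_N -> set 'rV[R]_d,
      (forall e b i x y, U (e :: b) i x -> U (e :: b) i y ->
         enorm (x - y) <= C * expR (g (e :: b) w)) /\
      (forall n, limit_set theta Phi w `<=`
         \bigcup_(a in words ini ter n.+1) \bigcup_i U a i);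
  est_packing : forall c : R, 0 < c -> exists I : finType, forall w r (T : set (seq E)) p0,
    good w -> 0 < r ->
    (forall t, T t -> c * r <= expR (g t w) <= r) ->
    (forall t t', T t -> T t' -> prefix t t' -> t = t') ->
    (forall t, T t -> exists tau, [/\ shift_space ini ter tau, t = mkseq tau (size t) &
       enorm (coding theta Phi w tau - p0) <= r]) ->
    exists f : seq E -> I, forall t t', T t -> T t' -> f t = f t' -> t = t'
}.

Lemma conformal_estimates : (0 < d)%N -> measurable_fun [set: Omega] theta ->
  measure_preserving P theta -> conformal P Phi -> normal P Phi ->
  exists good g K kp mm, sys_est good g K kp mm.
Proof.
move=> d0 mt pt [HC1 HC2 _ [W [HC3 [L [alpha [L1 a01 HC5]]]]]] Hn.
have /choice[M HM] : forall e, exists M, 0 < M <= contr Phi /\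
    \forall w \ae P, M < inf [set dnorm (gmap Phi e w) x | x in vset Phi (ter e)].
  by move=> e; have [M] := Hn e; exists M.
have M0 e : 0 < M e by have [/andP[]] := HM e.
have /andP[k0 k1] := contr_bounds Phi.
have /andP[al0 al1] := a01.
have cX v : compact (vset Phi v) by exact: vset_compact.
have [e1 e10 e1W] : exists2 e : R, 0 < e & forall v x y,
    vset Phi v x -> enorm (y - x) < e -> W v y.
  have /choice[e He] : forall v, exists e : R, 0 < e /\ forall x y,
      vset Phi v x -> enorm (y - x) < e -> W v y.
    move=> v; have [h _ _] := HC3; have [_ oW _ XW] := h v.
    by have [e e0 He] := compact_thickening (cX v) oW XW; exists e.
  exists (\big[Num.min/1]_v e v).
    by apply/bigmin_gtP; split=> // v _; have [] := He v.
  move=> v x y Xx xy; have [_ h] := He v; apply: (h x y Xx).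
  by apply: lt_le_trans xy _; apply: (bigmin_inf v).
(* The choice 2 e = t ^ (1 / alpha) makes L (2 e) ^ alpha equal to (1 - kap) / 2, where kap is
   [contr Phi]; multiplying this by kap < 1 keeps the total below the midpoint of kap and 1. *)
have [e2 e20 e2L] : exists2 e : R, 0 < e &
    contr Phi * (1 + L * (2 * e) `^ alpha) <= (1 + contr Phi) / 2.
  pose t := (1 - contr Phi) / (2 * L).
  have L0 : 0 < L by apply: lt_le_trans L1.
  have t0 : 0 < t by rewrite divr_gt0 ?subr_gt0// mulr_gt0.
  exists ((t `^ alpha^-1) / 2); first by rewrite divr_gt0// powR_gt0.
  rewrite mulrCA mulfV// mulr1 -powRrM mulVf ?gt_eqF// powRr1 ?ltW//.
  rewrite (_ : L * t = (1 - contr Phi) / 2); last by rewrite /t; field; rewrite gt_eqF.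
  nra.
pose eps := Num.min e1 e2.
have eps0 : 0 < eps by rewrite lt_min e10.
have epsW v x y : vset Phi v x -> enorm (y - x) < eps -> W v y.
  by rewrite lt_min => Xx /andP[h _]; exact: e1W h.
have epsL : contr Phi * (1 + L * (2 * eps) `^ alpha) <= (1 + contr Phi) / 2.
  apply: le_trans e2L; rewrite ler_pM2l// lerD2l ler_pM2l ?(lt_le_trans _ L1)//.
  apply: ge0_ler_powR; rewrite ?nnegrE ?mulr_ge0 ?(ltW al0) ?(ltW eps0) ?(ltW e20)//.
  by rewrite ler_pM2l// ge_min lexx orbT.
have [D D0 DX] : exists2 D : R, 0 <= D & forall v x y,
    vset Phi v x -> vset Phi v y -> enorm (x - y) <= D.
  have /choice[D HD] : forall v, exists D : R, 0 <= D /\ forall x y,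
      vset Phi v x -> vset Phi v y -> enorm (x - y) <= D.
    by move=> v; have [D D0 HD] := compact_enorm_bounded (cX v); exists D.
  exists (\sum_v D v); first by apply: sumr_ge0 => v _; have [] := HD v.
  move=> v x y Xx Xy; have [_ h] := HD v; apply: le_trans (h _ _ Xx Xy) _.
  by rewrite (bigD1 v)//= lerDl; apply: sumr_ge0 => v' _; have [] := HD v'.
have /choice[z z_int] : forall v, exists z, (vset Phi v)° z.
  move=> v; have [_ _ clX] := HC1 v; have [x Xx] := vset_nonempty Phi v.
  have : closure (vset Phi v)° x by rewrite clX.
  by move=> /(_ setT filterT)[z [zi _]]; exists z.
have /choice[Sr HSr] : forall v, exists Sr : seq 'rV[R]_d * R, [/\ 0 < Sr.2,
    forall p, p \in Sr.1 -> forall y, enorm (y - p) < Sr.2 -> vset Phi v y &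
    forall x, vset Phi v x -> exists2 p, p \in Sr.1 & enorm (x - p) < eps].
  move=> v; have [_ _ clX] := HC1 v.
  by have [S [rho h]] := interior_net eps0 (cX v) clX; exists (S, rho).
pose S v := (Sr v).1.
pose rho := Num.min eps (\big[Num.min/1]_v (Sr v).2).
have rho0 : 0 < rho.
  rewrite lt_min eps0; apply/bigmin_gtP; split=> // v _.
  by have [] := HSr v.
have rho_eps : rho <= eps by rewrite ge_min lexx.
have SX v p : p \in S v -> forall y, enorm (y - p) < rho -> vset Phi v y.
  move=> pS y yp; have [_ h _] := HSr v; apply: (h p pS); apply: lt_le_trans yp _.
  by rewrite ge_min; apply/orP; right; apply: (bigmin_inf v).
have Scover v x : vset Phi v x -> exists2 p, p \in S v & enorm (x - p) < eps.
  by have [_ _ h] := HSr v; exact: h.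
pose K := distK Phi L alpha eps D.
exists (good theta Phi W L alpha M), (gpot theta Phi z), K, (- ln (contr Phi)), (fun e => - ln (M e)).
split.
- exact: distK_ge0.
- by rewrite oppr_gt0 ln_lt0// k0.
- have gb : \forall w \ae P, good_base Phi W L alpha M w.
    have HM' : \forall w \ae P, forall e, M e < inf [set dnorm (gmap Phi e w) x | x in vset Phi (ter e)].
      by apply: ae_forall_count => e; have [] := HM e.
    by move: HC2 HC5 HM'; apply: filterS3 => w h1 h2 h3; split.
  by apply: ae_foralln => n; exact: ae_iter.
- exact: good_theta.
- by move=> a u v wa; exact: (gpot_measurable mt d0 HC1 HC3 z_int wa).
- by move=> a b u v v' w gw wa wb; exact: (gpot_cat d0 HC1 HC3 L1 a01 eps0 epsW epsL D0 DX z_int gw wa wb).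
- by move=> a u v w gw wa; rewrite opprK mulrC; exact: (gpot_ub theta d0 HC3 eps0 epsW z_int w wa).
- by move=> e w gw; rewrite opprK; exact: (gpot_letter d0 HC3 M0 eps0 epsW z_int e gw).
- by move=> a u v tau w gw wa st it; exact: (birkhoff_gpot d0 HC1 HC3 L1 a01 eps0 epsW epsL D0 DX z_int gw wa st it).
(* Piece [i] comes from the ball around the [i]-th net point of the terminal set; for indices beyond
   the net [onth] returns [None] and the piece is empty. *)
- exists (expR K * (2 * eps)), (\max_v size (S v))%N.
  split; first by rewrite mulr_gt0 ?expR_gt0// mulr_gt0.
  move=> w gw.
  exists (fun a i => [set x | exists u v y p, [/\ wt ini ter a u v, onth (S v) i = Some p,
    vset Phi v p, enorm (y - p) < eps & x = word_map theta Phi a w y]]).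
  split.
    move=> e b i x y [u [v [x' [p [wa Sp Xp xp ->]]]]] [u' [v' [y' [p' [wa' Sp' _ yp' ->]]]]].
    have vv' : v' = v by rewrite (wt_last wa) (wt_last wa').
    rewrite vv' Sp in Sp'; case: Sp' => pp; rewrite -pp in yp'.
    apply: le_trans (wm_gpot d0 HC1 HC3 L1 a01 eps0 epsW epsL D0 DX z_int gw wa Xp yp' xp) _.
    rewrite expRD (_ : expR K * (2 * eps) * _ = expR (gpot theta Phi z (e :: b) w) * expR K * (2 * eps)); last ring.
    apply: ler_wpM2l; first by rewrite mulr_ge0// expR_ge0.
    rewrite (le_trans (enorm_tri p _ _))// mulr_natl mulr2n lerD// ltW//.
    by rewrite enormC.
  move=> n _ [tau st <-].
  have [y Xy ey] := coding_mem theta d0 HC3 eps0 epsW w n.+1 st.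
  have [p pS yp] := Scover _ _ Xy.
  have wt' := wt_mkseq n.+1 st.
  exists (mkseq tau n.+1); first by split; [rewrite size_mkseq|exact: wt_sorted wt'].
  have /onthP[k kp] := pS.
  have kS : (k < \max_v size (S v))%N.
    apply: leq_trans (leq_bigmax (ini (tau n.+1))).
    by rewrite ltnNge; apply/negP => h; move: kp; rewrite onth_default.
  exists (Ordinal kS) => //; exists (ini (tau 0%N)), (ini (tau n.+1)), y, p; split=> //.
  by apply: (SX _ _ pS); rewrite subrr enorm0.
- by move=> c c0; exact: (packing theta M d0 HC1 HC3 L1 a01 eps0 epsW epsL D0 DX z_int rho0 rho_eps SX Scover c0).
Qed.

End Estimates.

(** * Birkhoff's ergodic theorem *)

Section ErgodicTheorem.
Context {disp : measure_display} {Omega : measurableType disp} {R : realType}.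
Variables (P : probability Omega R) (theta : Omega -> Omega).
Hypothesis theta_meas : measurable_fun [set: Omega] theta.
Hypothesis theta_pres : measure_preserving P theta.
Hypothesis theta_erg : ergodic P theta.

Local Notation intg f := (P.-integrable [set: Omega] (EFin \o f)).

Lemma ge0_integral_theta (f : Omega -> \bar R) :
  measurable_fun [set: Omega] f -> (forall w, 0 <= f w)%E ->
  (\int[P]_w f (theta w) = \int[P]_w f w)%E.
Proof.
move=> mf f0; have := ge0_integral_pushforward theta_meas P measurableT mf (fun y _ => f0 y).
rewrite preimage_setT => <-.
by apply: eq_measure_integral => A mA _; exact: theta_pres.
Qed.

Lemma integrable_theta (f : Omega -> R) : intg f -> intg (f \o theta).
Proof.
move=> /integrableP[mf fi]; apply/integrableP; split.
  exact: (measurableT_comp mf theta_meas).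
have mf' : measurable_fun [set: Omega] (fun w => `|(f w)%:E|%E).
  exact: measurableT_comp mf.
by rewrite [X in (X < _)%E](ge0_integral_theta mf').
Qed.

Lemma integral_theta (f : Omega -> R) : intg f ->
  (\int[P]_w (f (theta w))%:E = \int[P]_w (f w)%:E)%E.
Proof.
move=> fi; have /integrableP[mf _] := fi.
have fi' : P.-integrable (theta @^-1` setT) ((EFin \o f) \o theta).
  by rewrite preimage_setT; exact: integrable_theta.
have := integral_pushforward theta_meas mf fi' measurableT.
rewrite preimage_setT /= => <-.
by apply: eq_measure_integral => A mA _; exact: theta_pres.
Qed.

Definition bsum (f : Omega -> R) n w : R := \sum_(i < n) f (iter i theta w).

Lemma bsumS f n w : bsum f n.+1 w = f w + bsum f n (theta w).
Proof.
by rewrite /bsum big_ord_recl; congr (_ + _); apply: eq_bigr => i _; rewrite -iterSr.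
Qed.

(* The maximum of [bsum f j w] over [j <= n]. *)
Fixpoint bmax (f : Omega -> R) n w : R :=
  if n is m.+1 then Num.max 0 (f w + bmax f m (theta w)) else 0.

Lemma bmax_ge0 f n w : 0 <= bmax f n w.
Proof. by case: n => //= n; rewrite le_max lexx. Qed.

Lemma bmax_le f n w : bmax f n w <= bmax f n.+1 w.
Proof.
elim: n w => [|n IH] w; first exact: bmax_ge0.
by rewrite [leLHS]/= [leRHS]/= ge_max le_max lexx /= le_max lerD2l IH orbT.
Qed.

Lemma bmax_mono f m n w : (m <= n)%N -> bmax f m w <= bmax f n w.
Proof.
elim: n => [|n IH]; first by rewrite leqn0 => /eqP->.
rewrite leq_eqVlt => /orP[/eqP->//|/IH h]; exact: le_trans (bmax_le _ _ _).
Qed.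

Lemma bsum_bmax f n w : bsum f n w <= bmax f n w.
Proof.
elim: n w => [|n IH] w; first by rewrite /bsum big_ord0.
by rewrite bsumS /= le_max lerD2l IH orbT.
Qed.

Lemma integrable_bmax f n : intg f -> intg (bmax f n).
Proof.
move=> fi; elim: n => [|n IH]; first exact: integrable0.
have h := integrableD measurableT fi (integrable_theta IH).
have /integrableP[mh _] := h.
apply: (le_integrable measurableT _ _ h).
  apply/measurable_EFinP/measurable_maxr; first exact: measurable_cst.
  exact/measurable_EFinP.
move=> w _ /=; rewrite lee_fin ger0_norm ?le_max ?lexx//.
by rewrite ge_max normr_ge0 ler_norm.
Qed.

Lemma measurable_of_integrable (f : Omega -> R) : intg f -> measurable_fun [set: Omega] f.
Proof. by move=> /integrableP[mf _]; exact/measurable_EFinP. Qed.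

Lemma measurable_bmax_gt f n (a : R) : intg f -> measurable [set w | a < bmax f n w].
Proof.
move=> fi; have mf := measurable_of_integrable (integrable_bmax n fi).
have := mf measurableT _ (measurable_itv `]a, +oo[); rewrite setTI.
by congr measurable; apply/seteqP; split=> w /=; rewrite in_itv/= andbT.
Qed.

(** Garsia's argument: where the maximum is positive it is at most [f w] plus the maximum at
    [theta w], elsewhere it is 0, and the two maxima have the same integral. *)
Lemma maximal_ergodic f n : intg f ->
  (0 <= \int[P]_w (f w * \1_[set w | 0 < bmax f n w] w)%:E)%E.
Proof.
move=> fi; have hn := integrable_bmax n fi.
have mA := measurable_bmax_gt n 0 fi.
have e : (\int[P]_w ((bmax f n w)%:E - (bmax f n (theta w))%:E) = 0)%E.
  rewrite integralB_EFin//; last exact: (integrable_theta hn).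
  by rewrite (integral_theta hn) subee// integrable_fin_num.
rewrite -e; apply: le_integral => //.
- exact: (integrableB measurableT hn (integrable_theta hn)).
- apply: (le_integrable measurableT _ _ fi).
    apply/measurable_EFinP/measurable_funM; first exact: measurable_of_integrable.
    exact: measurable_indic.
  move=> w _ /=; rewrite lee_fin normrM indicE.
  by case: (_ \in _); rewrite ?normr1 ?normr0 ?mulr1 ?mulr0.
- move=> w _; rewrite -EFinB lee_fin indicE.
  case: (asboolP (0 < bmax f n w)) => h.
    rewrite mem_set// mulr1; case: n {hn mA e} h => [|n] /=; first by rewrite ltxx.
    rewrite lt_max ltxx /= => h; rewrite (max_r (ltW h)).
    have := bmax_le f n (theta w); rewrite /=; lra.
  rewrite memNset// mulr0; have := bmax_ge0 f n (theta w).
  by move/negP: h; rewrite -leNgt; lra.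
Qed.

(** The set where the maxima are unbounded is invariant. If it had full measure, the indicators in
    the maximal inequality would tend to 1 and dominated convergence would make the integral of [f]
    nonnegative. *)
Lemma bsum_bounded f : intg f -> (\int[P]_w (f w)%:E < 0)%E ->
  \forall w \ae P, exists M : R, forall n, bsum f n w <= M.
Proof.
move=> fi fneg.
pose B := \bigcap_(m : nat) \bigcup_n [set w | m%:R < bmax f n w].
have mB : measurable B.
  apply: bigcapT_measurable => m; apply: bigcupT_measurable => n.
  exact: measurable_bmax_gt.
have invB : theta @^-1` B = B.
  apply/seteqP; split=> w Bw m _.
    have [n _ /= h] := Bw (Num.truncn (`|m%:R - f w|)).+1 I.
    exists n.+1 => //=; rewrite lt_max; apply/orP; right.
    have h2 := truncnS_gt `|m%:R - f w|.
    have := ler_norm (m%:R - f w).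
    by move: h2 h; lra.
  have [n _ /= h] := Bw (Num.truncn (`|m%:R + f w|)).+1 I.
  have h2 := truncnS_gt `|m%:R + f w|; have h3 := ler_norm (m%:R + f w).
  have m0 : 0 <= m%:R :> R by [].
  case: n h => [|n] /=; first by have := normr_ge0 (m%:R + f w); lra.
  rewrite lt_max => /orP[h|h].
    by have := normr_ge0 (m%:R + f w); lra.
  by exists n => //=; lra.
have [PB|PB] := theta_erg mB invB.
  exists B; split=> // w /= nb; apply: contrapT => nBw; apply: nb.
  have [m hm] : exists m : nat, forall n, bmax f n w <= m%:R.
    apply: contrapT => h; apply: nBw => m _; apply: contrapT => h'.
    apply: h; exists m => n; rewrite leNgt; apply/negP => h2; apply: h'.
    by exists n.
  by exists m%:R => n; exact: le_trans (bsum_bmax _ _ _) (hm n).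
have mf := measurable_of_integrable fi.
have [] := @dominated_convergence _ _ _ P _ measurableT
   (fun n w => (f w * \1_[set w | 0 < bmax f n w] w)%:E) (EFin \o f) (fun w => `|f w|%:E).
- move=> n; apply/measurable_EFinP/measurable_funM => //.
  exact/measurable_indic/measurable_bmax_gt.
- exact/measurable_EFinP.
- exists (~` B); split.
  + exact: measurableC.
  + by have := probability_setC P mB; rewrite PB subee// => ->.
  + move=> w /= h Bw; apply: h => _.
    have [n _ /= hn] := Bw 0%N I.
    apply: cvg_near_cst; exists n => // k /= nk.
    rewrite indicE mem_set ?mulr1//=.
    exact: lt_le_trans hn (bmax_mono _ _ nk).
- exact: (integrable_norm fi).
- apply: aeW => w n _; rewrite /= lee_fin normrM indicE.
  by case: (_ \in _); rewrite ?normr1 ?normr0 ?mulr1 ?mulr0.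
move=> _ _ h; exfalso; move: fneg; rewrite ltNge => /negP; apply.
have -> : (\int[P]_w (f w)%:E)%E = lim ((\int[P]_w (f w * \1_[set w | 0 < bmax f n w] w)%:E)%E @[n --> \oo]).
  by apply/esym/cvg_lim.
apply: lime_ge; first by apply/cvg_ex; eexists; exact: h.
by apply: nearW => n; exact: maximal_ergodic.
Qed.

Lemma integral_cstP (c : R) : intg (fun=> c) /\ (\int[P]_w c%:E = c%:E)%E.
Proof.
split; first exact: finite_measure_integrable_cst.
have := @integral_cst _ _ _ P _ measurableT c%:E.
by rewrite [X in (_ * X)%E](probability_setT P) mule1.
Qed.

Lemma integralD_cst (f : Omega -> R) (a c : R) : intg f ->
  (\int[P]_w (f w)%:E = a%:E)%E ->
  intg (fun w => f w + c) /\ (\int[P]_w (f w + c)%:E = (a + c)%:E)%E.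
Proof.
move=> fi fa; have [ci ec] := integral_cstP c.
split; first exact: (integrableD measurableT fi ci).
by rewrite EFinD -fa -[in RHS]ec -(integralD_EFin measurableT fi ci).
Qed.

Lemma bsum_lt (f : Omega -> R) (c : R) : intg f -> (\int[P]_w (f w)%:E < c%:E)%E ->
  \forall w \ae P, exists M : R, forall n, bsum f n w <= M + c * n%:R.
Proof.
move=> fi fc.
have [ci ec] := integral_cstP c.
have : \forall w \ae P, exists M : R, forall n, bsum (fun w => f w - c) n w <= M.
  apply: bsum_bounded; first exact: (integrableB measurableT fi ci).
  under eq_integral do rewrite EFinB.
  by rewrite integralB_EFin// [X in (_ - X)%E]ec lteBlDr// add0e.
apply: filterS => w [M hM]; exists M => n; have := hM n.
rewrite /bsum sumrB sumr_const card_ord -mulr_natr; lra.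
Qed.

(** Upper bounds for [f] and for [- f] are enough. Each is taken at the slopes that exceed the mean
    by [k.+1%:R^-1], which leaves countably many null sets. *)
Theorem birkhoff_ergodic (f : Omega -> R) (a : R) : intg f ->
  (\int[P]_w (f w)%:E = a%:E)%E ->
  \forall w \ae P, bsum f n w / n%:R @[n --> \oo] --> a.
Proof.
move=> fi fa.
have up (g : Omega -> R) (b : R) : intg g -> (\int[P]_w (g w)%:E = b%:E)%E ->
    \forall w \ae P, forall k : nat, exists M : R, forall n, bsum g n w <= M + (b + k.+1%:R^-1) * n%:R.
  move=> gi gb; apply: ae_foralln => k; apply: bsum_lt => //.
  by rewrite gb lte_fin ltrDl invr_gt0.
have fNi : intg (fun w => - f w) by exact: (integrableN fi).
have fNa : (\int[P]_w (- f w)%:E = (- a)%:E)%E.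
  under eq_integral do rewrite EFinN.
  by rewrite integralN ?fa// integrable_add_def.
move: (up _ _ fi fa) (up _ _ fNi fNa); apply: filterS2 => w h1 h2.
apply/cvgrPdist_le => e e0.
have e20 : 0 < e / 2 by rewrite divr_gt0.
have [k _ Hk] := near_infty_natSinv_lt (PosNum e20).
have {}Hk := Hk k (leqnn k).
have [M1 H1] := h1 k; have [M2 H2] := h2 k.
pose M := `|M1| + `|M2|.
exists (Num.truncn (M / (e / 2))).+1 => // n /= Nn.
have n0 : 0 < n%:R :> R by rewrite ltr0n (leq_trans _ Nn).
have Mn : M <= e / 2 * n%:R.
  rewrite mulrC -ler_pdivrMr//; apply: (le_trans (ltW (truncnS_gt _))).
  by rewrite ler_nat.
rewrite ler_distlC -(ler_pM2r n0) -[X in _ && X](ler_pM2r n0) divfK ?gt_eqF//.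
have := H1 n; have := H2 n.
have -> : bsum (fun w => - f w) n w = - bsum f n w by rewrite /bsum sumrN.
have kn : k.+1%:R^-1 * n%:R <= e / 2 * n%:R by rewrite ler_pM2r// ltW.
have := ler_norm M1; have := ler_norm M2; have := normr_ge0 M1; have := normr_ge0 M2.
move: Mn; rewrite /M; move: (bsum f n w) => S.
move: kn; move: (k.+1%:R^-1) (n%:R) => i N *; apply/andP; split; nra.
Qed.

End ErgodicTheorem.

Lemma sum_cst (R : realType) (x : R) k : \sum_(r < k) x = k%:R * x.
Proof. by rewrite sumr_const card_ord mulr_natl. Qed.

Lemma eventually_le_mul (R : realType) (C e : R) : 0 < e ->
  exists n0, forall n, (n0 <= n)%N -> C <= e * n%:R.
Proof.
move=> e0; exists (Num.truncn (C / e)).+1 => n nn.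
have h := ltW (truncnS_gt (C / e)); rewrite ler_pdivrMr// in h.
by rewrite mulrC; apply: (le_trans h); rewrite ler_pM2r// ler_nat.
Qed.

(** * Growth of almost additive sequences over an ergodic base *)

Section AlmostAdditive.
Context {disp : measure_display} {Omega : measurableType disp} {R : realType}.
Variables (P : probability Omega R) (theta : Omega -> Omega).
Hypothesis theta_meas : measurable_fun [set: Omega] theta.
Hypothesis theta_pres : measure_preserving P theta.
Hypothesis theta_erg : ergodic P theta.

Local Notation intg f := (P.-integrable [set: Omega] (EFin \o f)).
Local Notation bs := (bsum theta).
Implicit Types f : Omega -> R.

Lemma bsumD f m n w : bs f (m + n) w = bs f m w + bs f n (iter m theta w).
Proof.
elim: m w => [|m IH] w; first by rewrite /bsum big_ord0 add0r.
by rewrite addSn !bsumS IH addrA -iterSr.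
Qed.

Lemma bsum_ge0 f n w : (forall w, 0 <= f w) -> 0 <= bs f n w.
Proof. by move=> f0; apply: sumr_ge0 => i _. Qed.

Lemma bsum1 f w : bs f 1 w = f w.
Proof. by rewrite /bsum big_ord1. Qed.

Lemma bsum_norm f n w : `|bs f n w| <= bs (fun w => `|f w|) n w.
Proof. exact: ler_norm_sum. Qed.

Lemma bsum_phases f m q w :
  \sum_(r < m) \sum_(j < q) f (iter (r + j * m) theta w) = bs f (q * m) w.
Proof.
rewrite exchange_big /=; elim: q => [|q IH]; first by rewrite big_ord0 /bsum big_ord0.
rewrite big_ord_recr /= IH mulSn addnC bsumD; congr (_ + _).
by apply: eq_bigr => r _; rewrite -iterD addnC.
Qed.

(** The part missing at the right end has at most [u] terms, so it is dominated by the last [u]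
    absolute values, a bound that does not depend on where the window stops. *)
Lemma bsum_window f (o l u n : nat) w : (o + l <= n)%N -> (n <= o + l + u)%N -> (u <= n)%N ->
  `|bs f l (iter o theta w) - bs f n w| <=
    bs (fun w => `|f w|) o w + bs (fun w => `|f w|) u (iter (n - u) theta w).
Proof.
move=> h1 h2 h3.
have -> : bs f n w = bs f o w + bs f l (iter o theta w) +
    bs f (n - (o + l)) (iter (o + l) theta w).
  by rewrite -bsumD -{1}(subnKC h1) bsumD.
have -> : bs f l (iter o theta w) - (bs f o w + bs f l (iter o theta w) +
   bs f (n - (o + l)) (iter (o + l) theta w)) =
   - (bs f o w + bs f (n - (o + l)) (iter (o + l) theta w)) by ring.
rewrite normrN (le_trans (ler_normD _ _))// lerD ?bsum_norm//.
apply: le_trans (bsum_norm _ _ _) _.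
have -> : bs (fun w => `|f w|) u (iter (n - u) theta w) =
    bs (fun w => `|f w|) (o + l + u - n) (iter (n - u) theta w) +
    bs (fun w => `|f w|) (n - (o + l)) (iter (o + l) theta w).
  have e1 : (o + l = (o + l + u - n) + (n - u))%N by lia.
  have -> : iter (o + l) theta w = iter (o + l + u - n) theta (iter (n - u) theta w).
    by rewrite -iterD -e1.
  by rewrite -bsumD; congr (bs _ _ _); lia.
by rewrite lerDr; apply: bsum_ge0.
Qed.

Lemma bsum_asymp f a : intg f -> (\int[P]_w (f w)%:E = a%:E)%E ->
  \forall w \ae P, forall e : R, 0 < e -> exists n0, forall n, (n0 <= n)%N ->
    `|bs f n w - a * n%:R| <= e * n%:R.
Proof.
move=> fi fa; have := birkhoff_ergodic theta_meas theta_pres theta_erg fi fa.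
apply: filterS => w /cvgrPdist_le h e e0.
have [n0 _ H] := h e e0; exists n0.+1 => n n0n.
have nn : 0 < n%:R :> R by rewrite ltr0n (leq_trans _ n0n).
have := H n (ltnW n0n); rewrite /= -(ler_pM2r nn) -[X in _ * X <= _](gtr0_norm nn) -normrM distrC.
by rewrite mulrBl divfK ?gt_eqF.
Qed.

(** The last [u] terms are a difference of two Birkhoff sums with the same rate, hence negligible
    against [n]. *)
Lemma bsum_tail f (u : nat) : intg f ->
  \forall w \ae P, forall e : R, 0 < e -> exists n0, forall n, (n0 <= n)%N ->
    bs (fun w => `|f w|) u (iter (n - u) theta w) <= e * n%:R.
Proof.
move=> fi; have ni : intg (fun w => `|f w|) by exact: integrable_norm fi.
pose a := fine (\int[P]_w (`|f w|)%:E)%E.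
have na : (\int[P]_w (`|f w|)%:E = a%:E)%E by rewrite fineK// integrable_fin_num.
have a0 : 0 <= a by rewrite fine_ge0// integral_ge0// => w _; rewrite lee_fin.
move: (bsum_asymp ni na); apply: filterS => w h e e0.
have e3 : 0 < e / 3 by rewrite divr_gt0.
have [n0 H] := h _ e3.
exists (n0 + u + (Num.truncn (a * u%:R / (e / 3))).+1)%N => n nn.
have un : (u <= n)%N by lia.
have H1 := H n ltac:(lia); have H2 := H (n - u)%N ltac:(lia).
have h3 : a * u%:R <= e / 3 * n%:R.
  have := ltW (truncnS_gt (a * u%:R / (e / 3))).
  rewrite ler_pdivrMr// => h3; apply: (le_trans h3).
  rewrite mulrC; apply: ler_wpM2l; first exact: ltW.
  rewrite ler_nat; move: nn; move: (Num.truncn _) => T; lia.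
have e1 : bs (fun w => `|f w|) n w =
   bs (fun w => `|f w|) (n - u) w + bs (fun w => `|f w|) u (iter (n - u) theta w).
  by rewrite -bsumD subnK.
move: H1 H2 h3; rewrite e1 natrB//.
move: (bs _ (n - u)%N w) (bs _ u _) => S1 S2.
have n_ge : 0 <= n%:R - u%:R :> R by rewrite subr_ge0 ler_nat.
have u_ge : 0 <= u%:R :> R by [].
move: (n%:R) (u%:R) n_ge u_ge => X Y n_ge u_ge.
by rewrite !ler_norml => /andP[_ k1] /andP[k2 _] k3; nra.
Qed.

(** [L n] stands for the logarithm of Z_n: cutting a word costs [A], whereas gluing inserts a
    connecting word of length [N] and costs [B]. *)
Variables (G : set Omega) (L : nat -> Omega -> R) (A B c : R) (N : nat).
Hypothesis G_theta : forall w, G w -> G (theta w).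
Hypothesis A0 : 0 <= A.
Hypothesis L_upper : forall n m w, G w -> (0 < n)%N -> (0 < m)%N ->
  L (n + m)%N w <= L n w + L m (iter n theta w) + A.
Hypothesis L_lower : forall n m w, G w -> (0 < n)%N -> (0 < m)%N ->
  L n w + L m (iter (n + N) theta w) - B <= L (n + N + m)%N w.
Hypothesis L_bound : forall n w, G w -> (0 < n)%N -> - c * n%:R <= L n w.
Hypothesis c0 : 0 <= c.
Hypothesis G_ae : \forall w \ae P, G w.

Let G_iter n w : G w -> G (iter n theta w).
Proof. by elim: n => //= n IH /IH; exact: G_theta. Qed.

Lemma L_upper_blocks k q n m w : G w -> (0 < k)%N -> (0 < n)%N -> (0 < m)%N ->
  L (n + q * k + m)%N w <=
    L n w + \sum_(j < q) (L k (iter (n + j * k) theta w) + A) +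
    L m (iter (n + q * k) theta w) + A.
Proof.
move=> Gw k0; elim: q n w Gw m => [|q IH] n w Gw m n0 m0.
  by rewrite big_ord0 mul0n addn0 addr0; exact: L_upper.
rewrite big_ord_recr /= (_ : n + q.+1 * k = n + q * k + k)%N; last lia.
rewrite -[(n + q * k + k + m)%N]addnA.
have km0 : (0 < k + m)%N by lia.
apply: (le_trans (IH n w Gw (k + m)%N n0 km0)).
have := L_upper (G_iter (n + q * k) Gw) k0 m0; rewrite -iterD [(k + (_ + _))%N]addnC.
lra.
Qed.

Lemma L_lower_blocks k q n m w : G w -> (0 < k)%N -> (0 < n)%N -> (0 < m)%N ->
    L n w + \sum_(j < q) (L k (iter (n + N + j * (k + N)) theta w) - B) +
    L m (iter (n + N + q * (k + N)) theta w) - B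
  <= L (n + N + q * (k + N) + m)%N w.
Proof.
move=> Gw k0; elim: q n w Gw m => [|q IH] n w Gw m n0 m0.
  by rewrite big_ord0 mul0n addn0 addr0; exact: L_lower.
rewrite big_ord_recr /= (_ : n + N + q.+1 * (k + N) = n + N + q * (k + N) + (k + N))%N; last lia.
rewrite -[(n + N + q * (k + N) + (k + N) + m)%N]addnA.
have km0 : (0 < k + N + m)%N by lia.
apply: le_trans (IH n w Gw (k + N + m)%N n0 km0).
have := L_lower (G_iter (n + N + q * (k + N)) Gw) k0 m0.
rewrite -iterD [(k + N + (_ + _))%N]addnC; lra.
Qed.

(** Nonnegative, so that its sum over the longest possible end block bounds every shorter one. *)
Let L1pos w := `|L 1%N w| + A.

Lemma L_le_bsum n w : G w -> (0 < n)%N -> L n w <= bs L1pos n w.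
Proof.
elim: n w => [//|[|n] IH] w Gw _.
  rewrite bsumS /bsum big_ord0 addr0 /L1pos.
  by have := ler_norm (L 1%N w); have := A0; lra.
rewrite bsumS; apply: le_trans (L_upper Gw (ltn0Sn 0) (ltn0Sn n)) _.
have := IH _ (G_theta Gw) (ltn0Sn n); rewrite /= /L1pos.
by have := ler_norm (L 1%N w); lra.
Qed.

(* Since [theta ^ k] need not be ergodic, [n] is cut into blocks of length [k] at
   each of the [k] phases and the [k] resulting bounds are averaged. *)
Lemma growth_le k a : (0 < k)%N -> intg (L 1%N) -> intg (L k) ->
  (\int[P]_w (L k w)%:E = a%:E)%E ->
  \forall w \ae P, forall e : R, 0 < e -> exists n0, forall n, (n0 <= n)%N ->
    L n w <= ((a + A) / k%:R + e) * n%:R.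
Proof.
move=> k0 L1i Lki Lka.
have kR1 : 1 <= k%:R :> R by rewrite ler1n.
have kR0 : 0 < k%:R :> R by rewrite ltr0n.
pose f w := L k w + A.
have [fi fa] := integralD_cst A Lki Lka.
have bi : intg L1pos.
  by have [] := integralD_cst A (integrable_norm L1i) (esym (fineK (integrable_fin_num measurableT (integrable_norm L1i)))).
have b0 w : 0 <= L1pos w by rewrite addr_ge0.
move: (aeI (aeI (bsum_asymp fi fa) (bsum_tail (2 * k) fi))
  (aeI (bsum_tail (2 * k) bi) G_ae)).
apply: filterS => w [[h1 h2] [h3 Gw]] e e0.
have e4 : 0 < e / 4 by rewrite divr_gt0.
have [n1 H1] := h1 _ e4; have [n2 H2] := h2 _ e4; have [n3 H3] := h3 _ e4.
pose C := `|f w| + bs L1pos k w + A.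
have [n4 H4] := eventually_le_mul C e4.
exists (n1 + n2 + n3 + n4 + 3 * k + 3)%N => n nn.
have {}H1 := H1 n ltac:(clear -nn; lia); have {}H2 := H2 n ltac:(clear -nn; lia).
have {}H3 := H3 n ltac:(clear -nn; lia); have {}H4 := H4 n ltac:(clear -nn; lia).
(* Reserving [k + 1] indices makes the number [q] of full blocks the same for all phases and leaves
   the last block nonempty. *)
pose q := ((n - k - 1) %/ k)%N.
have q1 : (q * k <= n - k - 1)%N by exact: leq_divM.
have q2 : (n - k - 1 < q * k + k)%N by rewrite /q {1}(divn_eq (n - k - 1) k) ltn_add2l ltn_mod.
clearbody q; set T1 := bs _ _ _ in H3.
have Lr (r : 'I_k) : L n w <=
    bs L1pos k w + \sum_(j < q) f (iter (r + j * k) theta (theta w)) + T1 + A.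
  have rk := ltn_ord r.
  have t0 : (0 < n - r.+1 - q * k)%N by clear -nn q1 q2 rk; lia.
  have := L_upper_blocks q Gw k0 (ltn0Sn r) t0.
  rewrite (_ : r.+1 + q * k + _ = n)%N; last by clear -nn q1 q2 rk; lia.
  have l1 : L r.+1 w <= bs L1pos k w.
    apply: le_trans (L_le_bsum Gw (ltn0Sn r)) _.
    have -> : bs L1pos k w = bs L1pos (r.+1 + (k - r.+1)) w by rewrite subnKC.
    by rewrite bsumD lerDl bsum_ge0.
  have l2 : L (n - r.+1 - q * k) (iter (r.+1 + q * k) theta w) <= T1.
    apply: le_trans (L_le_bsum (G_iter _ Gw) t0) _.
    apply: le_trans (ler_norm _) _; apply: le_trans (bsum_norm _ _ _) _.
    rewrite /T1 (_ : 2 * k = (2 * k - (n - r.+1 - q * k)) + (n - r.+1 - q * k))%N; last by clear -nn q1 q2 rk; lia.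
    rewrite bsumD -iterD (_ : _ + (n - _) = r.+1 + q * k)%N; last by clear -nn q1 q2 rk; lia.
    by rewrite lerDr bsum_ge0.
  have -> : \sum_(j < q) (L k (iter (r.+1 + j * k) theta w) + A) =
      \sum_(j < q) f (iter (r + j * k) theta (theta w)).
    by apply: eq_bigr => j _; rewrite -iterSr addSn.
  lra.
have : \sum_(r < k) L n w <= \sum_(r < k) (bs L1pos k w +
   \sum_(j < q) f (iter (r + j * k) theta (theta w)) + T1 + A).
  by apply: ler_sum => r _; exact: Lr.
rewrite !big_split /= bsum_phases !sum_cst => Hs.
have := @bsum_window f 1 (q * k) (2 * k) n w ltac:(clear -nn q1 q2; lia) ltac:(clear -nn q1 q2; lia) ltac:(clear -nn q1 q2; lia).
rewrite ler_distl => /andP[_]; rewrite bsum1 => W.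
move: H1; rewrite ler_distl => /andP[_ H1].
rewrite -(ler_pM2l kR0) (_ : k%:R * (((a + A) / k%:R + e) * n%:R) =
  (a + A) * n%:R + k%:R * (e * n%:R)); last by field; rewrite gt_eqF.
have eX : 0 <= e / 4 * n%:R by rewrite mulr_ge0// ltW.
have p1 := ler_wpM2l (ltW kR0) H4; have p2 := ler_wpM2l (ltW kR0) H3.
have p3 := ler_wpM2r eX kR1.
have p4 := ler_wpM2r (normr_ge0 (f w)) kR1.
by move: p1 p2 p3 p4; rewrite /C; lra.
Qed.

(** The same averaging with period [m = k + N], a block followed by a gap. The end blocks, of at
    most [m] and [2 * m] letters, are bounded below by [L_bound], whence the term [3 * c * m%:R]. *)
Lemma growth_ge k a : (0 < k)%N -> intg (L k) ->
  (\int[P]_w (L k w)%:E = a%:E)%E ->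
  \forall w \ae P, forall e : R, 0 < e -> exists n0, forall n, (n0 <= n)%N ->
    ((a - B) / (k + N)%:R - e) * n%:R <= L n w.
Proof.
move=> k0 Lki Lka; pose m := (k + N)%N.
have m0 : (0 < m)%N by rewrite addn_gt0 k0.
have mR1 : 1 <= m%:R :> R by rewrite ler1n.
have mR0 : 0 < m%:R :> R by rewrite ltr0n.
pose f w := L k w - B.
have [fi fa] := integralD_cst (- B) Lki Lka.
move: (aeI (aeI (bsum_asymp fi fa) (bsum_tail (2 * m) fi)) G_ae).
apply: filterS => w [[h1 h2] Gw] e e0.
have e4 : 0 < e / 4 by rewrite divr_gt0.
have [n1 H1] := h1 _ e4; have [n2 H2] := h2 _ e4.
pose C := bs (fun w => `|f w|) N.+1 w + 3 * c * m%:R + `|B|.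
have [n4 H4] := eventually_le_mul C e4.
exists (n1 + n2 + n4 + 3 * m + N + 3)%N => n nn.
have {}H1 := H1 n ltac:(clear -nn; lia); have {}H2 := H2 n ltac:(clear -nn; lia).
have {}H4 := H4 n ltac:(clear -nn; lia).
pose q := ((n - m - N - 1) %/ m)%N.
have q1 : (q * m <= n - m - N - 1)%N by exact: leq_divM.
have q2 : (n - m - N - 1 < q * m + m)%N.
  by rewrite /q {1}(divn_eq (n - m - N - 1) m) ltn_add2l ltn_mod.
clearbody q.
have Lr (r : 'I_m) : \sum_(j < q) f (iter (r + j * m) theta (iter N.+1 theta w))
    - 3 * c * m%:R - `|B| <= L n w.
  have rm := ltn_ord r.
  have t0 : (0 < n - r.+1 - N - q * m)%N by clear -nn q1 q2 rm; lia.
  have := L_lower_blocks q Gw k0 (ltn0Sn r) t0; rewrite -/m.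
  rewrite (_ : r.+1 + N + q * m + _ = n)%N; last by clear -nn q1 q2 rm; lia.
  have l1 : - c * m%:R <= L r.+1 w.
    apply: le_trans (L_bound Gw (ltn0Sn r)).
    by rewrite !mulNr lerN2 ler_wpM2l// ler_nat.
  have l2 : - c * (2 * m%:R) <= L (n - r.+1 - N - q * m) (iter (r.+1 + N + q * m) theta w).
    apply: le_trans (L_bound (G_iter _ Gw) t0).
    rewrite !mulNr lerN2 ler_wpM2l// -natrM ler_nat; clear -nn q1 q2 rm; lia.
  have -> : \sum_(j < q) (L k (iter (r.+1 + N + j * m) theta w) - B) =
      \sum_(j < q) f (iter (r + j * m) theta (iter N.+1 theta w)).
    apply: eq_bigr => j _; rewrite -iterD /f.
    by rewrite (_ : r + j * m + N.+1 = r.+1 + N + j * m)%N//; clear; lia.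
  by have := ler_norm B; lra.
have : \sum_(r < m) (\sum_(j < q) f (iter (r + j * m) theta (iter N.+1 theta w))
   + (- 3 * c * m%:R - `|B|)) <= \sum_(r < m) L n w.
  by apply: ler_sum => r _; have := Lr r; lra.
rewrite big_split /= bsum_phases !sum_cst => Hs.
have := @bsum_window f N.+1 (q * m) (2 * m) n w ltac:(clear -nn q1 q2; lia) ltac:(clear -nn q1 q2; lia) ltac:(clear -nn q1 q2; lia).
rewrite ler_distl => /andP[W _].
move: H1; rewrite ler_distl => /andP[H1 _].
rewrite -(ler_pM2l mR0) (_ : m%:R * (((a - B) / m%:R - e) * n%:R) =
  (a - B) * n%:R - m%:R * (e * n%:R)); last by field; rewrite gt_eqF.
have eX : 0 <= e / 4 * n%:R by rewrite mulr_ge0// ltW.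
have p1 := ler_wpM2l (ltW mR0) H4.
have p3 := ler_wpM2r eX mR1.
have p4 : bs (fun w => `|f w|) N.+1 w <= m%:R * bs (fun w => `|f w|) N.+1 w.
  by rewrite ler_peMl// bsum_ge0.
by move: p1 p3 p4; rewrite /C; lra.
Qed.

End AlmostAdditive.

(** * Sums over countable sets of words *)

Section Esum.
Context {R : realType}.
Local Open Scope ereal_scope.

Lemma esum_subset (I : choiceType) (A B : set I) (a : I -> \bar R) :
  A `<=` B -> (forall i, 0 <= a i) -> \esum_(i in A) a i <= \esum_(i in B) a i.
Proof.
move=> AB a0; rewrite (esum_mkcond A) (esum_mkcond B); apply: le_esum => i _.
case: ifPn => [/set_mem Ai|_]; first by rewrite mem_set//; exact: AB.
by case: ifPn.
Qed.

(** The tool for comparing partition functions: an injective surgery on words that controls each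
    weight. *)
Lemma esum_le_inj (I J : choiceType) (A : set I) (B : set J) (f : I -> J)
    (a : I -> \bar R) (b : J -> \bar R) :
  (forall i, A i -> B (f i)) -> (forall i i', A i -> A i' -> f i = f i' -> i = i') ->
  (forall i, A i -> a i <= b (f i)) -> (forall j, 0 <= b j) ->
  \esum_(i in A) a i <= \esum_(j in B) b j.
Proof.
move=> AB finj ab b0.
apply: (@le_trans _ _ (\esum_(i in A) b (f i))); first exact: le_esum.
rewrite -esum_image; last by move=> i i' /set_mem Ai /set_mem Ai'; exact: finj.
by apply: esum_subset => // _ [i Ai <-]; exact: AB.
Qed.

Lemma esumZ_le (I : choiceType) (A : set I) (a : I -> \bar R) (c : R) :
  (0 <= c)%R -> (forall i, 0 <= a i) ->
  \esum_(i in A) (c%:E * a i) <= c%:E * \esum_(i in A) a i.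
Proof.
move=> c0 a0; rewrite ge_ereal_sup//= => _ [X [finX XA]] <-.
have -> : \sum_(i \in X) (c%:E * a i) = c%:E * \sum_(i \in X) a i.
  by rewrite ge0_mule_fsumr.
by apply: lee_wpmul2l; [rewrite lee_fin|rewrite esum_ge//; exists X].
Qed.

Lemma esumZ (I : choiceType) (A : set I) (a : I -> \bar R) (c : R) :
  (0 < c)%R -> (forall i, 0 <= a i) ->
  \esum_(i in A) (c%:E * a i) = c%:E * \esum_(i in A) a i.
Proof.
move=> c0 a0; apply/eqP; rewrite eq_le esumZ_le ?(ltW c0)//=.
have := @esumZ_le _ A (fun i => c%:E * a i) c^-1.
rewrite invr_ge0 (ltW c0) => /(_ isT); have h i : 0 <= c%:E * a i by rewrite mule_ge0// lee_fin ltW.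
move=> /(_ h); rewrite (eq_esum (b := a)); last first.
  by move=> i _; rewrite muleA -EFinM mulVf ?gt_eqF// mul1e.
by rewrite lee_pdivlMl.
Qed.

Lemma esum_gt0_ge (I : choiceType) (A : set I) (a : I -> \bar R) i :
  A i -> (forall i, 0 <= a i) -> a i <= \esum_(i in A) a i.
Proof.
move=> Ai a0; rewrite -[leLHS](@esum_set1 _ _ i a)//.
by apply: esum_subset => // _ ->.
Qed.

(** Reindexing by codes turns the sum into a series of measurable functions; codes without an
    element of [A] contribute 0. *)
Lemma emeasurable_esum disp (T : measurableType disp) (I : countType) (A : set I)
    (f : I -> T -> \bar R) :
  (forall i, A i -> measurable_fun setT (f i)) -> (forall i w, 0 <= f i w) ->
  measurable_fun [set: T] (fun w => \esum_(i in A) f i w).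
Proof.
move=> mf f0.
pose h n w := if @pickle_inv I n is Some i then
   if i \in A then f i w else 0 else 0.
have h0 n w : 0 <= h n w by rewrite /h; case: pickle_inv => // i; case: ifPn.
have -> : (fun w => \esum_(i in A) f i w) = (fun w => \sum_(n <oo) h n w).
  apply/funext => w; rewrite nneseries_esumT//.
  apply/eqP; rewrite eq_le; apply/andP; split.
    apply: (@esum_le_inj _ _ _ _ (@pickle I)) => //.
      by move=> i i' _ _; exact: (pcan_inj pickleK).
    by move=> i Ai; rewrite /h pickleK_inv mem_set.
  pose B := [set n | exists2 i, @pickle_inv I n = Some i & A i].
  rewrite (esumID B)//.
  rewrite [X in _ + X]esum1 ?adde0; last first.
    move=> n [_ /= nn]; rewrite /h; case e: (@pickle_inv I n) => [i|//].
    case: ifPn => // /set_mem Ai; exfalso; apply: nn; by exists i.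
  have [[i0 Ai0]|A0] := pselect (exists i, A i); last first.
    rewrite esum1 ?esum_ge0// => n [_ [i _ Ai]]; exfalso; apply: A0; by exists i.
  have pK n i : @pickle_inv I n = Some i -> pickle i = n.
    by move=> e; have := @pickle_invK I n; rewrite e.
  apply: (@esum_le_inj _ _ _ _ (fun n => odflt i0 (@pickle_inv I n))) => //.
  - by move=> n [_ [i e Ai]]; rewrite e.
  - by move=> n n' [_ [i e _]] [_ [i' e' _]]; rewrite e e' /= -(pK _ _ e) -(pK _ _ e') => ->.
  - by move=> n [_ [i e Ai]]; rewrite /h e /= mem_set.
apply: ge0_emeasurable_sum => // n _.
rewrite /h; case: (@pickle_inv I n) => [i|]; last exact: measurable_cst.
by case: (boolP (i \in A)) => [/set_mem Ai|_]; [exact: mf|exact: measurable_cst].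
Qed.

Lemma esum_const (I : finType) (c : \bar R) : 0 <= c ->
  \esum_(i in [set: I]) c = (#|I|%:R)%:E * c.
Proof.
move=> c0; rewrite esum_fset//; last exact: finite_finset.
have -> : [set: I] = [set` index_enum I].
  by apply/seteqP; split=> // v _ /=; exact: mem_index_enum.
rewrite -fsbig_seq ?index_enum_uniq//.
have -> : \sum_(i : I) c = (\sum_(i : I) 1%:E) * c.
  by rewrite ge0_sume_distrl//; apply: eq_bigr => v _; rewrite mul1e.
by rewrite sumEFin sumr_const.
Qed.

End Esum.

Section PrimitiveWords.
Context {V : finType} {E : countType} (ini ter : E -> V).
Local Notation wt := (wt ini ter).

Lemma words_wt n a (e0 : E) : words ini ter n a -> exists u v, wt a u v.
Proof.
case: a => [_|e b [_ sb]]; first by exists (ini e0), (ini e0); rewrite /= eqxx.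
by exists (ini e), (ter (last e b)); rewrite -sorted_wt.
Qed.

Lemma wt_take n a u v : wt a u v -> exists w, wt (take n a) u w.
Proof. by rewrite -{1}(cat_take_drop n a) => /wt_cat[w h _]; exists w. Qed.

(** One connecting word is fixed for each pair of letters. Since [Lambda] is finite, all their
    letters lie in one finite list, on which letterwise lower bounds become uniform. *)
Lemma primitive_data (e0 : E) : finitely_primitive ini ter ->
  exists (N : nat) (conn : E -> E -> seq E) (F0 : seq E), [/\ (0 < N)%N, e0 \in F0,
    forall e e', size (conn e e') = N,
    forall e e', wt (conn e e') (ter e) (ini e') &
    forall e e' x, x \in conn e e' -> x \in F0].
Proof.
move=> [N [Lam [N0 finL LamN conn]]].
have /choice[cn Hcn] : forall p : E * E, exists w, Lam w /\ sorted (adm ini ter) (p.1 :: rcons w p.2).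
  by move=> [e e']; have [w] := conn e e'; exists w.
have [X LX] := finite_fsetP.1 finL.
exists N, (fun e e' => cn (e, e')), (e0 :: flatten (finmap.enum_fset X)); split=> //.
- by rewrite inE eqxx.
- by move=> e e'; have [/LamN[]] := Hcn (e, e').
- move=> e e'; have [_ /=] := Hcn (e, e').
  have := sorted_wt ini ter e (rcons (cn (e, e')) e'); rewrite /= eqxx /= => ->.
  rewrite -cats1 => /wt_cat[w h /=] /andP[/eqP -> _]; exact: h.
- move=> e e' x xc; rewrite inE; apply/orP; right; apply/flattenP.
  exists (cn (e, e')) => //; have [h _] := Hcn (e, e').
  by move: h; rewrite LX.
Qed.

End PrimitiveWords.

(** * Partition functions over an alphabet *)

Section Symbolic.
Context {disp : measure_display} {Omega : measurableType disp} {R : realType}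
  {d : nat} {V : finType} {E : countType} {ini ter : E -> V}.
Variables (P : probability Omega R) (theta : Omega -> Omega).
Variable Phi : rgdms Omega R d ini ter.
Variables (good : set Omega) (g : seq E -> Omega -> R) (K kp : R) (mm : E -> R).
Hypothesis est : sys_est P theta Phi good g K kp mm.
Variables (e0 : E) (N : nat) (conn : E -> E -> seq E) (F0 : seq E).
Hypothesis N0 : (0 < N)%N.
Hypothesis e0F0 : e0 \in F0.
Hypothesis conn_size : forall e e', size (conn e e') = N.
Hypothesis conn_wt : forall e e', wt ini ter (conn e e') (ter e) (ini e').
Hypothesis conn_F0 : forall e e' x, x \in conn e e' -> x \in F0.

Local Notation wt := (wt ini ter).

(** A uniform cost per letter of [F0]: the sum of absolute values stands in for a maximum, and [K]
    pays for one concatenation. *)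
Definition cF : R := \sum_(e <- F0) `|mm e| + K.

Let K0 : 0 <= K. Proof. exact: est_K est. Qed.

Lemma cF_ge0 : 0 <= cF.
Proof. by rewrite addr_ge0// sumr_ge0. Qed.

Lemma mm_cF e : e \in F0 -> mm e + K <= cF.
Proof.
move=> eF; rewrite /cF lerD2r (le_trans (ler_norm _))//.
by rewrite (big_rem e)//= lerDl sumr_ge0.
Qed.

Let good_iter n w : good w -> good (iter n theta w).
Proof. by elim: n => //= n IH /IH h; exact: (est_theta est h). Qed.

Lemma g_catl a b u v v' w : good w -> wt a u v -> wt b v v' ->
  g a w + g b (iter (size a) theta w) - K <= g (a ++ b) w.
Proof.
move=> gw wa wb; have := est_cat est gw wa wb.
by rewrite -addrA -opprD ler_distl => /andP[].
Qed.

Lemma g_catr a b u v v' w : good w -> wt a u v -> wt b v v' ->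
  g (a ++ b) w <= g a w + g b (iter (size a) theta w) + K.
Proof.
move=> gw wa wb; have := est_cat est gw wa wb.
by rewrite -addrA -opprD ler_distl => /andP[].
Qed.

Lemma g_lower_gen (c : R) a u v w : good w -> wt a u v -> (0 < size a)%N ->
  (forall e, e \in a -> mm e + K <= c) -> - c * (size a)%:R <= g a w.
Proof.
elim: a u w => [//|e a IH] u w gw /= /andP[_ wa] _ ac.
have he : mm e + K <= c by apply: ac; rewrite inE eqxx.
have ge := est_letter est e gw.
case: a wa IH ac => [_ _ _|e' a wa IH ac] /=.
  by rewrite mulr1; have := K0; lra.
have := IH _ _ (est_theta est gw) wa isT (fun x xa => ac x (mem_behead (s := [:: e, e' & a]) xa)).
have we : wt [:: e] (ini e) (ter e) by rewrite /= !eqxx.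
have := g_catl gw we wa; rewrite /= -[in X in _ -> _ -> X](natr1 (size a).+1).
lra.
Qed.

Lemma g_lower a u v w : good w -> wt a u v -> (0 < size a)%N ->
  (forall e, e \in a -> e \in F0) -> - cF * (size a)%:R <= g a w.
Proof. by move=> gw wa a0 aF; apply: g_lower_gen gw wa a0 _ => e /aF/mm_cF. Qed.

(** Prefixes of repeated loops through [e0] and [conn e0 e0]. They bound [Z] from below for every
    alphabet that contains [F0]. *)
Lemma F0_words n : exists a u v, [/\ size a = n, wt a u v & forall e, e \in a -> e \in F0].
Proof.
have [a [sa wa aF]] : exists a, [/\ (n <= size a)%N, wt a (ini e0) (ini e0) & forall e, e \in a -> e \in F0].
  elim: n => [|n [a [sa wa aF]]]; first by exists [::]; rewrite /= eqxx.
  exists ((e0 :: conn e0 e0) ++ a); split.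
  - by rewrite size_cat /= -[n.+1]add1n leq_add.
  - by apply/wt_cat; exists (ini e0) => //=; rewrite eqxx conn_wt.
  - move=> e; rewrite mem_cat inE => /orP[/orP[/eqP->//|]|]; [exact: conn_F0|exact: aF].
have [w ww] := wt_take n wa.
exists (take n a), (ini e0), w; split=> //; first by rewrite size_takel.
by move=> e /mem_take; exact: aF.
Qed.

Definition lwords (F : set E) n : set (seq E) :=
  [set a | words ini ter n a /\ forall e, e \in a -> F e].

Definition Z (F : set E) s n w : \bar R :=
  \esum_(a in lwords F n) (expR (s * g a w))%:E.

Variable F : set E.
Hypothesis F0F : forall e, e \in F0 -> F e.
Variable s : R.
Hypothesis s0 : 0 <= s.

Let expR_ge0E (x : R) : (0 <= (expR x)%:E)%E. Proof. by rewrite lee_fin expR_ge0. Qed.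

Lemma Z_ge0 n w : (0 <= Z F s n w)%E.
Proof. by apply: esum_ge0 => a _. Qed.

Lemma Z_lower n w : good w -> (0 < n)%N -> ((expR (- (s * cF) * n%:R))%:E <= Z F s n w)%E.
Proof.
move=> gw n0; have [a [u [v [sa wa aF]]]] := F0_words n.
have la : lwords F n a by split; [split=> //; exact: wt_sorted wa|move=> e /aF/F0F].
apply: le_trans (esum_gt0_ge (a := fun a => (expR (s * g a w))%:E) la _) => //.
rewrite lee_fin ler_expR (_ : - (s * cF) * n%:R = s * (- cF * n%:R)); last ring.
apply: ler_wpM2l => //; rewrite -sa; apply: g_lower gw wa _ aF.
by rewrite sa.
Qed.

(** Cutting at position [n] is injective into pairs of words. The second factor enters through a
    real bound, because a partition function may be infinite. *)
Lemma Z_upper n m w (M : R) : good w -> 0 <= M -> (Z F s m (iter n theta w) <= M%:E)%E ->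
  (Z F s (n + m) w <= (expR (s * K) * M)%:E * Z F s n w)%E.
Proof.
move=> gw M0 ZM.
pose x a := expR (s * K) * expR (s * g a w).
pose y b := expR (s * g b (iter n theta w)).
have x0 a : 0 < x a by rewrite mulr_gt0// expR_gt0.
apply: (@le_trans _ _ (\esum_(a in lwords F n) \esum_(b in lwords F m) ((x a)%:E * (y b)%:E))%E).
  rewrite esum_esum; last by move=> a b _ _; rewrite mule_ge0// lee_fin ?expR_ge0// ltW.
  apply: (@esum_le_inj _ _ _ _ _ (fun c => (take n c, drop n c))).
  - move=> c [[sc wc] cF']; split; split=> /=.
    + split; first by rewrite size_takel// sc leq_addr.
      exact: take_sorted.
    + by move=> e /mem_take; exact: cF'.
    + split; first by rewrite size_drop sc addKn.
      exact: drop_sorted.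
    + by move=> e /mem_drop; exact: cF'.
  - by move=> c c' _ _ [h1 h2]; rewrite -(cat_take_drop n c) h1 h2 cat_take_drop.
  - move=> c cw; have [u [v wc]] := words_wt e0 cw.1.
    rewrite /= -EFinM lee_fin /x /y -!expRD ler_expR.
    have [[sc _] _] := cw.
    have stn : size (take n c) = n by rewrite size_takel// sc leq_addr.
    move: wc; rewrite -{1}(cat_take_drop n c) => /wt_cat[v' w1 w2].
    have := g_catr gw w1 w2; rewrite cat_take_drop stn => h.
    by rewrite -!mulrDr ler_wpM2l//; lra.
  - by move=> [a b] /=; rewrite mule_ge0// lee_fin ?expR_ge0// ltW.
apply: (@le_trans _ _ (\esum_(a in lwords F n) ((expR (s * K) * M)%:E * (expR (s * g a w))%:E))%E).
  apply: le_esum => a _.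
  rewrite esumZ//; last by move=> b; exact: expR_ge0E.
  rewrite -/(Z F s m (iter n theta w)).
  apply: (@le_trans _ _ ((x a)%:E * M%:E)%E); first by rewrite lee_wpmul2l// lee_fin ltW.
  by rewrite -!EFinM lee_fin /x mulrAC.
by apply: (@esumZ_le _ _ (lwords F n) (fun a => (expR (s * g a w))%:E)) => //; rewrite mulr_ge0// expR_ge0.
Qed.

(** Gluing through a connector takes two concatenations, each costing [K], and [N] letters of [F0],
    each costing [cF]. *)
Definition gapC : R := 2 * K + cF * N%:R.

(** Gluing is injective on pairs because [n] and the length [N] of the connector are fixed, so both
    words can be read off the result. *)
Lemma Z_gap n m w (m1 : R) : good w -> (0 < n)%N -> (0 < m)%N -> 0 <= m1 ->
  (m1%:E <= Z F s m (iter (n + N) theta w))%E ->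
  ((expR (- (s * gapC)) * m1)%:E * Z F s n w <= Z F s (n + N + m) w)%E.
Proof.
move=> gw n0 m0 m10 Zm.
pose x a := expR (- (s * gapC)) * expR (s * g a w).
pose y b := expR (s * g b (iter (n + N) theta w)).
have x0 a : 0 < x a by rewrite mulr_gt0// expR_gt0.
apply: (@le_trans _ _ (\esum_(a in lwords F n) ((x a)%:E * Z F s m (iter (n + N) theta w)))%E).
  have [->|m1n] := eqVneq m1 0.
    rewrite mulr0 mul0e; apply: esum_ge0 => a _; rewrite mule_ge0 ?Z_ge0// lee_fin ltW//.
  have m1p : 0 < m1 by rewrite lt_neqAle eq_sym m1n.
  rewrite -esumZ; [|by rewrite mulr_gt0// expR_gt0|by move=> a; exact: expR_ge0E].
  apply: le_esum => a _; apply: (@le_trans _ _ ((x a)%:E * m1%:E)%E).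
    by rewrite -!EFinM lee_fin /x mulrAC.
  by rewrite lee_wpmul2l// lee_fin ltW.
have -> : (\esum_(a in lwords F n) ((x a)%:E * Z F s m (iter (n + N) theta w)) =
    \esum_(a in lwords F n) \esum_(b in lwords F m) ((x a)%:E * (y b)%:E))%E.
  by apply: eq_esum => a _; rewrite esumZ// => b; exact: expR_ge0E.
rewrite esum_esum; last by move=> a b _ _; rewrite mule_ge0// lee_fin ?expR_ge0// ltW.
pose c (p : seq E * seq E) := p.1 ++ conn (last e0 p.1) (head e0 p.2) ++ p.2.
have cP a b : lwords F n a -> lwords F m b -> exists u v v' u',
    [/\ wt a u v, wt (conn (last e0 a) (head e0 b)) v v', wt b v' u',
      (size a = n)%N & size b = m].
  move=> [[sa wa] aF] [[sb wb] bF].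
  case: a wa aF sa => [|ea a] wa aF sa; first by rewrite -sa in n0.
  case: b wb bF sb => [|eb b] wb bF sb; first by rewrite -sb in m0.
  exists (ini ea), (ter (last ea a)), (ini eb), (ter (last eb b)); split=> //.
  - by rewrite -sorted_wt.
  - by rewrite -sorted_wt.
apply: (@esum_le_inj _ _ _ _ _ c) => //.
- move=> [a b] [/= la lb]; have [u [v [v' [u' [w1 w2 w3 sa sb]]]]] := cP a b la lb.
  have wc : wt (c (a, b)) u u'.
    by apply/wt_cat; exists v => //; apply/wt_cat; exists v'.
  split.
    split; last exact: wt_sorted wc.
    by rewrite !size_cat sa sb conn_size addnA.
  move=> e; rewrite !mem_cat => /orP[|/orP[]]; [exact: la.2| |exact: lb.2].
  by move/conn_F0/F0F.
- move=> [a b] [a' b'] [/= [[sa _] _] [[sb _] _]] [/= [[sa' _] _] [[sb' _] _]].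
  rewrite /c /= => /eqP; rewrite eqseq_cat ?sa ?sa'// => /andP[/eqP ->].
  by rewrite eqseq_cat ?conn_size// => /andP[_ /eqP ->].
- move=> [a b] [/= la lb]; have [u [v [v' [u' [w1 w2 w3 sa sb]]]]] := cP a b la lb.
  rewrite -EFinM lee_fin /x /y -!expRD ler_expR -mulrN -!mulrDr ler_wpM2l//.
  have w23 : wt (conn (last e0 a) (head e0 b) ++ b) v u' by apply/wt_cat; exists v'.
  have h1 := g_catl gw w1 w23.
  have h2 := g_catl (good_iter (size a) gw) w2 w3.
  have h3 := g_lower (good_iter (size a) gw) w2 (eq_ind_r (fun x => 0 < x)%N N0 (conn_size _ _))
     (fun e => @conn_F0 _ _ e).
  rewrite conn_size -iterD (addnC _ (size a)) sa in h2 h3.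
  rewrite sa in h1 *.
  rewrite /c /= /gapC; lra.
Qed.

Lemma Z_measurable n : measurable_fun [set: Omega] (Z F s n).
Proof.
apply: emeasurable_esum => // a [aw _].
have [u [v wa]] := words_wt e0 aw.
apply/measurable_EFinP; apply: measurableT_comp; first exact: measurable_expR.
apply: measurable_funM; first exact: measurable_cst.
exact: (est_meas est wa).
Qed.

Definition Zgood : set Omega :=
  [set w | good w /\ forall j, (Z F s 1 (iter j theta w) < +oo)%E].

Lemma Zgood_theta w : Zgood w -> Zgood (theta w).
Proof.
move=> [gw h]; split; first exact: (est_theta est gw).
by move=> j; rewrite -iterSr.
Qed.

Lemma Z_finite n w : Zgood w -> (Z F s n.+1 w < +oo)%E.
Proof.
elim: n w => [|n IH] w [gw h]; first exact: (h 0%N).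
rewrite -[n.+2]addn1; have h1 := h n.+1.
have M0 : 0 <= fine (Z F s 1 (iter n.+1 theta w)) by rewrite fine_ge0 ?Z_ge0.
have f1 : Z F s 1 (iter n.+1 theta w) \is a fin_num by rewrite ge0_fin_numE// Z_ge0.
have := @Z_upper n.+1 1%N w _ gw M0; rewrite fineK// => /(_ (lexx _)) h2.
apply: (le_lt_trans h2); apply: lte_mul_pinfty => //.
  by rewrite lee_fin mulr_ge0// expR_ge0.
by apply: IH; split.
Qed.

(** The indicator sets the value to 0 off [Zgood], so that the bounds used for integrability hold at
    every point. *)
Definition Lz n w : R := ln (fine (Z F s n w)) * \1_Zgood w.

Lemma Lz_out n w : ~ Zgood w -> Lz n w = 0.
Proof. by move=> nG; rewrite /Lz indicE memNset// mulr0. Qed.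

Lemma Z_Lz n w : Zgood w -> (0 < n)%N -> Z F s n w = (expR (Lz n w))%:E.
Proof.
case: n => // n Gw _.
have h := Z_finite n Gw.
have f : Z F s n.+1 w \is a fin_num by rewrite ge0_fin_numE// Z_ge0.
rewrite /Lz indicE mem_set// mulr1 lnK ?fineK// posrE -lte_fin fineK//.
by apply: lt_le_trans (Z_lower Gw.1 (ltn0Sn n)); rewrite lte_fin expR_gt0.
Qed.

Lemma Lz_upper n m w : Zgood w -> (0 < n)%N -> (0 < m)%N ->
  Lz (n + m) w <= Lz n w + Lz m (iter n theta w) + s * K.
Proof.
move=> Gw n0 m0.
have Gn : Zgood (iter n theta w) by elim: n {n0} => //= n; exact: Zgood_theta.
have := @Z_upper n m w (expR (Lz m (iter n theta w))) Gw.1 (expR_ge0 _).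
rewrite -Z_Lz// => /(_ (lexx _)); rewrite !Z_Lz ?addn_gt0 ?n0//.
rewrite -EFinM lee_fin -!expRD ler_expR; lra.
Qed.

Lemma Lz_lower n m w : Zgood w -> (0 < n)%N -> (0 < m)%N ->
  Lz n w + Lz m (iter (n + N) theta w) - s * gapC <= Lz (n + N + m) w.
Proof.
move=> Gw n0 m0.
have Gn : Zgood (iter (n + N) theta w) by elim: (n + N)%N => //= k; exact: Zgood_theta.
have := @Z_gap n m w (expR (Lz m (iter (n + N) theta w))) Gw.1 n0 m0 (expR_ge0 _).
rewrite -Z_Lz// => /(_ (lexx _)); rewrite !Z_Lz ?addn_gt0 ?n0//.
rewrite -EFinM lee_fin -!expRD ler_expR; lra.
Qed.

Lemma Lz_bound n w : Zgood w -> (0 < n)%N -> - (s * cF) * n%:R <= Lz n w.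
Proof.
move=> Gw n0; have := Z_lower Gw.1 n0.
by rewrite Z_Lz// lee_fin ler_expR.
Qed.

End Symbolic.

(* The integrals of the positive and negative parts of a non-measurable function
   are suprema over the simple functions below them. *)
Section LowerIntegral.
Context {disp : measure_display} {Omega : measurableType disp} {R : realType}.
Variable P : probability Omega R.
Local Open Scope ereal_scope.
Implicit Types f h : Omega -> \bar R.
Import HBNNSimple.

Lemma lower_integral_le f h : (forall w, 0 <= f w) -> (forall w, 0 <= h w) ->
  measurable_fun [set: Omega] h -> (\forall w \ae P, f w <= h w) ->
  \int[P]_w f w <= \int[P]_w h w.
Proof.
move=> f0 h0 mh fh; rewrite [leLHS]ge0_integralTE//.
apply: ge_ereal_sup => _ [k /= kf <-].
rewrite -integralT_nnsfun; apply: ae_ge0_le_integral => //.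
- by move=> w _; rewrite lee_fin; exact: fun_ge0.
- exact/measurable_EFinP.
- by move: fh; apply: filterS => w fw _; exact: le_trans (kf w) fw.
Qed.

Lemma lower_integral_ge f h : (forall w, 0 <= f w) -> (forall w, 0 <= h w) ->
  (forall w, f w <= h w) -> \int[P]_w f w <= \int[P]_w h w.
Proof.
move=> f0 h0 fh; rewrite !ge0_integralTE//.
apply: le_ereal_sup => _ [k /= kf <-]; exists k => //= w.
exact: le_trans (kf w) (fh w).
Qed.

Lemma lower_integral_lty f h (c : R) : (forall w, 0 <= h w) ->
  measurable_fun [set: Omega] h ->
  (\forall w \ae P, f w <= h w + c%:E) -> \int[P]_w h w < +oo ->
  \int[P]_w f w < +oo.
Proof.
move=> h0 mh fh hi.
have mhc : measurable_fun [set: Omega] (fun w => h w + `|c|%:E).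
  by apply: emeasurable_funD => //; exact: measurable_cst.
have c0 : 0 <= `|c|%:E by rewrite lee_fin.
have pos : \int[P]_w f^\+ w < +oo.
  apply: (@le_lt_trans _ _ (\int[P]_w (h w + `|c|%:E))).
    apply: lower_integral_le => //.
    - by move=> w; exact: adde_ge0.
    - move: fh; apply: filterS => w fw; rewrite funeposE ge_max adde_ge0// andbT.
      by rewrite (le_trans fw)// leeD2l// lee_fin ler_norm.
  rewrite (ge0_integralD P measurableT (fun w _ => h0 w) mh (fun _ _ => c0) (measurable_cst _)).
  have := @integral_cst _ _ _ P _ measurableT `|c|%:E.
  rewrite [X in (_ * X)](probability_setT P) mule1 => ->.
  by rewrite lte_add_pinfty// ltry.
rewrite integralE; apply: le_lt_trans pos.
by rewrite -[leRHS]sube0; apply: leeB => //; exact: integral_ge0.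
Qed.

(** Completeness makes the set where the bounds hold measurable. The positive part of [f] then lies
    above a measurable function with infinite integral, and the negative part has a finite one, so
    no indeterminate difference arises. *)
Lemma lower_integral_y f h (c : R) : (forall w, 0 <= h w) ->
  measurable_fun [set: Omega] h -> measure_is_complete P ->
  (\forall w \ae P, h w <= f w + c%:E /\ - c%:E <= f w) -> \int[P]_w h w = +oo ->
  \int[P]_w f w = +oo.
Proof.
move=> h0 mh Pc hf hi.
have c0 : 0 <= `|c|%:E by rewrite lee_fin.
have neg : \int[P]_w f^\- w < +oo.
  apply: (@le_lt_trans _ _ (\int[P]_w `|c|%:E)).
    apply: lower_integral_le => //.
    move: hf; apply: filterS => w [_ fw]; rewrite funenegE ge_max lee_fin normr_ge0 andbT.
    by rewrite leeNl (le_trans _ fw)// -EFinN lee_fin lerN2 ler_norm.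
  have := @integral_cst _ _ _ P _ measurableT `|c|%:E.
  by rewrite [X in (_ * X)](probability_setT P) mule1 => ->; rewrite ltry.
pose A := [set w | h w <= f w + c%:E /\ - c%:E <= f w].
have mA : measurable A by rewrite -[A]setCK; apply: measurableC; exact: Pc.
pose k w := maxe (h w - `|c|%:E) 0 * (\1_A w)%:E.
have k0 w : 0 <= k w by rewrite mule_ge0 ?lee_fin// le_max lexx orbT.
have mk : measurable_fun [set: Omega] k.
  apply: emeasurable_funM; last exact/measurable_EFinP/measurable_indic.
  apply: measurable_maxe; last exact: measurable_cst.
  by apply: emeasurable_funB => //; exact: measurable_cst.
have kf w : k w <= f^\+ w.
  rewrite /k indicE funeposE; case: (boolP (w \in A)) => [/set_mem [hw _]|_].
    rewrite mule1 ge_max !le_max lexx !orbT andbT.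
    rewrite leeBlDr// (le_trans hw) ?orbT//.
    by rewrite leeD2l// lee_fin ler_norm.
  by rewrite mule0 le_max lexx orbT.
have ki : \int[P]_w k w = +oo.
  apply: contrapT => /eqP kn.
  have kfin : \int[P]_w k w < +oo by rewrite ltey.
  suff : \int[P]_w h w < +oo by rewrite hi ltxx.
  apply: (@lower_integral_lty h k `|c|%R) => //.
  exists (~` A); split; [exact: measurableC| |].
    have [B [mB PB AB]] := hf; apply/eqP; rewrite -measure_le0 -PB le_measure ?inE//.
    exact: measurableC.
  move=> w /= h1 Aw; apply: h1; rewrite /k indicE mem_set// mule1.
  rewrite -leeBlDr// le_max lexx//.
rewrite integralE; have -> : \int[P]_w f^\+ w = +oo.
  apply/eqP; rewrite -leye_eq -ki; apply: lower_integral_ge => //.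
rewrite addye//; apply/eqP => /(congr1 oppe); rewrite oppeK /= => negy.
by rewrite negy ltxx in neg.
Qed.

End LowerIntegral.

Lemma squeeze_arith (R : realType) (l X p x y e : R) :
  l <= (x + e / 2) * X -> (y - e / 2) * X <= l ->
  x * X <= (p + e / 2) * X -> (p - e / 2) * X <= y * X -> `|l - p * X| <= e * X.
Proof. by move=> *; rewrite ler_norml; apply/andP; split; lra. Qed.

(** [X] is a word length, [Y] the number of letters spent on closing a word up to a loop; [L] and
    [L'] are logarithms of partition functions at lengths [X] and [X - Y], and [l] is the quantity
    squeezed between them. *)
Lemma pressure_arith (R : realType) (l L L' p X Y a b e : R) (Y0 : 0 <= Y) :
  0 <= e -> `|L - p * X| <= e / 4 * X -> `|L' - p * (X - Y)| <= e / 4 * (X - Y) ->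
  `|a| + `|b| + `|p| * Y <= e / 4 * X -> - b + L' <= l -> l <= a + L ->
  `|l - p * X| <= e * X.
Proof.
move=> e0 h1 h2 h3 h4 h5.
have a1 := ler_norm a; have a2 := ler_norm b.
have a3 : `|p * Y| <= `|p| * Y by rewrite normrM [X in _ * X]ger0_norm.
have a4 : 0 <= e / 4 * Y by rewrite !mulr_ge0.
have a5 := normr_ge0 a; have a6 := normr_ge0 b.
have a7 : 0 <= `|p| * Y by rewrite mulr_ge0.
move: h1 h2 a3; rewrite !ler_norml => /andP[b1 b2] /andP[b3 b4] /andP[b5 b6].
by apply/andP; split; lra.
Qed.

Lemma le_lne (R : realType) (x y : \bar R) : (0 < x)%E -> (x <= y)%E -> (lne x <= lne y)%E.
Proof.
move=> x0 xy; have y0 := lt_le_trans x0 xy.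
by rewrite lee_lne// in_itv /= leey andbT ltW.
Qed.

(** * Existence of the pressure and finiteness of the transfer integral *)

Section PressureExists.
Context {disp : measure_display} {Omega : measurableType disp} {R : realType}
  {d : nat} {V : finType} {E : countType} {ini ter : E -> V}.
Variables (P : probability Omega R) (theta : Omega -> Omega).
Variable Phi : rgdms Omega R d ini ter.
Variables (good : set Omega) (g : seq E -> Omega -> R) (K kp : R) (mm : E -> R).
Hypothesis est : sys_est P theta Phi good g K kp mm.
Hypothesis P_complete : measure_is_complete P.
Hypothesis theta_meas : measurable_fun [set: Omega] theta.
Hypothesis theta_pres : measure_preserving P theta.
Hypothesis theta_erg : ergodic P theta.
Variables (e0 : E) (N : nat) (conn : E -> E -> seq E) (F0 : seq E).
Hypothesis N0 : (0 < N)%N.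
Hypothesis e0F0 : e0 \in F0.
Hypothesis conn_size : forall e e', size (conn e e') = N.
Hypothesis conn_wt : forall e e', wt ini ter (conn e e') (ter e) (ini e').
Hypothesis conn_F0 : forall e e' x, x \in conn e e' -> x \in F0.
Variable s : R.
Hypothesis s0 : 0 <= s.

Local Notation wt := (wt ini ter).
Local Notation Z F := (@Z _ Omega R V E ini ter g F s).
Local Notation Zgood F := (@Zgood _ Omega R V E ini ter theta good g F s).
Local Notation Lz F := (@Lz _ Omega R V E ini ter theta good g F s).
Local Notation cF := (cF K mm F0).
Local Notation gapC := (gapC K mm N F0).
Local Notation intg f := (P.-integrable [set: Omega] (EFin \o f)).

Let K0 : 0 <= K. Proof. exact: est_K est. Qed.

Lemma ae_measurable (A : set Omega) : (\forall w \ae P, A w) -> measurable A.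
Proof. by move=> hA; rewrite -[A]setCK; apply: measurableC; exact: P_complete. Qed.

Section FixedAlphabet.
Variable F : set E.
Hypothesis F0F : forall e, e \in F0 -> F e.
Hypothesis F_ae : \forall w \ae P, Zgood F w.

Let mG : measurable (Zgood F). Proof. exact: ae_measurable. Qed.

Lemma Lz_measurable n : measurable_fun [set: Omega] (Lz F n).
Proof.
apply: measurable_funM; last exact: measurable_indic.
apply: (@measurableT_comp _ _ _ _ _ _ (@ln R)); first exact: measurable_ln.
apply: (@measurableT_comp _ _ _ _ _ _ (@fine R)); first exact: fine_measurable.
exact: (Z_measurable est e0).
Qed.

Let Gt w : Zgood F w -> Zgood F (theta w) := Zgood_theta est (w:=w).
Let A0 : 0 <= s * K. Proof. exact: mulr_ge0. Qed.
Let c0 : 0 <= s * cF. Proof. by rewrite mulr_ge0// (cF_ge0 est). Qed.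
Let Up n m w : Zgood F w -> (0 < n)%N -> (0 < m)%N -> _ :=
  @Lz_upper _ _ _ _ _ _ _ _ _ _ _ _ _ _ _ _ est _ _ _ e0F0 conn_wt conn_F0 F F0F s s0 n m w.
Let Low n m w : Zgood F w -> (0 < n)%N -> (0 < m)%N -> _ :=
  @Lz_lower _ _ _ _ _ _ _ _ _ _ _ _ _ _ _ _ est _ _ _ _ N0 e0F0 conn_size conn_wt conn_F0 F F0F s s0 n m w.
Let Bnd n w : Zgood F w -> (0 < n)%N -> _ :=
  @Lz_bound _ _ _ _ _ _ _ _ _ _ _ _ _ _ _ _ est _ _ _ e0F0 conn_wt conn_F0 F F0F s s0 n w.

Lemma integrable_bsum (f : Omega -> R) n : intg f -> intg (bsum theta f n).
Proof.
move=> fi; elim: n => [|n IH].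
  by rewrite (_ : bsum _ _ _ = fun=> 0); [exact: integrable0|apply/funext => w; rewrite /bsum big_ord0].
rewrite (_ : bsum theta f n.+1 = fun w => f w + bsum theta f n (theta w)); last first.
  by apply/funext => w; rewrite bsumS.
exact: (integrableD measurableT fi (integrable_theta theta_meas theta_pres IH)).
Qed.

Lemma Lz_integrable n : intg (Lz F 1) -> (0 < n)%N -> intg (Lz F n).
Proof.
move=> L1i n0.
have [ci _] := @integral_cstP _ _ _ P (s * K).
have bi : intg (fun w => `|Lz F 1 w| + s * K).
  exact: (integrableD measurableT (integrable_norm L1i) ci).
have [ki _] := @integral_cstP _ _ _ P (s * cF * n%:R).
have hi := integrableD measurableT (integrable_bsum n bi) ki.
apply: (le_integrable measurableT _ _ hi).
  by apply/measurable_EFinP; exact: Lz_measurable.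
move=> w _ /=; rewrite lee_fin.
have b0 : 0 <= bsum theta (fun w => `|Lz F 1 w| + s * K) n w.
  by apply: bsum_ge0 => w'; rewrite addr_ge0.
have k0 : 0 <= s * cF * n%:R by rewrite mulr_ge0.
rewrite [leRHS]ger0_norm ?addr_ge0//.
have [Gw|nGw] := pselect (Zgood F w); last first.
  by rewrite Lz_out// normr0 addr_ge0.
have h1 := L_le_bsum Gt A0 Up Gw n0.
have h2 := Bnd Gw n0.
rewrite ler_norml; apply/andP; split; last by lra.
by move: h2; rewrite mulNr; lra.
Qed.

Definition meanL n : R := fine (\int[P]_w (Lz F n w)%:E)%E.

Lemma meanLE n : intg (Lz F n) -> (\int[P]_w (Lz F n w)%:E = (meanL n)%:E)%E.
Proof. by move=> Li; rewrite fineK// integrable_fin_num. Qed.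

(** The cost [s * gapC] is paid once per block, so a block length whose mean exceeds it already
    forces linear growth of [Lz]. *)
Lemma finite_growth k : (0 < k)%N -> intg (Lz F k) -> s * gapC < meanL k ->
  exists2 c : R, 0 < c & \forall w \ae P, exists n0, forall n, (n0 <= n)%N ->
    c * n%:R <= Lz F n w.
Proof.
move=> k0 Lki kB.
have kN0 : 0 < (k + N)%:R :> R by rewrite ltr0n addn_gt0 k0.
pose c := (meanL k - s * gapC) / (k + N)%:R / 2.
have cp : 0 < c by rewrite !divr_gt0// subr_gt0.
exists c => //.
have := growth_ge theta_meas theta_pres theta_erg Gt A0 Low Bnd c0 F_ae k0 Lki (meanLE Lki).
have e : (meanL k - s * gapC) / (k + N)%:R - c = c by rewrite /c; lra.
by apply: filterS => w /(_ c cp); rewrite e.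
Qed.

Hypothesis L1i : intg (Lz F 1).

(** Fekete's limit: [meanL k + s * K] is subadditive in [k], so the infimum of the quotients is the
    growth rate. It turns out to be the pressure. *)
Definition prate : R := inf [set (meanL k + s * K) / k%:R | k in [set k | (0 < k)%N]].

Lemma prate_lbound : has_lbound [set (meanL k + s * K) / k%:R | k in [set k | (0 < k)%N]].
Proof.
exists (- (s * cF)) => _ [k /= k0 <-].
have kR0 : 0 < k%:R :> R by rewrite ltr0n.
rewrite ler_pdivlMr//.
suff : - (s * cF) * k%:R <= meanL k by have := A0; lra.
rewrite -lee_fin -(meanLE (Lz_integrable L1i k0)).
have [ki ke] := @integral_cstP _ _ _ P (- (s * cF) * k%:R).
rewrite -ke; apply: le_integral => //; first exact: Lz_integrable.
move=> w _; rewrite lee_fin.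
have [Gw|nGw] := pselect (Zgood F w); first exact: Bnd.
by rewrite Lz_out// mulNr oppr_le0 mulr_ge0.
Qed.

Lemma prate_le k : (0 < k)%N -> prate * k%:R <= meanL k + s * K.
Proof.
move=> k0; rewrite -ler_pdivlMr ?ltr0n//.
by apply: ge_inf; [exact: prate_lbound|exists k].
Qed.

Lemma growth_prate : \forall w \ae P, forall e : R, 0 < e ->
  exists n0, forall n, (n0 <= n)%N -> `|Lz F n w - prate * n%:R| <= e * n%:R.
Proof.
have up : \forall w \ae P, forall k : nat, forall e : R, 0 < e -> exists n0, forall n, (n0 <= n)%N ->
    Lz F n w <= ((meanL k.+1 + s * K) / k.+1%:R + e) * n%:R.
  apply: ae_foralln => k.
  exact: (growth_le theta_meas theta_pres theta_erg Gt A0 Up c0 F_ae (ltn0Sn k) L1i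
    (Lz_integrable L1i (ltn0Sn k)) (meanLE (Lz_integrable L1i (ltn0Sn k)))).
have low : \forall w \ae P, forall k : nat, forall e : R, 0 < e -> exists n0, forall n, (n0 <= n)%N ->
    ((meanL k.+1 - s * gapC) / (k.+1 + N)%:R - e) * n%:R <= Lz F n w.
  apply: ae_foralln => k.
  exact: (growth_ge theta_meas theta_pres theta_erg Gt A0 Low Bnd c0 F_ae (ltn0Sn k)
    (Lz_integrable L1i (ltn0Sn k)) (meanLE (Lz_integrable L1i (ltn0Sn k)))).
move: up low; apply: filterS2 => w up low e ep.
have e2 : 0 < e / 2 by rewrite divr_gt0.
have [k1 k1e] : exists k1 : nat, (meanL k1.+1 + s * K) / k1.+1%:R < prate + e / 2.
  have hi : has_inf [set (meanL k + s * K) / k%:R | k in [set k | (0 < k)%N]].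
    by split; [exists ((meanL 1 + s * K) / 1%:R), 1%N|exact: prate_lbound].
  have [_ [k /= k0 <-]] := inf_adherent e2 hi.
  by move=> h; exists k.-1; rewrite prednK.
(* For long blocks the gap [N] and the costs [s * K] and [s * gapC] are negligible, since
   [meanL k + s * K] is at least [prate * k%:R]. *)
have [k2 k2e] : exists k2 : nat, prate - e / 2 <= (meanL k2.+1 - s * gapC) / (k2.+1 + N)%:R.
  pose D := `|prate * N%:R| + s * K + `|s * gapC|.
  have [n0 Hn] := eventually_le_mul D e2.
  exists n0; have {}Hn := Hn (n0.+1 + N)%N ltac:(clear; lia).
  have kN0 : 0 < (n0.+1 + N)%:R :> R by rewrite ltr0n.
  rewrite ler_pdivlMr//.
  have := prate_le (ltn0Sn n0).
  have := ler_norm (prate * N%:R); have := ler_norm (s * gapC).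
  by move: Hn; rewrite /D natrD; move: (n0.+1%:R) => x; nra.
have [n1 H1] := up k1 _ e2; have [n2 H2] := low k2 _ e2.
exists (n1 + n2)%N => n nn.
have {}H1 := H1 n ltac:(clear -nn; lia); have {}H2 := H2 n ltac:(clear -nn; lia).
have nR : 0 <= n%:R :> R by [].
have u1 := ler_wpM2r nR (ltW k1e); have u2 := ler_wpM2r nR k2e.
exact: squeeze_arith H1 H2 u1 u2.
Qed.

End FixedAlphabet.

Variable xi : E -> nat -> E.
Hypothesis xi_spec : forall e, shift_space ini ter (xi e) /\ xi e 0%N = e.

Local Notation Q := (partition_sum theta Phi xi s).
Local Notation T := [set: E].
Let F0T : forall e : E, e \in F0 -> T e. Proof. by []. Qed.

Let good_iter n w : good w -> good (iter n theta w).
Proof. by elim: n => //= n IH /IH h; exact: (est_theta est h). Qed.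

Lemma Q_upper n e w : good w -> (Q n e w <= (expR (s * K))%:E * Z T n w)%E.
Proof.
move=> gw; rewrite -esumZ; [|exact: expR_gt0|by move=> a; rewrite lee_fin expR_ge0].
apply: (@esum_le_inj _ _ _ _ _ id) => //.
- by move=> a [wa _ _]; split.
- move=> a [[sa wa] ha aa].
  case: a wa ha aa sa => [//|e' b] wa [ee] aa sa; rewrite ee in wa aa sa *.
  have [st x0] := xi_spec e.
  have wa' : wt (e :: b) (ini e) (ter (last e b)) by rewrite -sorted_wt.
  have := est_birkhoff est gw wa' st; rewrite x0.
  move=> /(_ (esym (eqP aa))); rewrite ler_distl => /andP[_ h].
  rewrite -EFinM lee_fin -expRD ler_expR -mulrDr ler_wpM2l// -sa addrC.
  exact: h.
Qed.

(** The first letter costs [mm e], the two connectors [2 * cF * N%:R], the three concatenations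
    [3 * K], and the passage to the Birkhoff sum one more [K]. *)
Definition retC e : R := mm e + 2 * cF * N%:R + 4 * K.

(** A word [a] becomes a return word: the letter [e], a connector, [a], a connector back. This adds
    [N.*2.+1] letters, of which [N.+1] precede [a]; hence the two shifts. *)
Lemma Q_lower n e w : good w -> (0 < n)%N ->
  ((expR (- (s * retC e)))%:E * Z T n (iter N.+1 theta w) <= Q (n + N.*2.+1) e w)%E.
Proof.
move=> gw n0; rewrite -esumZ; [|exact: expR_gt0|by move=> a; rewrite lee_fin expR_ge0].
pose c a := e :: conn e (head e0 a) ++ a ++ conn (last e0 a) e.
have sc a : size a = n -> size (c a) = (n + N.*2.+1)%N.
  by move=> sa; rewrite /= !size_cat !conn_size sa -addnn; lia.
apply: (@esum_le_inj _ _ _ _ _ c).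
- move=> a [[sa wa] _].
  case: a wa sa => [|ea a] wa sa; first by rewrite -sa in n0.
  have w1 : wt (ea :: a) (ini ea) (ter (last ea a)) by rewrite -sorted_wt.
  have wc : wt (c (ea :: a)) (ini e) (ini e).
    rewrite /c /= eqxx /=; apply/wt_cat; exists (ini ea); first exact: conn_wt.
    by apply/(wt_cat ini ter (ea :: a)); exists (ter (last ea a)).
  split.
  + by split; [rewrite sc|exact: wt_sorted wc].
  + by [].
  + by rewrite /adm -(wt_last wc).
- move=> a a' [[sa _] _] [[sa' _] _]; rewrite /c => -[] /eqP.
  rewrite eqseq_cat ?conn_size// => /andP[_].
  by rewrite eqseq_cat ?sa ?sa'// => /andP[/eqP].
- move=> a [[sa wa] _].
  case: a wa sa => [|ea a] wa sa; first by rewrite -sa in n0.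
  have w1 : wt (ea :: a) (ini ea) (ter (last ea a)) by rewrite -sorted_wt.
  set a1 := ea :: a in w1 sa *.
  have w2 : wt (conn ea e) (ter ea) (ini e) by exact: conn_wt.
  have we : wt [:: e] (ini e) (ter e) by rewrite /= !eqxx.
  have wh : wt (conn e ea) (ter e) (ini ea) by exact: conn_wt.
  have wl : wt (conn (last ea a) e) (ter (last ea a)) (ini e) by exact: conn_wt.
  have w3 : wt (a1 ++ conn (last ea a) e) (ini ea) (ini e).
    by apply/wt_cat; exists (ter (last ea a)).
  have w4 : wt (conn e ea ++ a1 ++ conn (last ea a) e) (ter e) (ini e).
    by apply/wt_cat; exists (ini ea).
  have w5 : wt (c a1) (ini e) (ini e).
    by rewrite -[c a1]/([:: e] ++ _); apply/wt_cat; exists (ter e).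
  have h1 := g_catl est gw we w4.
  have gw1 := good_iter 1 gw.
  have h2 := g_catl est gw1 wh w3.
  have gw2 := good_iter N gw1.
  rewrite conn_size in h2.
  have h3 := g_catl est gw2 w1 wl.
  have gw3 := good_iter n gw2.
  rewrite sa in h3.
  have l1 := g_lower est gw1 wh (eq_ind_r (fun x => 0 < x)%N N0 (conn_size _ _)) (fun e => @conn_F0 _ _ e).
  have l2 := g_lower est gw3 wl (eq_ind_r (fun x => 0 < x)%N N0 (conn_size _ _)) (fun e => @conn_F0 _ _ e).
  rewrite conn_size in l1; rewrite conn_size in l2.
  have l3 := est_letter est e gw.
  have [st x0] := xi_spec e.
  have := est_birkhoff est gw w5 st; rewrite x0 => /(_ (erefl _)).
  rewrite sc// ler_distl => /andP[h5 _].
  rewrite -EFinM lee_fin -expRD ler_expR -mulrN -mulrDr ler_wpM2l//.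
  apply: le_trans h5.
  rewrite -[c a1]/([:: e] ++ conn e ea ++ a1 ++ conn (last ea a) e).
  rewrite (_ : iter N.+1 theta w = iter N theta (iter 1 theta w)); last by rewrite -iterD addn1.
  move: h1 h2 h3 l1 l2 l3; rewrite /retC /=.
  move: (g (e :: _) w) (g (_ ++ _) (theta w)) (g (a1 ++ _) _) (g a1 _) (g (conn e ea) _) (g (conn (last ea a) e) _) (g [:: e] w) => *.
  lra.
- by move=> a; rewrite lee_fin expR_ge0.
Qed.

Section FullAlphabet.
Hypothesis T_ae : \forall w \ae P, Zgood T w.
Hypothesis L1i : intg (Lz T 1).
Local Notation p := (prate T).

(** The return sums are squeezed between [Z] at the same length and [Z] at a length shorter by
    [N.*2.+1] over a shifted base point; both grow at the rate [prate]. *)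
Lemma is_pressure_prate : is_pressure P theta Phi xi s (p%:E).
Proof.
have gr := growth_prate F0T T_ae L1i.
have gr' := ae_iter theta_meas theta_pres N.+1 gr.
move: (aeI (aeI gr gr') T_ae); apply: filterS => w [[h h'] Gw] e.
have gw := Gw.1.
have Gw' : Zgood T (iter N.+1 theta w).
  by elim: N.+1 => //= k; exact: (Zgood_theta est).
pose q n := fine (Q n e w).
have Qup n : (0 < n)%N -> (Q n e w <= (expR (s * K + Lz T n w))%:E)%E.
  move=> n0; apply: le_trans (Q_upper n e gw) _.
  by rewrite (Z_Lz est e0F0 conn_wt conn_F0 F0T s0 Gw n0) -EFinM -expRD.
have Qlow n : (0 < n)%N -> ((expR (- (s * retC e) + Lz T n (iter N.+1 theta w)))%:E <= Q (n + N.*2.+1) e w)%E.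
  move=> n0; apply: le_trans (Q_lower e gw n0).
  by rewrite (Z_Lz est e0F0 conn_wt conn_F0 F0T s0 Gw' n0) -EFinM -expRD.
have Qfin n : (N.*2.+1 < n)%N -> Q n e w = (q n)%:E /\ 0 < q n /\
   - (s * retC e) + Lz T (n - N.*2.+1) (iter N.+1 theta w) <= ln (q n) <= s * K + Lz T n w.
  move=> nN; have n0 : (0 < n)%N by clear -nN; lia.
  have up := Qup n n0.
  have n0' : (0 < n - N.*2.+1)%N by clear -nN; lia.
  have low := Qlow _ n0'; rewrite subnK in low; last exact: ltnW.
  have f : Q n e w \is a fin_num.
    rewrite ge0_fin_numE; first by apply: le_lt_trans up _; exact: ltry.
    by apply: le_trans low; rewrite lee_fin expR_ge0.
  have qe : Q n e w = (q n)%:E by rewrite /q fineK.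
  rewrite qe !lee_fin in up low.
  have q0 : 0 < q n by apply: lt_le_trans low; exact: expR_gt0.
  split=> //; split=> //.
  by rewrite -{1}[X in X <= ln _]expRK -[X in _ && (_ <= X)]expRK !ler_ln ?posrE ?expR_gt0// low.
apply: (@cvg_trans _ ((fun n => ((n%:R^-1 * ln (q n))%:E)) @ \oo)).
  apply: near_eq_cvg; exists N.*2.+2 => // n /= nN.
  by have [-> [q0 _]] := Qfin n nN; rewrite lne_EFin.
apply: cvg_EFin; first by exists 0%N.
apply/cvgrPdist_le => eps eps0.
have e4 : 0 < eps / 4 by rewrite divr_gt0.
have [n1 H1] := h _ e4; have [n2 H2] := h' _ e4.
pose C := `|s * K| + `|s * retC e| + `|p| * (N.*2.+1)%:R.
have [n3 H3] := eventually_le_mul C e4.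
exists (n1 + n2 + n3 + N.*2.+2)%N => // n /= nn.
have nR : 0 < n%:R :> R by rewrite ltr0n; clear -nn; lia.
have [|_ [_ /andP[k1 k2]]] := Qfin n; first by clear -nn; lia.
have {}H1 := H1 n ltac:(clear -nn; lia).
have {}H2 := H2 (n - N.*2.+1)%N ltac:(clear -nn; lia).
have {}H3 := H3 n ltac:(clear -nn; lia).
rewrite natrB in H2; last by clear -nn; lia.
rewrite -(ler_pM2r nR) -[X in _ * X <= _](gtr0_norm nR) -normrM mulrBl mulrAC mulVf ?gt_eqF// mul1r distrC.
exact: pressure_arith (ler0n _ _) (ltW eps0) H1 H2 H3 k1 k2.
Qed.

End FullAlphabet.

Local Notation M := (transfer_sup (ini := ini) (ter := ter) theta Phi s).

Lemma transfer_zeta e tau w : good w -> shift_space ini ter tau -> adm ini ter e (tau 0%N) ->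
  `|zeta theta Phi (scons e tau) w - g [:: e] w| <= K.
Proof.
move=> gw st ad.
have we : wt [:: e] (ini e) (ter e) by rewrite /= !eqxx.
have := est_birkhoff est gw we st (esym (eqP ad)).
by rewrite /birkhoff big_ord1.
Qed.

Lemma transfer_le_Z w : good w -> (M w <= (expR (s * K))%:E * Z T 1 w)%E.
Proof.
move=> gw; apply: ge_ereal_sup => _ [tau st <-].
rewrite -esumZ; [|exact: expR_gt0|by move=> a; rewrite lee_fin expR_ge0].
apply: (@esum_le_inj _ _ _ _ _ (fun e => [:: e])).
- by move=> e _; split.
- by move=> e e' _ _ [].
- move=> e ad; rewrite -EFinM lee_fin -expRD ler_expR -mulrDr ler_wpM2l//.
  by have := transfer_zeta gw st ad; rewrite ler_distl [K + _]addrC => /andP[].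
- by move=> a; rewrite mule_ge0// lee_fin expR_ge0.
Qed.

Lemma transfer_ge0 w : (0 <= M w)%E.
Proof.
apply: (@le_trans _ _ (\esum_(e in [set e | adm ini ter e (xi e0 0%N)])
    (expR (s * zeta theta Phi (scons e (xi e0)) w))%:E)%E).
  by apply: esum_ge0 => e _; rewrite lee_fin expR_ge0.
by apply: ereal_sup_ubound; exists (xi e0) => //; have [] := xi_spec e0.
Qed.

(** For a given sequence the transfer sum sees only the letters ending at one vertex; summing over
    the finite set [V] recovers all letters. *)
Lemma Z_le_transfer w : good w ->
  (Z T 1 w <= (#|V|%:R * expR (s * K))%:E * M w)%E.
Proof.
move=> gw.
have M0 := transfer_ge0 w.
apply: (@le_trans _ _ (\esum_(v in [set: V]) \esum_(e in [set e | ter e == v]) (expR (s * g [:: e] w))%:E)%E).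
  rewrite esum_esum; last by move=> v e _ _; rewrite lee_fin expR_ge0.
  apply: (@esum_le_inj _ _ _ _ _ (fun a => (ter (head e0 a), head e0 a))).
  - by move=> a _; split => //=.
  - move=> [|e [|? ?]] [|e' [|? ?]] [[]]//= _ _ _ [[]]//= _ _ _ [_ ->] //.
  - by move=> [|e [|? ?]] [[]].
  - by move=> [v e]; rewrite lee_fin expR_ge0.
apply: (@le_trans _ _ (\esum_(v in [set: V]) ((expR (s * K))%:E * M w))%E).
  apply: le_esum => v _.
  have [[e ev]|nov] := pselect (exists e, ter e == v); last first.
    rewrite esum1; last by move=> e ev; exfalso; apply: nov; exists e.
    by rewrite mule_ge0// lee_fin expR_ge0.
  (* A connector after a letter ending at [v] starts at [v], and so does the sequence [xi] attached
     to its first letter. *)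
  have [tau [st tv]] : exists tau, shift_space ini ter tau /\ ini (tau 0%N) = v.
    have wc := conn_wt e e; case ec : (conn e e) wc => [|e' c] wc.
      by have := conn_size e e; rewrite ec => h; move: N0; rewrite -h.
    have [st x0] := xi_spec e'; exists (xi e'); split=> //.
    by rewrite x0; move: wc => /= /andP[/eqP -> _]; exact/eqP.
  apply: (@le_trans _ _ ((expR (s * K))%:E * \esum_(e in [set e | adm ini ter e (tau 0%N)])
      (expR (s * zeta theta Phi (scons e tau) w))%:E)%E); last first.
    by apply: lee_wpmul2l; [rewrite lee_fin expR_ge0|apply: ereal_sup_ubound; exists tau].
  rewrite -esumZ; [|exact: expR_gt0|by move=> a; rewrite lee_fin expR_ge0].
  apply: (@esum_le_inj _ _ _ _ _ id) => //.
  - by move=> e1 /= /eqP e1v; rewrite /adm e1v tv.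
  - move=> e1 /= /eqP e1v; rewrite -EFinM lee_fin -expRD ler_expR -mulrDr ler_wpM2l//.
    have ad : adm ini ter e1 (tau 0%N) by rewrite /adm e1v tv.
    by have := transfer_zeta gw st ad; rewrite ler_distl lerBlDl => /andP[].
by rewrite esum_const ?mule_ge0 ?lee_fin ?expR_ge0// EFinM muleA.
Qed.

(* [er_map ln] agrees with [lne] on positive values, and its measurability is in
   the library; the added constant makes the maximum idle on good points. *)
Definition logZ F k w : \bar R := maxe (er_map (@ln R) (Z F k w) + (s * cF * k%:R)%:E)%E 0%E.

Lemma logZE F k w :
  logZ F k w = maxe (er_map (@ln R) (Z F k w) + (s * cF * k%:R)%:E)%E 0%E.
Proof. by []. Qed.

Lemma logZ_ge0 F k w : (0 <= logZ F k w)%E.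
Proof. by rewrite /logZ le_max lexx orbT. Qed.

Lemma measurable_logZ F k : measurable_fun [set: Omega] (logZ F k).
Proof.
apply: measurable_maxe; last exact: measurable_cst.
apply: emeasurable_funD; last exact: measurable_cst.
apply: (@measurableT_comp _ _ _ _ _ _ (er_map (@ln R))).
  by apply: (measurable_er_map Omega); exact: measurable_ln.
exact: (Z_measurable est e0).
Qed.

Lemma Z_gt0 w : good w -> (0 < Z T 1 w)%E.
Proof.
move=> gw; apply: lt_le_trans (Z_lower est e0F0 conn_wt conn_F0 F0T s0 gw (ltn0Sn 0)).
by rewrite lte_fin expR_gt0.
Qed.

Lemma er_map_ln (x : \bar R) : (0 < x)%E -> er_map (@ln R) x = lne x.
Proof. by case: x => [r| |]//; rewrite lte_fin => r0; rewrite lne_EFin. Qed.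

Let lneE (x y : \bar R) (c : R) : (0 < x)%E -> 0 < c -> (0 <= y)%E -> (x <= c%:E * y)%E ->
  (lne x <= (ln c)%:E + lne y)%E.
Proof.
move=> x0 c0 y0 xy.
have yp : (0 < y)%E.
  rewrite lt_neqAle y0 andbT eq_sym; apply/eqP => ye.
  by move: xy; rewrite ye mule0 leNgt x0.
have cy : (0 < c%:E * y)%E by rewrite mule_gt0.
rewrite -lne_EFin// -lneM ?in_itv/= ?lte_fin ?c0 ?yp ?leey//.
by rewrite lee_lne ?in_itv/= ?leey ?andbT// ltW.
Qed.

Let V0 : 0 < #|V|%:R :> R.
Proof. by rewrite ltr0n; apply/card_gt0P; exists (ini e0). Qed.

(** At good points [lne (M w)] and the logarithm of Z_1 differ by a bounded amount. Measurability of
    the former is not at hand, so each direction uses a comparison of lower integrals. *)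
Lemma integral_transfer :
  (\int[P]_w lne (M w) < +oo)%E <-> (\int[P]_w logZ T 1 w < +oo)%E.
Proof.
have Vc : 0 < #|V|%:R * expR (s * K) :> R by rewrite mulr_gt0// expR_gt0.
split => [h|h].
  rewrite ltNge; apply/negP; rewrite leye_eq => /eqP ly; move: h.
  pose c := `|ln (#|V|%:R * expR (s * K))| + s * cF.
  rewrite (@lower_integral_y _ _ _ P _ (logZ T 1) c) ?ltxx//.
  - exact: logZ_ge0.
  - exact: measurable_logZ.
  - move: (est_ae est); apply: filterS => w gw.
    have Zl := Z_lower est e0F0 conn_wt conn_F0 F0T s0 gw (ltn0Sn 0).
    rewrite mulr1 in Zl.
    have l1 : ((- (s * cF))%:E <= lne (Z T 1 w))%E.
      have -> : (- (s * cF))%:E = lne (expR (- (s * cF)))%:E.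
        by rewrite lne_EFin ?expR_gt0// expRK.
      by apply: le_lne => //; rewrite lte_fin expR_gt0.
    have l2 := lneE (Z_gt0 gw) Vc (transfer_ge0 w) (Z_le_transfer gw).
    have l3 : (lne (Z T 1 w) + (s * cF)%:E <= lne (M w) + c%:E)%E.
      apply: (@le_trans _ _ ((ln (#|V|%:R * expR (s * K)))%:E + lne (M w) + (s * cF)%:E)%E).
        by rewrite leeD2r.
      rewrite [((ln _)%:E + _)%E]addeC -addeA leeD2l//.
      by rewrite -EFinD lee_fin /c lerD2r ler_norm.
    have l4 : (0 <= lne (M w) + c%:E)%E.
      apply: le_trans l3; have := @leeD2r _ (s * cF)%:E _ _ l1.
      by rewrite -EFinD addNr.
    split; last by rewrite -[leLHS]add0e leeBlDr.
    by rewrite /logZ mulr1 er_map_ln ?Z_gt0// ge_max l3.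
apply: (@lower_integral_lty _ _ _ P _ (logZ T 1) (s * K)) => //.
- exact: logZ_ge0.
- exact: measurable_logZ.
- move: (est_ae est); apply: filterS => w gw.
  have [M0|M0] := leP (M w) 0%E.
    have -> : M w = 0%E by apply/eqP; rewrite eq_le M0 transfer_ge0.
    by rewrite le0_lneNy// leNye.
  have := lneE M0 (expR_gt0 _) (ltW (Z_gt0 gw)) (transfer_le_Z gw).
  rewrite expRK addeC => h'; apply: (le_trans h'); apply: leeD2r.
  rewrite /logZ mulr1 er_map_ln ?Z_gt0// le_max.
  by rewrite leeDl// lee_fin mulr_ge0// (cF_ge0 est).
Qed.

Lemma logZ_finite : (\int[P]_w logZ T 1 w < +oo)%E -> (\forall w \ae P, Zgood T w) /\ intg (Lz T 1).
Proof.
move=> li.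
have lint : P.-integrable setT (logZ T 1).
  apply/integrableP; split; first exact: measurable_logZ.
  by under eq_integral do rewrite gee0_abs ?logZ_ge0//.
have lae : \forall w \ae P, (logZ T 1 w < +oo)%E.
  have := integrable_ae measurableT lint.
  by apply: filterS => w /(_ I); rewrite ge0_fin_numE// logZ_ge0.
have Zae : \forall w \ae P, (Z T 1 w < +oo)%E.
  move: (est_ae est) lae; apply: filterS2 => w gw.
  rewrite !ltey; apply: contra => /eqP Zy.
  by rewrite /logZ mulr1 Zy /=; apply/eqP; rewrite max_l ?leey.
have Gae : \forall w \ae P, Zgood T w.
  have h : \forall w \ae P, forall j, (Z T 1 (iter j theta w) < +oo)%E.
    apply: ae_foralln => j.
    exact: (ae_iter theta_meas theta_pres (Q := fun w => (Z T 1 w < +oo)%E)).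
  by move: (est_ae est) h; apply: filterS2 => w gw h; split.
split=> //.
have [ci _] := @integral_cstP _ _ _ P (s * cF).
have hi := integrableD measurableT lint ci.
apply: (le_integrable measurableT _ _ hi).
  by apply/measurable_EFinP; exact: Lz_measurable.
move=> w _ /=.
have sc0 : 0 <= s * cF by rewrite mulr_ge0// (cF_ge0 est).
rewrite [leRHS]gee0_abs ?adde_ge0 ?logZ_ge0 ?lee_fin//.
have [Gw|nGw] := pselect (Zgood T w); last first.
  by rewrite Lz_out// normr0 adde_ge0 ?logZ_ge0 ?lee_fin.
have gw := Gw.1.
have e1 := Z_Lz est e0F0 conn_wt conn_F0 F0T s0 Gw (ltn0Sn 0).
have b1 := Lz_bound est e0F0 conn_wt conn_F0 F0T s0 Gw (ltn0Sn 0).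
rewrite mulr1 in b1.
have -> : logZ T 1 w = (Lz T 1 w + s * cF)%:E.
  rewrite /logZ mulr1 e1 /= expRK -EFinD; apply/max_idPl; rewrite lee_fin; lra.
rewrite -EFinD lee_fin ler_norml; apply/andP; split; lra.
Qed.

End PressureExists.

Lemma finite_words (E : choiceType) (F : set E) n : finite_set F ->
  finite_set [set a : seq E | size a = n /\ forall e, e \in a -> F e].
Proof.
move=> finF; elim: n => [|n IH].
  by apply: sub_finite_set (finite_set1 [::]) => a [/size0nil].
apply: sub_finite_set (finite_image2 cons finF IH) => -[[]//|e a [[sa] aF]].
exists e; first by apply: aF; rewrite inE eqxx.
by exists a => //; split=> // x xa; apply: aF; rewrite inE xa orbT.
Qed.

(** The bound, the cardinality of [A], does not depend on the weights; partition functions over a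
    finite alphabet thus get a bound uniform in the base point. *)
Lemma esum_finite_le (R : realType) (I : choiceType) (A : set I) : finite_set A ->
  exists2 M : R, 0 <= M & forall a : I -> \bar R, (forall i, A i -> (0 <= a i <= 1)%E) ->
    (\esum_(i in A) a i <= M%:E)%E.
Proof.
move=> finA; exists (\sum_(i <- finmap.enum_fset (fset_set A)) 1).
  by apply: sumr_ge0.
move=> a a01; rewrite esum_fset//; last by move=> i /set_mem/a01/andP[].
rewrite fsbig_finite// -sumEFin big_seq [leRHS]big_seq.
by apply: lee_sum => i; rewrite in_fset_set// => /set_mem/a01/andP[].
Qed.

(** * Finite alphabets and the sign of the pressure *)

Section PressureFacts.
Context {disp : measure_display} {Omega : measurableType disp} {R : realType}
  {d : nat} {V : finType} {E : countType} {ini ter : E -> V}.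
Variables (P : probability Omega R) (theta : Omega -> Omega).
Variable Phi : rgdms Omega R d ini ter.
Variables (good : set Omega) (g : seq E -> Omega -> R) (K kp : R) (mm : E -> R).
Hypothesis est : sys_est P theta Phi good g K kp mm.
Hypothesis P_complete : measure_is_complete P.
Hypothesis theta_meas : measurable_fun [set: Omega] theta.
Hypothesis theta_pres : measure_preserving P theta.
Hypothesis theta_erg : ergodic P theta.
Variables (e0 : E) (N : nat) (conn : E -> E -> seq E) (F0 : seq E).
Hypothesis N0 : (0 < N)%N.
Hypothesis e0F0 : e0 \in F0.
Hypothesis conn_size : forall e e', size (conn e e') = N.
Hypothesis conn_wt : forall e e', wt ini ter (conn e e') (ter e) (ini e').
Hypothesis conn_F0 : forall e e' x, x \in conn e e' -> x \in F0.
Variable xi : E -> nat -> E.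
Hypothesis xi_spec : forall e, shift_space ini ter (xi e) /\ xi e 0%N = e.

Local Notation wt := (wt ini ter).
Local Notation Z F s := (@Z _ Omega R V E ini ter g F s).
Local Notation Zgood F s := (@Zgood _ Omega R V E ini ter theta good g F s).
Local Notation Lz F s := (@Lz _ Omega R V E ini ter theta good g F s).
Local Notation meanL F s := (@meanL _ Omega R V E ini ter P theta good g s F).
Local Notation prate F s := (@prate _ Omega R V E ini ter P theta good g K s F).
Local Notation logZ s := (@logZ _ Omega R V E ini ter g K mm F0 s).
Local Notation lwords := (@lwords V E ini ter).
Local Notation cF := (cF K mm F0).
Local Notation gapC := (gapC K mm N F0).
Local Notation T := [set: E].
Local Notation intg f := (P.-integrable [set: Omega] (EFin \o f)).
Let F0T : forall e : E, e \in F0 -> T e. Proof. by []. Qed.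

(** Finite alphabets that exhaust [E]; each contains [F0], so connecting words are always
    available. *)
Definition alph j : set E := [set e | (pickle e < j)%N \/ e \in F0].

Lemma finite_alph j : finite_set (alph j).
Proof.
apply: (@sub_finite_set _ _ (pickle @^-1` [set i | (i < j)%N] `|` [set` F0])).
  by move=> e [h|h]; [left|right].
rewrite finite_setU; split; last exact: finite_seq.
apply: finite_preimage; first by move=> x y _ _; exact: (pcan_inj pickleK).
exact: finite_II.
Qed.

Lemma F0_alph j e : e \in F0 -> alph j e. Proof. by right. Qed.

Lemma g_le0 F n a w : good w -> lwords F n a -> g a w <= 0.
Proof.
move=> gw [aw _]; have [u [v wa]] := words_wt e0 aw.
apply: le_trans (est_ub est gw wa) _.
by rewrite mulNr oppr_le0 mulr_ge0// ltW// (est_kp est).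
Qed.

Section FixedExponent.
Variable s : R.
Hypothesis s0 : 0 <= s.

Lemma finite_lwords F n : finite_set F -> finite_set (lwords F n).
Proof. by move=> /(finite_words n); apply: sub_finite_set => a [[]]. Qed.

Lemma Z_finite_alph F n : finite_set F -> exists2 M : R, 0 <= M &
  forall w, good w -> (Z F s n w <= M%:E)%E.
Proof.
move=> /(finite_lwords n)/(@esum_finite_le R)[M M0 HM]; exists M => // w gw.
apply: HM => a la; rewrite !lee_fin expR_ge0/= -expR0 ler_expR.
by rewrite mulr_ge0_le0// (g_le0 gw la).
Qed.

Let good_iter n w : good w -> good (iter n theta w).
Proof. by elim: n => //= n IH /IH h; exact: (est_theta est h). Qed.

Lemma Zgood_finite F w : finite_set F -> good w -> Zgood F s w.
Proof.
move=> fF gw; split=> // j; have [M M0 HM] := Z_finite_alph 1 fF.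
by apply: (@le_lt_trans _ _ M%:E); [exact/HM/good_iter|exact: ltry].
Qed.

Lemma Z_pos F n w : (forall e, e \in F0 -> F e) -> (0 < Z F s n w)%E.
Proof.
move=> F0F; have [a [u [v [sa wa aF]]]] := F0_words e0F0 conn_wt conn_F0 n.
have la : lwords F n a by split; [split=> //; exact: wt_sorted wa|move=> e /aF/F0F].
apply: lt_le_trans (esum_gt0_ge (a := fun a => (expR (s * g a w))%:E) la _).
  by rewrite lte_fin expR_gt0.
by move=> b; rewrite lee_fin expR_ge0.
Qed.

Lemma Lz_integrable_finite F n : finite_set F -> (forall e, e \in F0 -> F e) ->
  (0 < n)%N -> intg (Lz F s n).
Proof.
move=> fF F0F n0; have [M M0 HM] := Z_finite_alph n fF.
have Fae : \forall w \ae P, Zgood F s w.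
  by move: (est_ae est); apply: filterS => w; exact: Zgood_finite.
have [ki _] := @integral_cstP _ _ _ P (`|ln M| + s * cF * n%:R).
apply: (le_integrable measurableT _ _ ki).
  by apply/measurable_EFinP; exact: (Lz_measurable est P_complete e0 Fae).
move=> w _ /=; rewrite lee_fin.
have c0 : 0 <= s * cF * n%:R by rewrite !mulr_ge0// (cF_ge0 est).
rewrite [leRHS]ger0_norm ?addr_ge0//.
have [Gw|nGw] := pselect (Zgood F s w); last first.
  by rewrite Lz_out// normr0 addr_ge0.
have e1 := Z_Lz est e0F0 conn_wt conn_F0 F0F s0 Gw n0.
have b1 := Lz_bound est e0F0 conn_wt conn_F0 F0F s0 Gw n0.
have := HM _ Gw.1; rewrite e1 lee_fin => b2.
have Mp : 0 < M by apply: lt_le_trans b2; exact: expR_gt0.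
have b3 : Lz F s n w <= ln M by rewrite -[leLHS]expRK ler_ln ?posrE ?expR_gt0.
have b4 := ler_norm (ln M); have b5 := normr_ge0 (ln M).
rewrite mulNr in b1.
by rewrite ler_norml; apply/andP; split; lra.
Qed.

Lemma logZ_mono F F' k w : (forall e, e \in F0 -> F e) -> F `<=` F' ->
  (logZ s F k w <= logZ s F' k w)%E.
Proof.
move=> F0F FF'; rewrite !logZE.
have F0F' e : e \in F0 -> F' e by move=> /F0F/FF'.
have zz : (Z F s k w <= Z F' s k w)%E.
  by apply: esum_subset => [a [aw aF]|a]; [split=> // e /aF/FF'|rewrite lee_fin expR_ge0].
rewrite !er_map_ln ?Z_pos//.
have zl : (lne (Z F s k w) <= lne (Z F' s k w))%E by rewrite le_lne// Z_pos.
rewrite ge_max le_max leeD2r//=.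
by rewrite le_max lexx orbT.
Qed.

Lemma logZ_Lz F k w : (forall e, e \in F0 -> F e) -> (0 < k)%N -> Zgood F s w ->
  logZ s F k w = (Lz F s k w + s * cF * k%:R)%:E.
Proof.
move=> F0F k0 Gw.
have e1 := Z_Lz est e0F0 conn_wt conn_F0 F0F s0 Gw k0.
have b1 := Lz_bound est e0F0 conn_wt conn_F0 F0F s0 Gw k0.
rewrite !logZE e1 /= expRK -EFinD; apply/max_idPl; rewrite lee_fin; lra.
Qed.

Lemma integral_logZ F k : (forall e, e \in F0 -> F e) -> (0 < k)%N ->
  (\forall w \ae P, Zgood F s w) -> intg (Lz F s k) ->
  (\int[P]_w logZ s F k w = (meanL F s k + s * cF * k%:R)%:E)%E.
Proof.
move=> F0F k0 Fae Li.
have [ki ke] := @integral_cstP _ _ _ P (s * cF * k%:R).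
have [_ <-] := integralD_cst (s * cF * k%:R) Li (meanLE Li).
apply: (@ae_eq_integral _ _ _ _ _ (fun w => (Lz F s k w + s * cF * k%:R)%:E)) => //.
- exact: (measurable_logZ est e0).
- apply/measurable_EFinP; apply: measurable_funD; last exact: measurable_cst.
  exact: (Lz_measurable est P_complete e0 Fae).
- by move: Fae; apply: filterS => w Gw _; exact: logZ_Lz.
Qed.

(** A finite partial sum of [Z] involves finitely many letters and hence lives over a single
    [alph j]. *)
Lemma logZ_sup k w : (0 < k)%N ->
  (logZ s T k w <= ereal_sup (range (fun j => logZ s (alph j) k w)))%E.
Proof.
move=> k0; set S := ereal_sup _.
have ub j : (logZ s (alph j) k w <= S)%E by apply: ereal_sup_ubound; exists j.
have S0 : (0 <= S)%E by apply: le_trans (ub 0%N); exact: logZ_ge0.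
rewrite !logZE ge_max S0 andbT.
case ES : S S0 ub => [b| |]// S0 ub; last by rewrite leey.
rewrite er_map_ln; last exact: Z_pos.
rewrite -leeBrDr// -EFinB.
have Zj j : (Z (alph j) s k w <= (expR (b - s * cF * k%:R))%:E)%E.
  have := ub j; rewrite !logZE ge_max => /andP[+ _].
  rewrite er_map_ln ?Z_pos//; last exact: F0_alph.
  rewrite -leeBrDr// -EFinB => h.
  have Zp : (0 < Z (alph j) s k w)%E by apply: Z_pos; exact: F0_alph.
  rewrite -[leLHS]lneK; last by rewrite in_itv /= leey ltW.
  by rewrite -[leRHS]/(expeR (b - s * cF * k%:R)%:E) lee_expeR.
have ZT : (Z T s k w <= (expR (b - s * cF * k%:R))%:E)%E.
  apply: ge_ereal_sup => _ [X [finX XA] <-].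
  have [j Hj] : exists j, forall a, X a -> lwords (alph j) k a.
    have [sX eX] := (finite_seqP X).1 finX.
    exists (\max_(a <- sX) \max_(e <- a) (pickle e).+1)%N => a Xa.
    split; first by have [] := XA _ Xa.
    move=> e ea; left; have aX : a \in sX by move: Xa; rewrite eX.
    apply: (@leq_trans (\max_(e <- a) (pickle e).+1)).
      exact: (leq_bigmax_seq (F := fun e => (pickle e).+1) e ea).
    exact: (leq_bigmax_seq (F := fun a => \max_(e <- a) (pickle e).+1) a aX).
  apply: le_trans (Zj j); apply: esum_ge; exists X => //; by split.
rewrite -[leRHS]/(er_map id _%:E) -[X in er_map id X%:E]expRK /= -lne_EFin ?expR_gt0//.
by rewrite le_lne// Z_pos.
Qed.

Lemma finite_approx k (t : R) : (0 < k)%N -> (t%:E < \int[P]_w logZ s T k w)%E ->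
  exists j, t < meanL (alph j) s k + s * cF * k%:R.
Proof.
move=> k0 tT.
have := @cvg_monotone_convergence _ _ _ P _ measurableT (fun j => logZ s (alph j) k)
  (fun j => measurable_logZ est e0 F0 s (alph j) k) (fun j w _ => logZ_ge0 _ _ _ _ _ _ _ _) _.
have nd : forall w, [set: Omega] w -> {homo (fun j => logZ s (alph j) k w) : n m / (n <= m)%N >-> (n <= m)%E}.
  move=> w _ j j' jj'; apply: logZ_mono; first exact: F0_alph.
  by move=> e [h|h]; [left; exact: leq_trans h jj'|right].
move=> /(_ nd).
have lim_ge : (\int[P]_w logZ s T k w <= \int[P]_w (fun w => limn (fun j => logZ s (alph j) k w)) w)%E.
  apply: ge0_le_integral => //.
  - by move=> w _; exact: logZ_ge0.
  - exact: (measurable_logZ est e0).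
  - apply: (emeasurable_fun_cvg (fun j => logZ s (alph j) k)) => [j|w _].
      exact: (measurable_logZ est e0).
    by apply: (cvgP (ereal_sup (range (fun j => logZ s (alph j) k w)))); apply: ereal_nondecreasing_cvgn; exact: nd.
  - move=> w _; rewrite (cvg_lim _ (ereal_nondecreasing_cvgn (nd w I)))//.
    exact: logZ_sup.
have := lt_le_trans tT lim_ge; set I := (\int[P]_w _)%E => tI.
move=> /(_ [set x | (t%:E < x)%E]) [].
  by apply: open_nbhs_nbhs; split=> //; exact: open_ereal_gt_ereal.
move=> j _ /(_ j (leqnn j)) /=.
rewrite integral_logZ ?lte_fin//; first by move=> h; exists j.
- exact: F0_alph.
- by move: (est_ae est); apply: filterS => w; apply: Zgood_finite; exact: finite_alph.
- by apply: Lz_integrable_finite => //; [exact: finite_alph|exact: F0_alph].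
Qed.

End FixedExponent.

Local Notation M s := (transfer_sup (ini := ini) (ter := ter) theta Phi s).
Local Notation pressure s := (pressure P theta Phi xi s).

Lemma ae_exists (Q : Omega -> Prop) : (\forall w \ae P, Q w) -> exists w, Q w.
Proof.
move=> h; have PF : ProperFilter (almost_everywhere P).
  by apply: ae_properfilter_algebraOfSetsType; rewrite [X in (_ < X)%E]probability_setT.
by have [w Qw] := @filter_ex _ _ PF _ h; exists w.
Qed.

Lemma is_pressure_unique s p q : is_pressure P theta Phi xi s p ->
  is_pressure P theta Phi xi s q -> p = q.
Proof.
move=> hp hq; have [w [h1 h2]] := ae_exists (aeI hp hq).
by apply: cvg_unique (h1 e0) (h2 e0); exact: ereal_hausdorff.
Qed.

(** [pressure] is defined through [get], so its value is identified by uniqueness of the almost sure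
    limit. *)
Lemma pressureE s : 0 <= s -> (\int[P]_w lne (M s w) < +oo)%E ->
  [/\ \forall w \ae P, Zgood T s w, intg (Lz T s 1) & pressure s = (prate T s)%:E].
Proof.
move=> s0 h.
have li := (integral_transfer est P_complete N0 e0F0 conn_size conn_wt conn_F0 s0 xi_spec).1 h.
have [Tae L1i] := logZ_finite est P_complete theta_meas theta_pres e0F0 conn_wt conn_F0 s0 li.
split=> //; rewrite /Defs.pressure h.
have ip := is_pressure_prate est P_complete theta_meas theta_pres theta_erg N0 e0F0 conn_size
  conn_wt conn_F0 s0 xi_spec Tae L1i.
by have := getI ip; move=> ig; apply: is_pressure_unique ig ip.
Qed.

(* The case [pressure s = +oo], where [log Z_1] is not integrable, is covered by the
   same finite approximation with [k = 1]. *)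
Lemma pressure_gt0 s : 0 <= s -> (0 < pressure s)%E ->
  exists2 sF : seq E, {subset F0 <= sF} & \forall w \ae P, exists2 c : R, 0 < c &
    forall n, (c%:E <= Z [set` sF] s n.+1 w)%E.
Proof.
move=> s0 p0.
(* The mean of the logarithm of Z_k has to exceed the gap cost [s * gapC]; the term [s * cF * k%:R]
   is the shift built into [logZ]. A positive rate achieves this for large [k]. *)
have [k k0 kt] : exists2 k, (0 < k)%N & ((s * gapC + s * cF * k%:R)%:E < \int[P]_w logZ s T k w)%E.
  have [h|h] := boolP (\int[P]_w lne (M s w) < +oo)%E; last first.
    exists 1%N => //; rewrite ltNge; apply/negP => li.
    move/negP: h; apply.
    apply/(integral_transfer est P_complete N0 e0F0 conn_size conn_wt conn_F0 s0 xi_spec).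
    exact: le_lt_trans li (ltry _).
  have [Tae L1i pe] := pressureE s0 h.
  move: p0; rewrite pe lte_fin => p0.
  have [k k0 kp'] : exists2 k, (0 < k)%N & s * K + s * gapC < prate T s * k%:R.
    have [n Hn] := eventually_le_mul (s * K + s * gapC + 1) p0.
    exists n.+1 => //; have := Hn n.+1 (leqnSn n); lra.
  exists k => //; rewrite (integral_logZ s0 F0T k0 Tae) ?lte_fin ?ltrD2r.
    have := prate_le est P_complete theta_meas theta_pres e0F0 conn_wt conn_F0 s0 F0T Tae L1i k0.
    lra.
  exact: (Lz_integrable est P_complete theta_meas theta_pres e0F0 conn_wt conn_F0 s0 F0T Tae L1i k0).
have [j Hj] := finite_approx s0 k0 kt.
have [sF sFE] := (finite_seqP _).1 (finite_alph j).
exists sF; first by move=> e /(@F0_alph j); rewrite sFE.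
rewrite -sFE.
have Fae : \forall w \ae P, Zgood (alph j) s w.
  by move: (est_ae est); apply: filterS => w; apply: (Zgood_finite s0); exact: finite_alph.
have Lki : intg (Lz (alph j) s k).
  by apply: Lz_integrable_finite => //; [exact: finite_alph|exact: F0_alph].
have kB : s * gapC < meanL (alph j) s k by lra.
have [c c0 Hc] := finite_growth est theta_meas theta_pres theta_erg N0 e0F0 conn_size conn_wt conn_F0
   s0 (@F0_alph j) Fae k0 Lki kB.
move: Hc Fae; apply: filterS2 => w [n0 Hn] Gw.
have scF : 0 <= s * cF by rewrite mulr_ge0// (cF_ge0 est).
(* Lengths below [n0] are covered by the crude exponential lower bound; for the others [Z] is at
   least 1. *)
exists (expR (- (s * cF) * n0%:R)); first exact: expR_gt0.
move=> n; have [nn|nn] := leqP n0 n.+1.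
  rewrite (Z_Lz est e0F0 conn_wt conn_F0 (@F0_alph j) s0 Gw (ltn0Sn n)) lee_fin ler_expR.
  apply: (le_trans _ (Hn _ nn)); apply: (@le_trans _ _ 0); last by rewrite mulr_ge0// ltW.
  by rewrite mulNr oppr_le0 mulr_ge0.
apply: le_trans (Z_lower est e0F0 conn_wt conn_F0 (@F0_alph j) s0 Gw.1 (ltn0Sn n)).
by rewrite lee_fin ler_expR !mulNr lerN2 ler_wpM2l// ler_nat ltnW.
Qed.

(** Raising the exponent from [s] to [s'] multiplies the weight of a word of length [n] by at most
    [expR (- ((s' - s) * kp) * n%:R)], which beats the subexponential growth left by a nonpositive
    rate. *)
Lemma pressure_le0 s s' : 0 <= s -> s < s' -> (pressure s <= 0)%E ->
  \forall w \ae P, forall eps : R, 0 < eps -> exists n, (Z T s' n.+1 w <= eps%:E)%E.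
Proof.
move=> s0 ss' p0.
have h : (\int[P]_w lne (M s w) < +oo)%E.
  by move: p0; rewrite /Defs.pressure; case: ifP => // _; rewrite leye_eq.
have [Tae L1i pe] := pressureE s0 h.
move: p0; rewrite pe lee_fin => p0.
have gr := growth_prate est P_complete theta_meas theta_pres theta_erg N0 e0F0 conn_size
  conn_wt conn_F0 s0 F0T Tae L1i.
pose r := (s' - s) * kp.
have r0 : 0 < r by rewrite mulr_gt0 ?subr_gt0// (est_kp est).
have r2 : 0 < r / 2 by rewrite divr_gt0.
move: gr Tae; apply: filterS2 => w /(_ _ r2)[n0 Hn] Gw eps eps0.
have [n1 Hn1] := eventually_le_mul (- ln eps) r2.
exists (n0 + n1)%N; set n := (n0 + n1)%N.+1.
have {}Hn := Hn n ltac:(rewrite /n; clear; lia).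
have {}Hn1 := Hn1 n ltac:(rewrite /n; clear; lia).
apply: (@le_trans _ _ ((expR (- r * n%:R))%:E * Z T s n w)%E).
  rewrite -esumZ; [|exact: expR_gt0|by move=> a; rewrite lee_fin expR_ge0].
  apply: le_esum => a [aw _]; have [u [v wa]] := words_wt e0 aw.
  rewrite -EFinM lee_fin -expRD ler_expR.
  have := est_ub est Gw.1 wa; rewrite aw.1 => gu.
  have sd : 0 <= s' - s by rewrite subr_ge0 ltW.
  have := ler_wpM2l sd gu; rewrite /r; lra.
rewrite (Z_Lz est e0F0 conn_wt conn_F0 F0T s0 Gw (ltn0Sn _)) -EFinM lee_fin -expRD.
rewrite -[leRHS]lnK ?posrE// ler_expR.
move: Hn; rewrite ler_distl => /andP[_ Hn].
have pn : prate T s * n%:R <= 0 by rewrite mulr_le0_ge0.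
lra.
Qed.

End PressureFacts.

(** * Hausdorff measure and the upper bound *)

Section HausdorffBasics.
Context {R : realType} {d : nat}.
Implicit Types (U A : set 'rV[R]_d) (s : R).
Local Notation gauge := (@hausdorff_gauge R d).

Lemma gauge_ge0 s U : (0 <= gauge s U)%E.
Proof. by rewrite /hausdorff_gauge; case: ifP => // _; exact: poweR_ge0. Qed.

Lemma ediam_le U (r : R) : (forall x y, U x -> U y -> enorm (x - y) <= r) ->
  (ediam U <= r%:E)%E.
Proof. by move=> h; apply: ge_ereal_sup => _ [[x y] [/= Ux Uy] <-]; rewrite lee_fin h. Qed.

Lemma ediam_ge U x y : U x -> U y -> ((enorm (x - y))%:E <= ediam U)%E.
Proof. by move=> Ux Uy; apply: ereal_sup_ubound; exists (x, y). Qed.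

Lemma ediam_ge0 U : U !=set0 -> (0 <= ediam U)%E.
Proof.
move=> [x Ux]; apply: le_trans (ediam_ge Ux Ux); rewrite lee_fin; exact: enorm_ge0.
Qed.

Lemma gauge_le s U (r : R) : 0 <= s -> 0 <= r ->
  (forall x y, U x -> U y -> enorm (x - y) <= r) -> (gauge s U <= (r `^ s)%:E)%E.
Proof.
move=> s0 r0 h; rewrite /hausdorff_gauge; case: ifPn => [_|/set0P U0].
  by rewrite lee_fin powR_ge0.
have dr := ediam_le h; have d0 := ediam_ge0 U0.
rewrite -poweR_EFin; apply: gt0_ler_poweR => //.
  by rewrite in_itv /= d0 leey.
by rewrite in_itv /= lee_fin r0 leey.
Qed.

Lemma gauge_set0 s : gauge s set0 = 0%E.
Proof. by rewrite /hausdorff_gauge eqxx. Qed.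

Lemma hausdorff_measure_ge0 s A : (0 <= hausdorff_measure s A)%E.
Proof.
apply: (@le_trans _ _ (hausdorff_premeasure s 1 A)); last first.
  by apply: ereal_sup_ubound; exists 1 => //=; exact: ltr01.
apply: le_ereal_inf_tmp => _ [U _ <-].
by apply: nneseries_ge0 => n _ _; exact: gauge_ge0.
Qed.

(** Covers may be indexed by any countable type; codes without an index receive the empty set, whose
    gauge is 0. *)
Lemma hausdorff_measure_eq0 s A (I : countType) : 0 < s ->
  (forall delta eps : R, 0 < delta -> 0 < eps ->
    exists (D : set I) (U : I -> set 'rV[R]_d) (r : I -> R),
    [/\ A `<=` \bigcup_(i in D) U i, forall i, 0 <= r i,
        forall i, D i -> r i <= delta,
        forall i x y, D i -> U i x -> U i y -> enorm (x - y) <= r i &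
        (\esum_(i in D) (r i `^ s)%:E <= eps%:E)%E]) ->
  hausdorff_measure s A = 0%E.
Proof.
move=> s0 H; have s0' := ltW s0.
apply/eqP; rewrite eq_le hausdorff_measure_ge0 andbT.
apply: ge_ereal_sup => _ [delta /= d0 <-].
apply/lee_addgt0Pr => eps eps0; rewrite add0e.
have [D [U [r [AU r0 rd Ur re]]]] := H delta eps d0 eps0.
pose U' k := if pickle_inv k is Some i then (if i \in D then U i else set0) else set0.
apply: (@le_trans _ _ (\sum_(0 <= k <oo) gauge s (U' k))%E).
  apply: ereal_inf_lbound; exists U' => //; split.
    move=> x /AU[i Di Ux]; exists (pickle i) => //.
    by rewrite /U' pickleK_inv mem_set.
  move=> k; apply: ediam_le => x y; rewrite /U'.
  case: (pickle_inv k) => [i|//]; case: ifPn => // /set_mem Di Ux Uy.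
  exact: le_trans (Ur i x y Di Ux Uy) (rd i Di).
rewrite nneseries_esum; last by move=> n _; exact: gauge_ge0.
apply: le_trans re.
have [[i0 Di0]|nD] := pselect (exists i, D i); last first.
  rewrite esum1; first by apply: esum_ge0 => i _; rewrite lee_fin powR_ge0.
  move=> k _; rewrite /U'; case: (pickle_inv k) => [i|]; last by rewrite gauge_set0.
  by rewrite memNset ?gauge_set0// => Di; apply: nD; exists i.
pose B := [set k : nat | exists2 i, D i & k = pickle i].
apply: (@le_trans _ _ (\esum_(k in B) gauge s (U' k))%E).
  rewrite [leRHS]esum_mkcond (esum_mkcond [set x | true]); apply: le_esum => k _.
  rewrite mem_set//; case: ifPn => // /negP kB.
  rewrite /U'; case ek : (pickle_inv k) => [i|]; last by rewrite gauge_set0.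
  case: ifPn => [/set_mem Di|]; last by rewrite gauge_set0.
  exfalso; apply: kB; apply/mem_set; exists i => //.
  by have := @pickle_invK I k; rewrite ek.
apply: (@esum_le_inj _ _ _ _ _ (fun k => odflt i0 (pickle_inv k))).
- by move=> _ [i Di ->]; rewrite pickleK_inv.
- by move=> _ _ [i Di ->] [j Dj ->]; rewrite !pickleK_inv /= => ->.
- move=> _ [i Di ->]; rewrite /U' pickleK_inv mem_set//=; apply: gauge_le => // x y.
  exact: Ur.
- by move=> i; rewrite lee_fin powR_ge0.
Qed.

End HausdorffBasics.

Section UpperBound.
Context {disp : measure_display} {Omega : measurableType disp} {R : realType}
  {d : nat} {V : finType} {E : countType} {ini ter : E -> V}.
Variables (P : probability Omega R) (theta : Omega -> Omega).
Variable Phi : rgdms Omega R d ini ter.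
Variables (good : set Omega) (g : seq E -> Omega -> R) (K kp : R) (mm : E -> R).
Hypothesis est : sys_est P theta Phi good g K kp mm.
Local Notation Z F s := (@Z _ Omega R V E ini ter g F s).

Lemma limit_set_null s w : good w -> 0 < s ->
  (forall eps : R, 0 < eps -> exists n, (Z [set: E] s n.+1 w <= eps%:E)%E) ->
  hausdorff_measure s (limit_set theta Phi w) = 0%E.
Proof.
move=> gw s0 HZ; have [C [N [C0 HC]]] := est_cover est.
have [U [Ud Uc]] := HC w gw.
apply: (@hausdorff_measure_eq0 _ _ _ _ (seq E * 'I_N)%type) => // delta eps d0 eps0.
(* The first cap bounds every single term and hence every diameter, the second bounds the sum over
   all pieces. [N.+1] avoids a division by 0. *)
pose e1 : R := Num.min ((delta / C) `^ s) (eps / (C `^ s * N.+1%:R)).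
have CN : 0 < C `^ s * N.+1%:R by rewrite mulr_gt0// powR_gt0.
have e10 : 0 < e1 by rewrite lt_min powR_gt0 ?divr_gt0.
have [n Hn] := HZ _ e10.
pose D := [set p : seq E * 'I_N | words ini ter n.+1 p.1].
exists D, (fun p => U p.1 p.2), (fun p => C * expR (g p.1 w)); split.
- by move=> x /(Uc n)[a wa [i _ Ux]]; exists (a, i).
- by move=> p; rewrite mulr_ge0 ?expR_ge0// ltW.
- move=> [a i] /= wa.
  rewrite mulrC -ler_pdivlMr//.
  have la : lwords (ini := ini) (ter := ter) [set: E] n.+1 a by [].
  have := le_trans (esum_gt0_ge (a := fun a => (expR (s * g a w))%:E) la _) Hn.
  move=> /(_ (fun b => expR_ge0 _)); rewrite lee_fin => h.
  have : expR (s * g a w) <= (delta / C) `^ s.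
    by apply: le_trans h _; rewrite ge_min lexx.
  rewrite mulrC expRM => h2.
  have := @ge0_ler_powR R s^-1 _ (expR (g a w) `^ s) ((delta / C) `^ s).
  rewrite invr_ge0 (ltW s0) => /(_ isT); rewrite !nnegrE !powR_ge0 => /(_ isT isT h2).
  by rewrite -!powRrM mulfV ?gt_eqF// !powRr1 ?expR_ge0// divr_ge0// ltW.
- by move=> [[|e b] i] x y /= [sa _]//; exact: Ud.
have pE (p : seq E * 'I_N) : ((C * expR (g p.1 w)) `^ s)%:E = ((C `^ s)%:E * (expR (s * g p.1 w))%:E)%E.
  by rewrite -EFinM powRM ?expR_ge0 ?(ltW C0)// [s * _]mulrC expRM.
rewrite (eq_esum (fun p _ => pE p)) esumZ; [|exact: powR_gt0|by move=> p; rewrite lee_fin expR_ge0].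
apply: (@le_trans _ _ ((C `^ s)%:E * \esum_(i in [set: 'I_N]) Z [set: E] s n.+1 w)%E).
  apply: lee_wpmul2l; first by rewrite lee_fin powR_ge0.
  rewrite esum_esum; last by move=> i a _ _; rewrite lee_fin expR_ge0.
  apply: (@esum_le_inj _ _ _ _ _ (fun p : seq E * 'I_N => (p.2, p.1))).
  - by move=> [a i] wa; split.
  - by move=> [a i] [a' i'] _ _ /= [-> ->].
  - by move=> p _; exact: lexx.
  - by move=> p; rewrite lee_fin expR_ge0.
apply: (@le_trans _ _ ((C `^ s)%:E * \esum_(i in [set: 'I_N]) e1%:E)%E).
  by apply: lee_wpmul2l; [rewrite lee_fin powR_ge0|apply: le_esum].
rewrite esum_const; last by rewrite lee_fin ltW.
rewrite card_ord -!EFinM lee_fin.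
have : e1 * (C `^ s * N.+1%:R) <= eps.
  by rewrite -ler_pdivlMr// ge_min lexx orbT.
have : C `^ s * e1 * N%:R <= C `^ s * e1 * N.+1%:R.
  by rewrite ler_wpM2l ?ler_nat// mulr_ge0 ?powR_ge0// ltW.
lra.
Qed.

End UpperBound.

(** A one-point set has gauge 0, but the stopping rule needs positive radii. Adding a summable
    positive amount to each gauge and taking the root of order [s] provides them. *)
Lemma null_cover (R : realType) (d : nat) (A : set 'rV[R]_d) (s eps : R) : 0 < s -> 0 < eps ->
  hausdorff_measure s A = 0%E ->
  exists (U : nat -> set 'rV[R]_d) (r : nat -> R),
    [/\ A `<=` \bigcup_k U k, forall k, 0 < r k,
        forall k x y, U k x -> U k y -> enorm (x - y) <= r k &
        (\esum_(k in [set: nat]) (r k `^ s)%:E <= eps%:E)%E].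
Proof.
move=> s0 eps0 HA; have e20 : 0 < eps / 2 by rewrite divr_gt0.
have : (hausdorff_premeasure s 1 A < (eps / 2)%:E)%E.
  apply: (@le_lt_trans _ _ 0%E); last by rewrite lte_fin.
  by rewrite -HA; apply: ereal_sup_ubound; exists 1 => //=; exact: ltr01.
move=> /ereal_inf_lt[_ [U [AU Ud] <-]] Ue.
have ge0 k : (0 <= hausdorff_gauge s (U k))%E by exact: gauge_ge0.
have Se : (\sum_(0 <= k <oo) hausdorff_gauge s (U k) =
    \esum_(k in [set: nat]) hausdorff_gauge s (U k))%E.
  by rewrite nneseries_esum//; congr esum; apply/seteqP; split.
have gfin k : hausdorff_gauge s (U k) = (fine (hausdorff_gauge s (U k)))%:E.
  rewrite fineK// ge0_fin_numE//; apply: (@le_lt_trans _ _ (eps / 2)%:E); last exact: ltry.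
  apply: le_trans (ltW Ue); rewrite Se.
  exact: (@esum_gt0_ge _ _ _ (fun k => hausdorff_gauge s (U k))).
pose ga k := fine (hausdorff_gauge s (U k)).
have ga0 k : 0 <= ga k by rewrite fine_ge0.
pose x k := ga k + eps / 2 / (2 ^ k.+1)%:R.
have x0 k : 0 < x k by rewrite ltr_wpDl// !divr_gt0// ltr0n expn_gt0.
have rs k : (x k `^ s^-1) `^ s = x k.
  by rewrite -powRrM mulVf ?gt_eqF// powRr1 ?ltW.
exists U, (fun k => x k `^ s^-1); split=> //.
- by move=> k; exact: powR_gt0.
- move=> k y z Uy Uz.
  have Un : U k != set0 by apply/set0P; exists y.
  have h : enorm (y - z) `^ s <= ga k.
    rewrite -lee_fin -gfin /hausdorff_gauge (negbTE Un) -poweR_EFin.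
    apply: gt0_ler_poweR; rewrite ?in_itv /= ?leey ?andbT ?(ltW s0)//.
    + by rewrite lee_fin; exact: enorm_ge0.
    + by apply: ediam_ge0; exists y.
    + exact: ediam_ge.
  have h2 : enorm (y - z) `^ s <= x k.
    by rewrite (le_trans h)// lerDl !divr_ge0// ltW.
  have := @ge0_ler_powR R s^-1 _ (enorm (y - z) `^ s) (x k).
  rewrite invr_ge0 (ltW s0) => /(_ isT); rewrite !nnegrE powR_ge0 (ltW (x0 k)) => /(_ isT isT h2).
  rewrite -powRrM mulfV ?gt_eqF// powRr1//; exact: enorm_ge0.
- rewrite (eq_esum (fun k _ => congr1 EFin (rs k))).
  have -> : (\esum_(k in [set: nat]) (x k)%:E =
      \sum_(0 <= k <oo) (hausdorff_gauge s (U k) + (eps / 2 / (2 ^ k.+1)%:R)%:E))%E.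
    rewrite nneseries_esum; last first.
      by move=> k _; rewrite adde_ge0// lee_fin !divr_ge0// ltW.
    rewrite (_ : [set x | xpredT x] = [set: nat]); last by apply/seteqP; split.
    by apply: eq_esum => k _; rewrite [in RHS]gfin -EFinD.
  apply: (le_trans (epsilon_trick xpredT ge0 (ltW e20))).
  rewrite (_ : eps%:E = (eps / 2)%:E + (eps / 2)%:E)%E; last by rewrite -EFinD -splitr.
  by rewrite leeD2r// ltW.
Qed.

(** Otherwise words without a prefix in [T] exist at every length. As [F] is finite, a word with
    arbitrarily long such extensions has a one-letter extension with the same property, and
    iteration gives a sequence avoiding [T]. *)
Lemma konig_bar (E : eqType) (e : rel E) (F : seq E) (T : set (seq E)) :
  (forall tau : nat -> E, (forall n, tau n \in F /\ e (tau n) (tau n.+1)) ->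
     exists n, T (mkseq tau n)) ->
  exists n, forall a : seq E, size a = n -> sorted e a -> (forall x, x \in a -> x \in F) ->
    exists2 m, (m <= n)%N & T (take m a).
Proof.
move=> bar; apply: contrapT => nbar.
pose bad a := [/\ sorted e a, forall x, x \in a -> x \in F & forall m, ~ T (take m a)].
have bad_take m a : bad a -> bad (take m a).
  move=> [sa aF aT]; split; first exact: take_sorted.
    by move=> x /mem_take; exact: aF.
  by move=> k; rewrite -take_min; exact: aT.
pose inft a := forall n, exists b, size b = n /\ bad (a ++ b).
have inf0 : inft [::].
  move=> n; apply: contrapT => nb; apply: nbar; exists n => a sa ea aF.
  apply: contrapT => aT; apply: nb; exists a; split=> //; split=> // m Tm; apply: aT.
  have [mn|nm] := leqP m n; first by exists m.
  by exists n => //; rewrite -{1}sa take_size; move: Tm; rewrite take_oversize// sa ltnW.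
have step a : exists x, inft a -> inft (rcons a x).
  have [ia|nia] := pselect (inft a); last first.
    have [b [sb _]] := inf0 1%N.
    by case: b sb => [//|x b] _; exists x.
  apply: contrapT => nx.
  (* Each letter fails from some length on; the maximum of these lengths over [F] fails for all
     letters at once, since bad words are closed under prefixes. *)
  have /choice[n Hn] : forall x, exists n, ~ exists b, size b = n /\ bad (rcons a x ++ b).
    move=> x; apply/existsNP => h; apply: nx; exists x => _; exact: h.
  have [b [sb bb]] := ia (\max_(x <- F) n x).+1.
  case: b sb bb => [//|x b] [sb] bb.
  apply: (Hn x); exists (take (n x) b); split.
    rewrite size_takel// sb.
    apply: (leq_bigmax_seq (F := n)) => //.
    by have [_ h _] := bb; apply: h; rewrite mem_cat inE eqxx orbT.
  have := bad_take (size (rcons a x) + n x)%N _ bb.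
  by rewrite -cat_rcons take_cat ltnNge leq_addr /= addKn.
have /choice[nx Hnx] := step.
pose w n := iter n (fun a => rcons a (nx a)) [::].
have iw n : inft (w n) by elim: n => //= n IH; exact: Hnx.
have bw n : bad (w n).
  by have [b [/size0nil -> +]] := iw n 0%N; rewrite cats0.
pose tau n := nx (w n).
have wtau n : w n = mkseq tau n by elim: n => //= n IH; rewrite mkseqS -IH.
have [|n Tn] := bar tau.
  move=> n; have [se wF _] := bw n.+2; split.
    by have [_ h _] := bw n.+1; apply: h => /=; rewrite mem_rcons inE eqxx.
  move: se; rewrite wtau => /(sortedP (tau 0%N))/(_ n); rewrite size_mkseq => /(_ (leqnn _)).
  by rewrite !nth_mkseq.
by have [_ _ /(_ n)] := bw n; apply; rewrite wtau take_oversize// size_mkseq.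
Qed.

(** * The lower bound by stopped words *)

Section LowerBound.
Context {disp : measure_display} {Omega : measurableType disp} {R : realType}
  {d : nat} {V : finType} {E : countType} {ini ter : E -> V}.
Variables (P : probability Omega R) (theta : Omega -> Omega).
Variable Phi : rgdms Omega R d ini ter.
Variables (good : set Omega) (g : seq E -> Omega -> R) (K kp : R) (mm : E -> R).
Hypothesis est : sys_est P theta Phi good g K kp mm.
Variables (e0 : E) (N : nat) (conn : E -> E -> seq E) (F0 : seq E).
Hypothesis N0 : (0 < N)%N.
Hypothesis conn_size : forall e e', size (conn e e') = N.
Hypothesis conn_wt : forall e e', wt ini ter (conn e e') (ter e) (ini e').
Hypothesis conn_F0 : forall e e' x, x \in conn e e' -> x \in F0.
Local Notation wt := (wt ini ter).
Local Notation Z F s := (@Z _ Omega R V E ini ter g F s).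
Local Notation lwords := (@lwords V E ini ter).
Local Notation gapC := (gapC K mm N F0).
Variables (s : R) (sF : seq E) (w : Omega) (c0 : R).
Hypothesis s0 : 0 < s.
Hypothesis F0F : forall e, e \in F0 -> e \in sF.
Hypothesis gw : good w.
Hypothesis c00 : 0 < c0.
Local Notation F := [set` sF].
Hypothesis Zc : forall n, (c0%:E <= Z F s n.+1 w)%E.

Let good_iter n w' : good w' -> good (iter n theta w').
Proof. by elim: n => //= n IH /IH h; exact: (est_theta est h). Qed.

Let expR_ge0E (x : R) : (0 <= (expR x)%:E)%E. Proof. by rewrite lee_fin expR_ge0. Qed.

(* Summing over the first cutting prefix [t] of a long word of length [n] gives
   [Z_n <= C * sum_t expR (s * g t w) * Z_(n - |t|)], and the lower bound [c0] on
   [Z_|t|] makes the last factor at most a constant times [Z_n] itself. *)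
Lemma cut_sum : exists2 C : R, 0 <= C & forall (T : set (seq E)) n0,
  (forall t, T t -> (0 < size t)%N) ->
  (forall a, lwords F n0 a -> exists2 m, (m <= n0)%N & T (take m a)) ->
  (1 <= C%:E * \esum_(t in T) (expR (s * g t w))%:E)%E.
Proof.
have [MN MN0 HMN] := Z_finite_alph est e0 (ltW s0) N (finite_seq sF).
pose B := expR (s * gapC) / c0.
have B0 : 0 <= B by rewrite divr_ge0 ?expR_ge0// ltW.
have BE : B = expR (s * gapC) / c0 by [].
clearbody B.
exists (expR (s * K) * (expR (s * K) * B * MN)); first by rewrite !mulr_ge0 ?expR_ge0.
(* A cut within the first [n0] letters leaves room for a gap of length [N] and at least one more
   letter. *)
move=> T n0 Tsz Tcut; pose n := (n0 + N.+1)%N.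
have [Mn Mn0 HMn] := Z_finite_alph est e0 (ltW s0) n (finite_seq sF).
have Zfin k w' : good w' -> Z F s k w' = (fine (Z F s k w'))%:E.
  move=> gw'; have [Mk _ HMk] := Z_finite_alph est e0 (ltW s0) k (finite_seq sF).
  rewrite fineK// ge0_fin_numE ?Z_ge0//.
  by apply: le_lt_trans (HMk _ gw') _; exact: ltry.
pose z := fine (Z F s n w).
have z0 : 0 < z.
  rewrite -lte_fin -Zfin//; apply: (@lt_le_trans _ _ c0%:E); first by rewrite lte_fin.
  by rewrite /n addnS; exact: Zc.
(* The remainder has length [N + m]. Its first part is bounded by [MN]. For the second, gluing shows
   that Z_l times Z_m is at most a constant times Z_n, and Z_l is at least [c0]. *)
have step1 l : (0 < l <= n0)%N -> (Z F s (n - l) (iter l theta w) <= (expR (s * K) * B * MN * z)%:E)%E.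
  move=> /andP[l0 ln0]; pose m := (n - l - N)%N.
  have m0 : (0 < m)%N by rewrite /m /n; clear -ln0; lia.
  have -> : (n - l = N + m)%N by rewrite /m /n; clear -ln0; lia.
  have nE : (n = l + N + m)%N by rewrite /m /n; clear -ln0; lia.
  have Zm : (Z F s m (iter N theta (iter l theta w)) <= (B * z)%:E)%E.
    rewrite -iterD [(N + l)%N]addnC.
    have gw2 := good_iter (l + N) gw.
    have m10 : 0 <= fine (Z F s m (iter (l + N) theta w)) by rewrite fine_ge0// Z_ge0.
    have := Z_gap est e0 N0 conn_size conn_wt conn_F0 (F := F) F0F (ltW s0) gw l0 m0 m10.
    rewrite -Zfin// => /(_ (lexx _)); rewrite -nE [in X in (_ <= X)%E -> _]Zfin// -/z.
    have := Zc l.-1; rewrite prednK// (Zfin l)// (Zfin m)// -EFinM !lee_fin.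
    move: (fine (Z F s l w)) (fine (Z F s m (iter (l + N) theta w))) m10 => zl m1 m10 h1 h2.
    rewrite BE mulrAC ler_pdivlMr//.
    have h3 : expR (- (s * gapC)) * m1 * c0 <= z.
      by apply: le_trans h2; rewrite ler_wpM2l// mulr_ge0// expR_ge0.
    have := ler_wpM2l (expR_ge0 (s * gapC)) h3.
    by rewrite !mulrA -expRD subrr expR0 mul1r.
  have Bz0 : 0 <= B * z by rewrite mulr_ge0// ltW.
  apply: le_trans (Z_upper est e0 (ltW s0) (good_iter l gw) Bz0 Zm) _.
  apply: (@le_trans _ _ ((expR (s * K) * (B * z))%:E * MN%:E)%E).
    by apply: lee_wpmul2l; [rewrite lee_fin mulr_ge0// expR_ge0|apply: HMN; exact: good_iter].
  rewrite -EFinM lee_fin (_ : expR (s * K) * (B * z) * MN = expR (s * K) * B * MN * z)//; ring.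
have /choice[mf Hmf] : forall a, exists m, lwords F n a -> (m <= n0)%N /\ T (take m a).
  move=> a; have [la|nla] := pselect (lwords F n a); last by exists 0%N.
  have la' : lwords F n0 (take n0 a).
    case: la => [[sa wa] aF]; split; first split.
    - by rewrite size_takel// sa leq_addr.
    - exact: take_sorted.
    - by move=> e /mem_take; exact: aF.
  by have [m mn Tm] := Tcut _ la'; exists m => _; rewrite take_takel in Tm.
pose T1 := [set t | T t /\ (size t <= n0)%N].
pose x t := expR (s * K) * expR (s * g t w).
have x0 t : 0 <= x t by rewrite mulr_ge0// expR_ge0.
pose y (t b : seq E) := expR (s * g b (iter (size t) theta w)).
have main : (Z F s n w <= \esum_(t in T1) \esum_(b in lwords F (n - size t)) ((x t)%:E * (y t b)%:E))%E.
  rewrite esum_esum; last by move=> t b _ _; rewrite mule_ge0// lee_fin ?expR_ge0.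
  have szf a : lwords F n a -> size (take (mf a) a) = mf a.
    move=> la; have [h _] := Hmf a la; case: la => [[sa _] _].
    by rewrite size_takel// sa (leq_trans h)// leq_addr.
  apply: (@esum_le_inj _ _ _ _ _ (fun a => (take (mf a) a, drop (mf a) a))).
  - move=> a la; have [h1 h2] := Hmf a la; have sz := szf a la.
    split; first by split=> //=; rewrite sz.
    case: la => [[sa wa] aF]; split; first split => /=.
    + by rewrite size_drop sz sa.
    + exact: drop_sorted.
    + by move=> e /mem_drop; exact: aF.
  - by move=> a a' _ _ [h1 h2]; rewrite -(cat_take_drop (mf a) a) h1 h2 cat_take_drop.
  - move=> a la; have [u [v wa]] := words_wt e0 la.1.
    rewrite /= -EFinM lee_fin /x /y -!expRD ler_expR.
    move: wa; rewrite -{1}(cat_take_drop (mf a) a) => /wt_cat[v' w1 w2].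
    have := g_catr est gw w1 w2; rewrite cat_take_drop => h.
    have := ler_wpM2l (ltW s0) h; lra.
  - by move=> [t b] /=; rewrite mule_ge0// lee_fin ?expR_ge0.
have D0 : 0 <= expR (s * K) * B * MN * z by rewrite !mulr_ge0 ?expR_ge0// ltW.
have main2 : (Z F s n w <= (expR (s * K) * (expR (s * K) * B * MN * z))%:E *
    \esum_(t in T) (expR (s * g t w))%:E)%E.
  apply: (le_trans main).
  apply: (@le_trans _ _ (\esum_(t in T1) ((expR (s * K) * (expR (s * K) * B * MN * z))%:E * (expR (s * g t w))%:E))%E).
    apply: le_esum => t [Tt tn].
    rewrite esumZ; [|by rewrite mulr_gt0// expR_gt0|by move=> b; exact: expR_ge0E].
    have tl : (0 < size t <= n0)%N by rewrite Tsz.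
    apply: (@le_trans _ _ ((x t)%:E * (expR (s * K) * B * MN * z)%:E)%E).
      by rewrite lee_wpmul2l ?lee_fin//; exact: step1.
    by rewrite -!EFinM lee_fin /x mulrAC.
  apply: (@le_trans _ _ ((expR (s * K) * (expR (s * K) * B * MN * z))%:E * \esum_(t in T1) (expR (s * g t w))%:E)%E).
    by apply: esumZ_le => [|t]; [rewrite mulr_ge0// expR_ge0|exact: expR_ge0E].
  apply: lee_wpmul2l; first by rewrite lee_fin mulr_ge0// expR_ge0.
  by apply: esum_subset => [t []|t].
move: main2; rewrite Zfin// -/z => main2.
(* The common factor [z] is positive and finite; cancelling it leaves a bound free of [n]. *)
rewrite -(@lee_pmul2l _ z%:E)// mule1; apply: (le_trans main2).
rewrite muleA -EFinM (_ : z * _ = expR (s * K) * (expR (s * K) * B * MN * z))//; ring.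
Qed.

Definition first_passage (r : R) : set (seq E) :=
  [set t | [/\ (0 < size t)%N, expR (g t w) <= r &
    forall m, (0 < m < size t)%N -> r < expR (g (take m t) w)]].

Lemma first_passage_prefix r t t' : first_passage r t -> first_passage r t' ->
  prefix t t' -> t = t'.
Proof.
move=> [t0 tr _] [_ _ t'm]; rewrite prefixE => /eqP tt'.
have [lt|le] := ltnP (size t) (size t'); last by rewrite -tt' take_oversize.
have := t'm (size t); rewrite t0 lt tt' => /(_ isT).
by rewrite ltNge tr.
Qed.

(** The prefix before the last letter still exceeds [r], and one letter of the finite alphabet loses
    at most the factor [expR (- cF K mm sF)]. For a single letter that prefix is empty and [r <= 1]
    takes over. *)
Lemma first_passage_ge r t u v : first_passage r t -> r <= 1 -> wt t u v ->
  (forall e, e \in t -> e \in sF) -> expR (- cF K mm sF) * r <= expR (g t w).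
Proof.
move=> [t0 tr tm] r1 wtt tF.
case/lastP: t t0 tr tm wtt tF => [//|b e] _ tr tm.
rewrite -cats1 => /wt_cat[v' wb we] tF.
have eF : mm e + K <= cF K mm sF.
  by apply: mm_cF; apply: tF; rewrite mem_cat inE eqxx orbT.
have ge0 := est_letter est e (good_iter (size b) gw).
have K0 := est_K est.
case: b tr tm wb tF ge0 => [|e' b] tr tm wb tF ge0.
  apply: (@le_trans _ _ (expR (- cF K mm sF) * 1)); first by rewrite ler_wpM2l ?expR_ge0.
  by rewrite mulr1 ler_expR; move: ge0 => /=; lra.
have := tm (size (e' :: b)); rewrite size_rcons ltnSn /= => /(_ isT).
rewrite -cats1 take_size_cat// => rb.
have := g_catl est gw wb we => h.
apply: (@le_trans _ _ (expR (- cF K mm sF) * expR (g (e' :: b) w))).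
  by rewrite ler_wpM2l ?expR_ge0// ltW.
rewrite -expRD ler_expR; lra.
Qed.

Lemma limit_set_not_null : hausdorff_measure s (limit_set theta Phi w) <> 0%E.
Proof.
move=> H0; have [C C0 HC] := cut_sum.
have [I HI] := est_packing est (expR_gt0 (- cF K mm sF)).
pose Q : R := #|I|%:R.
have Q0 : 0 <= Q by [].
have CQ : 0 <= C * Q by exact: mulr_ge0.
(* Makes [C * Q * eps] smaller than 1, which contradicts [cut_sum], and [eps] at most 1, so that all
   radii are at most 1. *)
pose eps := (2 * (C * Q + 1))^-1.
have eps0 : 0 < eps by rewrite invr_gt0 mulr_gt0// ltr_wpDl.
have epsC : (C * Q + 1) * eps = 2^-1.
  by rewrite /eps invfM mulrCA mulfV ?mulr1// gt_eqF// ltr_wpDl.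
have eps1 : eps <= 1 by have := mulr_ge0 CQ (ltW eps0); lra.
have [U [r [cov r0 Ur rs]]] := null_cover s0 eps0 H0.
have r1 k : r k <= 1.
  have h : r k `^ s <= 1.
    rewrite -lee_fin; apply: le_trans (le_trans rs _); last by rewrite lee_fin.
    by apply: (@esum_gt0_ge _ _ _ (fun k => (r k `^ s)%:E)) => // i; rewrite lee_fin powR_ge0.
  have := @ge0_ler_powR R s^-1 _ (r k `^ s) 1.
  rewrite invr_ge0 (ltW s0) => /(_ isT); rewrite !nnegrE powR_ge0 ler01 => /(_ isT isT h).
  by rewrite -powRrM mulfV ?gt_eqF// powRr1 ?powR1// ltW.
pose T k t := first_passage (r k) t /\ exists tau : nat -> E,
  [/\ shift_space ini ter tau, forall n, tau n \in sF, t = mkseq tau (size t) &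
      U k (coding theta Phi w tau)].
have /choice[f Hf] : forall k, exists f : seq E -> I, forall t t', T k t -> T k t' -> f t = f t' -> t = t'.
  move=> k.
  have [p0 Hp0] : exists p0, forall x, U k x -> enorm (x - p0) <= r k.
    have [[p0 Up]|nU] := pselect (U k !=set0).
      by exists p0 => x Ux; exact: (Ur k).
    by exists 0 => x Ux; exfalso; apply: nU; exists x.
  apply: (HI w (r k) [set t | T k t] p0 gw (r0 k)).
  - move=> t [ft [tau [st tF te _]]].
    have tr : expR (g t w) <= r k by case: ft.
    rewrite tr andbT; have wtt := wt_mkseq (size t) st; rewrite -te in wtt.
    apply: first_passage_ge ft (r1 k) wtt _ => e.
    by rewrite te => /mapP[i _ ->].
  - by move=> t t' [ft _] [ft' _]; exact: first_passage_prefix ft ft'.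
  - move=> t [_ [tau [st _ te Ut]]]; exists tau; split=> //; exact: Hp0.
pose TT := [set t | exists k, T k t].
have TT0 t : TT t -> (0 < size t)%N by move=> [k [[]]].
have [n0 Hn0] : exists n, forall a : seq E, size a = n -> sorted (adm ini ter) a ->
    (forall x, x \in a -> x \in sF) -> exists2 m, (m <= n)%N & TT (take m a).
  apply: konig_bar => tau tauF.
  have st : shift_space ini ter tau by move=> n; have [] := tauF n.
  have tF n : tau n \in sF by have [] := tauF n.
  (* The coded point lies in some [U k], and the contraction of the prefixes tends to 0, so a first
     passage below [r k] exists. *)
  have [k _ Uk] : (\bigcup_k U k) (coding theta Phi w tau) by apply: cov; exists tau.
  pose Pn n := (0 < n)%N && (expR (g (mkseq tau n) w) <= r k).
  have exP : exists n, Pn n.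
    have [n Hn] := eventually_le_mul (- ln (r k)) (est_kp est).
    exists n.+1; rewrite /Pn /= -[leRHS]lnK ?posrE// ler_expR.
    have := est_ub est gw (wt_mkseq n.+1 st); rewrite size_mkseq.
    have := Hn n.+1 (leqnSn n); lra.
  case: (ex_minnP exP) => n /andP[n0 nr] nmin.
  exists n, k; split; last by exists tau; rewrite size_mkseq; split.
  rewrite /first_passage /= size_mkseq; split=> // m' /andP[m'0 m'n].
  rewrite (_ : take m' (mkseq tau n) = mkseq tau m'); last first.
    by rewrite /mkseq -map_take take_iota (minn_idPl (ltnW m'n)).
  rewrite ltNge; apply/negP => h.
  by have := nmin m'; rewrite /Pn m'0 h => /(_ isT); rewrite leqNgt m'n.
have /(HC TT n0 TT0) : forall a, lwords F n0 a -> exists2 m, (m <= n0)%N & TT (take m a).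
  by move=> a [[sa wa] aF]; exact: Hn0.
apply/negP; rewrite -ltNge.
(* A word is recovered from an index [k] and its packing label, so each [k] is charged at most
   [#|I|] times. *)
have sumT : (\esum_(t in TT) (expR (s * g t w))%:E <= (Q * eps)%:E)%E.
  have /choice[kf Hk] : forall t, exists k, TT t -> T k t.
    by move=> t; have [[k Tk]|n] := pselect (TT t); [exists k|exists 0%N].
  apply: (@le_trans _ _ (\esum_(i in [set: I]) \esum_(k in [set: nat]) (r k `^ s)%:E)%E).
    rewrite esum_esum; last by move=> i k _ _; rewrite lee_fin powR_ge0.
    apply: (@esum_le_inj _ _ _ _ _ (fun t => (f (kf t) t, kf t))).
    - by move=> t _; split.
    - move=> t t' Tt Tt' [fe ke]; have h := Hk _ Tt; have h' := Hk _ Tt'.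
      by rewrite -ke in h' fe; exact: Hf h h' fe.
    - move=> t Tt; have [[_ tr _] _] := Hk _ Tt.
      rewrite lee_fin /= mulrC expRM; apply: ge0_ler_powR; rewrite ?nnegrE ?expR_ge0 ?(ltW s0) ?(ltW (r0 _))//.
    - by move=> p; rewrite lee_fin powR_ge0.
  apply: (@le_trans _ _ (\esum_(i in [set: I]) eps%:E)%E); first exact: le_esum.
  by rewrite esum_const// lee_fin ltW.
apply: (@le_lt_trans _ _ (C%:E * (Q * eps)%:E)%E).
  by rewrite lee_wpmul2l// lee_fin.
rewrite -EFinM lte_fin; lra.
Qed.

End LowerBound.

(** For sets of diameter at most [delta], passing from exponent [s] to [q] multiplies the gauge by
    at most delta ^ (q - s), so a cover with small enough sum at [s] serves at [q]. *)
Lemma hausdorff_null_mono (R : realType) (d : nat) (s q : R) (A : set 'rV[R]_d) :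
  0 <= s -> s < q -> hausdorff_measure s A = 0%E -> hausdorff_measure q A = 0%E.
Proof.
move=> s0 sq H0; apply/eqP; rewrite eq_le hausdorff_measure_ge0 andbT.
have q0 : 0 < q by exact: le_lt_trans sq.
apply: ge_ereal_sup => _ [delta /= d0 <-].
apply/lee_addgt0Pr => eps eps0; rewrite add0e.
have dq : 0 < delta `^ (q - s) by exact: powR_gt0.
have : (hausdorff_premeasure s delta A < (eps / delta `^ (q - s))%:E)%E.
  apply: (@le_lt_trans _ _ 0%E); last by rewrite lte_fin divr_gt0.
  by rewrite -H0; apply: ereal_sup_ubound; exists delta.
move=> /ereal_inf_lt[_ [U [AU Ud] <-]] Ue.
have ge0 t k : (0 <= hausdorff_gauge t (U k))%E by exact: gauge_ge0.
apply: (@le_trans _ _ (\sum_(0 <= k <oo) hausdorff_gauge q (U k))%E).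
  by apply: ereal_inf_lbound; exists U.
apply: (@le_trans _ _ (\sum_(0 <= k <oo) ((delta `^ (q - s))%:E * hausdorff_gauge s (U k)))%E).
  apply: lee_nneseries => // k _; rewrite /hausdorff_gauge.
  case: ifPn => [_|/set0P U0]; first by rewrite mule0.
  have := ediam_ge0 U0; have := Ud k.
  case: (ediam (U k)) => [D| |]// Dd' D0'.
  have Dd : D <= delta by rewrite -lee_fin.
  have D0 : 0 <= D by rewrite -lee_fin.
  rewrite !poweR_EFin -EFinM lee_fin.
  (* The exponents cannot be added at base 0, where the power is 1 for exponent 0; diameter 0 is
     therefore treated apart. *)
  have [->|Dn] := eqVneq D 0.
    by rewrite powR0 ?gt_eqF// mulr_ge0// powR_ge0.
  rewrite -{1}(subrK s q) (@powRD _ D); last by rewrite Dn implybT.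
  apply: ler_wpM2r; first exact: powR_ge0.
  by apply: ge0_ler_powR => //; rewrite ?nnegrE ?subr_ge0 (ltW sq, ltW d0).
rewrite nneseriesZl; last by move=> k _.
by rewrite muleC -lee_pdivlMr// -EFinM ltW.
Qed.

(** * The two inequalities for the dimension *)

Theorem theorem3p8 (R : realType) (d : nat) (d_ge1 : (1 <= d)%N)
    (disp : measure_display) (Omega : measurableType disp)
    (P : probability Omega R) (P_complete : measure_is_complete P)
    (theta : Omega -> Omega) (theta_bimeas : bimeasurable theta)
    (theta_pres : measure_preserving P theta) (theta_erg : ergodic P theta)
    (V : finType) (E : countType) (E_nonempty : [set: E] !=set0)
    (ini ter : E -> V) (E_prim : finitely_primitive ini ter)
    (Phi : rgdms Omega R d ini ter)
    (Phi_conformal : conformal P Phi) (Phi_normal : normal P Phi)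
    (xi : E -> nat -> E)
    (xi_spec : forall e, shift_space ini ter (xi e) /\ xi e 0%N = e) :
  \forall omega \ae P,
    hausdorff_dim (limit_set theta Phi omega) =
    ereal_inf [set s%:E | s in
      [set s : R | 0 <= s /\ (pressure P theta Phi xi s <= 0)%E]].
Proof.
have mth : measurable_fun [set: Omega] theta by case: theta_bimeas => ? [].
have [e0 _] := E_nonempty.
have [N [conn [F0 [N0 e0F0 csz cwt cF0]]]] := primitive_data e0 E_prim.
have [good [g [K [kp [mm est]]]]] := conformal_estimates d_ge1 mth theta_pres Phi_conformal Phi_normal.
set S := [set s : R | _]; set p := ereal_inf _.
have gae := est_ae est.
(* Rational exponents leave only countably many null sets; monotonicity in the exponent recovers the
   others at the end. *)
have lower : \forall w \ae P, forall q : rat, 0 < (ratr q : R) -> ((ratr q)%:E < p)%E ->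
    hausdorff_measure (ratr q : R) (limit_set theta Phi w) <> 0%E.
  apply: ae_forall_count => q.
  have [q0|nq0] := pselect (0 < (ratr q : R)); last by apply: aeW => w /nq0.
  have [qp|nqp] := pselect ((ratr q)%:E < p)%E; last by apply: aeW => w _ /nqp.
  have q_ge0 := ltW q0.
  have pq : (0 < pressure P theta Phi xi (ratr q))%E.
    rewrite ltNge; apply/negP => pq; move: qp; rewrite ltNge => /negP; apply.
    by apply: ereal_inf_lbound; exists (ratr q).
  have [sF F0F HF] := pressure_gt0 est P_complete mth theta_pres theta_erg N0 e0F0 csz cwt cF0
    xi_spec q_ge0 pq.
  move: HF gae; apply: filterS2 => w [c c0 Hc] gw _ _.
  exact: (limit_set_not_null est e0 N0 csz cwt cF0 q0 F0F gw c0 Hc).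
have upper : \forall w \ae P, (hausdorff_dim (limit_set theta Phi w) <= p)%E.
  have [[s1 Ss1]|nS] := pselect (S !=set0); last first.
    apply: aeW => w; rewrite /p (_ : S = set0) ?image_set0 ?ereal_inf0 ?leey//.
    by apply/seteqP; split=> // s Ss; apply: nS; exists s.
  have p0 : (0 <= p)%E by apply: le_ereal_inf_tmp => _ [s [s0 _] <-]; rewrite lee_fin.
  have ps1 : (p <= s1%:E)%E by apply: ereal_inf_lbound; exists s1.
  have pE : p = (fine p)%:E.
    by rewrite fineK// ge0_fin_numE//; exact: le_lt_trans ps1 (ltry _).
  (* [pressure_le0] needs an exponent strictly above one with nonpositive pressure, so [p] is
     approached from above along a countable sequence. *)
  have h : \forall w \ae P, forall j : nat,
      (hausdorff_dim (limit_set theta Phi w) <= (fine p + j.+1%:R^-1)%:E)%E.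
    apply: ae_foralln => j.
    have : (p < (fine p + j.+1%:R^-1)%:E)%E.
      by rewrite {1}pE lte_fin ltrDl invr_gt0.
    move=> /ereal_inf_lt[_ [s [s0 ps] <-]]; rewrite lte_fin => ss'.
    have s'0 := le_lt_trans s0 ss'.
    have := pressure_le0 est P_complete mth theta_pres theta_erg N0 e0F0 csz cwt cF0
      xi_spec s0 ss' ps.
    move: gae; apply: filterS2 => w gw HZ.
    apply: ereal_inf_lbound; eexists; last reflexivity.
    by split; [exact: ltW|exact: (limit_set_null est gw s'0 HZ)].
  move: h; apply: filterS => w h; apply/lee_addgt0Pr => eps eps0.
  apply: le_trans (h (Num.truncn eps^-1)) _.
  rewrite pE -EFinD lee_fin lerD2l invf_ple ?posrE// ltW//.
  exact: truncnS_gt.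
move: lower upper; apply: filterS2 => w lower upper.
apply/eqP; rewrite eq_le upper /=.
apply: le_ereal_inf_tmp => _ [s [s0 Hs] <-].
rewrite leNgt; apply/negP => sp.
(* [p] may be [+oo], so a real number is inserted before a rational one is chosen. *)
have [s' ss' s'p] : exists2 s', s < s' & (s'%:E <= p)%E.
  case ep : p sp => [r| |]//; first by rewrite lte_fin => sr; exists r.
  by move=> _; exists (s + 1); [rewrite ltrDl|exact: leey].
have [q] := rat_in_itvoo ss'; rewrite in_itv /= => /andP[sq qs'].
apply: (lower q).
- exact: le_lt_trans sq.
- by apply: lt_le_trans s'p; rewrite lte_fin.
- exact: hausdorff_null_mono s0 sq Hs.
Qed.
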